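(* Let $d\ge2$. Then there exists a Hilbertian (orthonormal) basis $(\varphi_n)_{n\ge1}$ of $L^2(\mathbb R^d)$ consisting of eigenfunctions of the harmonic oscillator $H$, $H\varphi_n=\lambda_n\varphi_n$, with $\|\varphi_n\|_{L^2(\mathbb R^d)}=1$, and such that for some $M>0$ and all $n\ge1$, $$\|\varphi_n\|_{L^\infty(\mathbb R^d)}\le M\lambda_n^{-d/4}(1+\log\lambda_n)^{1/2}.$$
   Context: $H=-\Delta+|x|^2=\sum_{j=1}^d(-\partial_j^2+x_j^2)$ on $L^2(\mathbb R^d)$; $\lambda_n$ denotes the eigenvalue of $H$ associated with $\varphi_n$ (eigenvalues in non-decreasing order, repeated with multiplicity). *)

(* Defs.v *)
From HB Require Import structures.
From mathcomp Require Import all_boot all_order all_algebra.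
From mathcomp Require Import all_classical all_reals all_analysis.
From mathcomp Require Import complex.

Set Implicit Arguments.
Unset Strict Implicit.
Unset Printing Implicit Defensive.
Import Order.TTheory GRing.Theory Num.Theory.
Import numFieldNormedType.Exports.

Local Open Scope classical_set_scope.
Local Open Scope ring_scope.
Local Open Scope complex_scope.

Definition rV_display : measure_display. Proof. exact: default_measure_display. Qed.

Section measurable_rV.
Variables (R : realType) (n : nat).

Definition rV_coor (i : 'I_n) (x : 'rV[R]_n) : measurableTypeR R := x 0 i.

Let rV_set0 : g_sigma_preimage rV_coor set0.
Proof. exact: sigma_algebra0. Qed.

Let rV_setC A : g_sigma_preimage rV_coor A -> g_sigma_preimage rV_coor (~` A).
Proof. exact: sigma_algebraC. Qed.

Let rV_bigcup (F : _^nat) : (forall i, g_sigma_preimage rV_coor (F i)) ->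
  g_sigma_preimage rV_coor (\bigcup_i (F i)).
Proof. exact: sigma_algebra_bigcup. Qed.

(* the product sigma-algebra, i.e. the Borel sigma-algebra of R^n *)
HB.instance Definition _ := @isMeasurable.Build rV_display
  'rV[R]_n (g_sigma_preimage rV_coor) rV_set0 rV_setC rV_bigcup.

End measurable_rV.

Lemma measurable_rV_coor (R : realType) n (i : 'I_n) :
  measurable_fun [set: 'rV[R]_n] (@rV_coor R n i).
Proof.
move=> _ Y mY; rewrite setTI; apply: sub_sigma_algebra => /=.
rewrite -bigcup_seq/=; exists i => /=; first by rewrite mem_index_enum.
by exists Y => //; rewrite setTI.
Qed.

Lemma measurable_fun_rVP (R : realType) d (T : measurableType d) n
    (f : T -> 'rV[R]_n) :
  (forall i, measurable_fun [set: T] (@rV_coor R n i \o f)) ->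
  measurable_fun [set: T] f.
Proof.
move=> mf.
have H : g_sigma_preimage (fun i => @rV_coor R n i \o f) `<=` measurable.
  apply: smallest_sub; first exact: sigma_algebra_measurable.
  move=> A; rewrite -bigcup_seq => -[i _ [B mB <-]].
  exact: mf.
move=> _ A mA; apply: H; rewrite g_sigma_preimage_comp.
by exists A.
Qed.

Section lebesgue_rV.
Variable R : realType.

Definition rV_cons n (p : measurableTypeR R * 'rV[R]_n) : 'rV[R]_n.+1 :=
  \row_i oapp (fun j => p.2 0 j) p.1 (unlift ord0 i).

Definition rV_uncons n (x : 'rV[R]_n.+1) : measurableTypeR R * 'rV[R]_n :=
  (x 0 ord0, \row_j x 0 (lift ord0 j)).

Lemma rV_unconsK n : cancel (@rV_uncons n) (@rV_cons n).
Proof.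
move=> x; apply/rowP => i; rewrite mxE /=.
by case: unliftP => [j ->|->] /=; rewrite ?mxE.
Qed.

Lemma rV_consK n : cancel (@rV_cons n) (@rV_uncons n).
Proof.
move=> [t x]; rewrite /rV_uncons /rV_cons mxE unlift_none /=; congr pair.
by apply/rowP => j; rewrite !mxE liftK.
Qed.

Lemma measurable_rV_cons n : measurable_fun [set: _] (@rV_cons n).
Proof.
apply: measurable_fun_rVP => i.
case: (unliftP ord0 i) => [j ->|->].
  rewrite (_ : _ \o _ = @rV_coor R n j \o snd).
    by apply: measurableT_comp => //; exact: measurable_rV_coor.
  by apply/funext => -[t x]; rewrite /rV_coor /= mxE liftK.
rewrite (_ : _ \o _ = fst) //.
by apply/funext => -[t x]; rewrite /rV_coor /= mxE unlift_none.
Qed.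

Lemma measurable_rV_uncons n : measurable_fun [set: _] (@rV_uncons n).
Proof.
apply/measurable_fun_pairP; split; first exact: (measurable_rV_coor ord0).
apply: measurable_fun_rVP => i.
rewrite (_ : _ \o _ = @rV_coor R n.+1 (lift ord0 i)).
  exact: measurable_rV_coor.
by apply/funext => x; rewrite /rV_coor /= mxE.
Qed.

(* Lebesgue measure on R^(n+1) from Lebesgue measure on R^n, through the
   bijection R * R^n -> R^(n+1) *)
Definition lebesgue_rV_step n (mu : {sigma_finite_measure set 'rV[R]_n -> \bar R})
    : set 'rV[R]_n.+1 -> \bar R :=
  pushforward (@lebesgue_measure R \x mu)%E (@rV_cons n).

Section step.
Variables (n : nat) (mu : {sigma_finite_measure set 'rV[R]_n -> \bar R}).

HB.instance Definition _ := Measure.copy (lebesgue_rV_step mu)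
  (measure_function_pushforward__canonical__measure_function_Measure
     (@lebesgue_measure R \x mu)%E (@measurable_rV_cons n)).

Let sigma_finite_step : sigma_finite setT (lebesgue_rV_step mu).
Proof.
have /sigma_finiteP[F [TF ndF Foo]] := sigma_finiteT (@lebesgue_measure R).
have /sigma_finiteP[G [TG ndG Goo]] := sigma_finiteT mu.
exists (fun k => @rV_uncons n @^-1` (F k `*` G k)).
  rewrite -preimage_bigcup (_ : \bigcup_k _ = setT) ?preimage_setT //.
  rewrite -setXTT TF TG predeqE => -[x y]; split => [[k _ [Fx Gy]]|].
    by split; exists k.
  move=> [/= [k _ Fx] [l _ Gy]]; exists (maxn k l) => //; split.
    by move: x Fx; exact/subsetPset/ndF/leq_maxl.
  by move: y Gy; exact/subsetPset/ndG/leq_maxr.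
move=> k; have [mF Fk] := Foo k; have [mG Gk] := Goo k.
split.
  rewrite -[X in measurable X]setTI; apply: measurable_rV_uncons => //.
  exact: measurableX.
rewrite /lebesgue_rV_step /pushforward -comp_preimage.
rewrite (_ : _ \o _ = id); last by apply/funext => p /=; rewrite rV_consK.
by rewrite /= product_measure1E// lte_mul_pinfty// ge0_fin_numE.
Qed.

HB.instance Definition _ := Measure_isSigmaFinite.Build _ _ _
  (lebesgue_rV_step mu) sigma_finite_step.
End step.

Fixpoint lebesgue_rV n : {sigma_finite_measure set 'rV[R]_n -> \bar R} :=
  if n is m.+1 then lebesgue_rV_step (lebesgue_rV m) else \d_(0 : 'rV[R]_0).

Lemma lebesgue_rV_box n (A : 'I_n -> set (measurableTypeR R)) :
  (forall i, measurable (A i)) ->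
  lebesgue_rV n [set x | forall i, A i (x 0 i)] =
  (\prod_(i < n) lebesgue_measure (A i))%E.
Proof.
elim: n A => [|n IH] A mA.
  by rewrite big_ord0 /= diracE mem_set //= => -[].
rewrite big_ord_recl -IH // /= /lebesgue_rV_step /pushforward.
rewrite (_ : _ @^-1` _ = A ord0 `*`
    [set x : 'rV[R]_n | forall i, A (lift ord0 i) (x 0 i)]).
  rewrite product_measure1E //.
  rewrite (_ : mkset _ =
     \bigcap_(i in [set: 'I_n]) (@rV_coor R n i @^-1` A (lift ord0 i))).
    apply: fin_bigcap_measurable => // i _.
    by rewrite -[X in measurable X]setTI; exact: measurable_rV_coor.
  by apply/seteqP; split => x /= h; [move=> i _; exact: h|move=> i; exact: h].
apply/seteqP; split => -[t x] /=.
  move=> h; split; first by have := h ord0; rewrite mxE unlift_none.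
  by move=> i; have := h (lift ord0 i); rewrite mxE liftK.
move=> [h0 h] i; rewrite mxE; case: (unliftP ord0 i) => [j ->|->] //=.
Qed.

End lebesgue_rV.

Section complex_functions.
Variables (R : realType) (d : nat).
Implicit Types (f g : 'rV[R]_d -> R[i]).

Definition modulus f (x : 'rV[R]_d) : \bar R := (Normc.normc (f x))%:E.

Definition L2norm f : \bar R := ('N[lebesgue_rV R d]_(2%:E) [modulus f])%E.

Definition Linfnorm f : \bar R := ('N[lebesgue_rV R d]_(+oo) [modulus f])%E.

Definition L2 f : Prop :=
  [/\ measurable_fun [set: 'rV[R]_d] (fun x => complex.Re (f x)),
      measurable_fun [set: 'rV[R]_d] (fun x => complex.Im (f x)) &
      (L2norm f < +oo)%E].

Definition cintegral f : R[i] :=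
  (\int[lebesgue_rV R d]_x complex.Re (f x)) +i*
  (\int[lebesgue_rV R d]_x complex.Im (f x)).

Definition inner f g : R[i] := cintegral (fun x => f x * conjc (g x)).

(* Orthonormal, with linear span dense in L^2 *)
Definition hilbert_basis (phi : nat -> 'rV[R]_d -> R[i]) : Prop :=
  [/\ forall n, L2 (phi n),
      forall m n, inner (phi m) (phi n) = (m == n)%:R &
      forall f, L2 f -> forall e : R, 0 < e ->
        exists (n : nat) (c : nat -> R[i]),
          (L2norm (fun x => (f x - \sum_(k < n) c k * phi k x)%R) < e%:E)%E].

Definition e_ (j : 'I_d) : 'rV[R]_d := delta_mx 0 j.

(* R[i] carries no normed R-module structure, so partial derivatives are
   taken componentwise *)
Definition partial (j : 'I_d) f (x : 'rV[R]_d) : R[i] :=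
  ('D_(e_ j) (fun y => complex.Re (f y)) x) +i*
  ('D_(e_ j) (fun y => complex.Im (f y)) x).

Definition partially_derivable f : Prop :=
  forall (j : 'I_d) (x : 'rV[R]_d),
    derivable (fun y => complex.Re (f y)) x (e_ j) /\
    derivable (fun y => complex.Im (f y)) x (e_ j).

Definition ccontinuous f : Prop :=
  continuous (fun x => complex.Re (f x)) /\
  continuous (fun x => complex.Im (f x)).

Fixpoint Ck (k : nat) f : Prop :=
  if k is k'.+1 then
    [/\ ccontinuous f, partially_derivable f & forall j, Ck k' (partial j f)]
  else ccontinuous f.

Definition harmonic_oscillator f (x : 'rV[R]_d) : R[i] :=
  \sum_(j < d) (- partial j (partial j f) x + ((x 0 j) ^+ 2)%:C * f x).

(* By elliptic regularity every L^2 eigenfunction of H has a (unique)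
   continuous representative, and that representative is smooth: nothing is
   lost by asking for the eigenvalue equation in the classical sense. *)
Definition eigenfunction (lambda : R) f : Prop :=
  [/\ L2 f, Ck 2 f, exists x, f x != 0 &
      forall x, harmonic_oscillator f x = lambda%:C * f x].

End complex_functions.

(* Main.v *)
(* The eigenspace of H for the eigenvalue 2 k + d is spanned by the products h_a
   of one-dimensional Hermite functions, |a| = k; let N be its dimension.  The sum
   S of the h_a(x)^2 is O(k^(d/2 - 1)) uniformly in x.  For d = 2 this sum is a
   radial function, a sum of Laguerre functions q_k; it is bounded by energy
   estimates for the ODE of q_k up to the turning point and by convexity beyond
   it.  Each further dimension costs a factor O(k^(1/2)), since in dimension one
   h_0^2 + ... + h_k^2 is at most twice its value at 0.

   The basis of the eigenspace is given by the rows of N^(-1/2) (w^(j a) eps_a),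
   a discrete Fourier matrix with flipped columns, where w is a primitive N-th
   root of unity.  For fixed x and j a random choice of the signs eps makes
   |u_j(x)|^2 of order S / N = O(k^(-d/2)) with subgaussian tails, and polynomially
   many points x suffice to control the supremum; hence some choice of signs works
   for all j and x with a loss of sqrt(log k).

   Completeness: the functions theta such that theta phi x^a e^(-|x|^2/2) is in the
   closed span of the Hermite functions for all admissible phi form an algebra
   closed under bounded pointwise limits.  It contains sin and cos of the
   coordinates, by their power series, hence the indicators of half-spaces, hence
   all bounded measurable functions. *)

(* The difficulty of the two-dimensional bound is the turning point r = L, with L = 2 k + 1. In the
   variable log r the equation of q_k has frequency sqrt (r (L - r)), and the natural invariant,
   energy over frequency, blows up where the frequency vanishes. Replacing L by L + mu in the
   weight, with mu = 2 L^(1/3) of the order of the Airy width, gives an energy that is still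
   monotone up to L. It yields |q_k| = O(1 / mu) on a window of length mu, hence a bounded
   contribution to the primitive of q_k, which controls the sum of the h_a^2.

   A matrix whose entries all have modulus N^(-1/2) gives every row the same variance at a point, at
   most S / N. Flipping columns preserves unitarity and acts on all rows at once. Flat unitary
   matrices exist for every N over the complex numbers, whereas real ones (Hadamard matrices) exist
   only for special N; hence a complex-valued basis. In dimension one this averaging is void, since
   the eigenspaces are lines. *)
Require Import Defs.
From HB Require Import structures.
From mathcomp Require Import all_boot all_order all_algebra.
From mathcomp Require Import all_classical all_reals all_analysis.
From mathcomp Require Import complex ring lra zify.
From mathcomp Require Import measurable_realfun ess_sup_inf.
From mathcomp Require cyclic separable cyclotomic.

Set Implicit Arguments.
Unset Strict Implicit.
Unset Printing Implicit Defensive.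
Import Order.TTheory GRing.Theory Num.Theory.
Import numFieldNormedType.Exports.

Local Open Scope ring_scope.

(** * Derivatives and Hermite functions *)

Section derivatives.
Variable R : realType.
Implicit Types (f g : R -> R) (x a b : R).

(* [is_derive] is a class, so applying its instances triggers a search for the
   subgoals; this alias leaves them to the user. *)
Definition isd (f : R -> R) x a : Prop := is_derive x (1 : R) f a.

Lemma isd_cst x (c : R) : isd (fun _ => c) x 0.
Proof. exact: is_derive_cst. Qed.

Lemma isd_id x : isd (fun t => t) x 1.
Proof. exact: is_derive_id. Qed.

Lemma isdD f g x a b : isd f x a -> isd g x b ->
  isd (fun t => f t + g t) x (a + b).
Proof. by move=> df dg; exact: is_deriveD. Qed.

Lemma isdN f x a : isd f x a ->
  isd (fun t => - f t) x (- a).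
Proof. by move=> df; exact: is_deriveN. Qed.

Lemma isdM f g x a b : isd f x a -> isd g x b ->
  isd (fun t => f t * g t) x (a * g x + f x * b).
Proof.
move=> df dg; apply: (@is_derive_eq _ _ _ _ _ _ _ _ (is_deriveM df dg)).
by rewrite /GRing.scale /= addrC mulrC.
Qed.

Lemma isdX f x a n : isd f x a ->
  isd (fun t => f t ^+ n) x (n%:R * f x ^+ n.-1 * a).
Proof.
move=> df; elim: n => [|n IH]; first by rewrite !mul0r; exact: isd_cst.
under [X in isd X _ _]eq_fun do rewrite exprS.
apply: (@is_derive_eq _ _ _ _ _ _ _ _ (isdM df IH)).
by case: n {IH} => [|n] /=; rewrite ?exprS -?natr1; ring.
Qed.

Lemma isd_comp f g x a b : isd f x a ->
  isd g (f x) b ->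
  isd (fun t => g (f t)) x (b * a).
Proof. by move=> df dg; exact: (@is_derive1_comp _ g f). Qed.

Lemma isd_expR f x a : isd f x a ->
  isd (fun t => expR (f t)) x (expR (f x) * a).
Proof. by move=> df; apply: isd_comp df _; exact: is_derive_expR. Qed.

Lemma isdV f x a : f x != 0 -> isd f x a ->
  isd (fun t => (f t)^-1) x (- (f x) ^- 2 * a).
Proof. by move=> fx0 df; exact: is_deriveV. Qed.

Lemma isd_sum (I : Type) (r : seq I) (F : I -> R -> R) (dF : I -> R) x :
  (forall i, isd (F i) x (dF i)) ->
  isd (fun t => \sum_(i <- r) F i t) x (\sum_(i <- r) dF i).
Proof.
move=> dFi; elim: r => [|i r IH].
  under [X in isd X _ _]eq_fun do rewrite big_nil.
  by rewrite big_nil; exact: isd_cst.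
under [X in isd X _ _]eq_fun do rewrite big_cons.
by rewrite big_cons; exact: isdD.
Qed.

Lemma isd_eq f x a b : isd f x a -> a = b ->
  isd f x b.
Proof. by move=> df <-. Qed.

Lemma isd_nincr f (f' : R -> R) a b : a <= b ->
  (forall x, a <= x <= b -> isd f x (f' x)) ->
  (forall x, a <= x <= b -> f' x <= 0) -> f b <= f a.
Proof.
move=> ab df f'0.
have sub x : x \in `]a, b[ -> a <= x <= b.
  by rewrite in_itv /= => /andP[/ltW -> /ltW ->].
apply: (@ler0_derive1_nincr _ f a b) => // [x /sub xab|x /sub xab|].
- by have := df _ xab => -[].
- by rewrite derive1E; have := df _ xab => -[_ ->]; exact: f'0.
apply: derivable_within_continuous => x.
by rewrite in_itv /= => xab; have := df _ xab => -[].
Qed.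

Lemma isd_ndecr f (f' : R -> R) a b : a <= b ->
  (forall x, a <= x <= b -> isd f x (f' x)) ->
  (forall x, a <= x <= b -> 0 <= f' x) -> f a <= f b.
Proof.
move=> ab df f'0; rewrite -lerN2.
apply: (@isd_nincr (fun x => - f x) (fun x => - f' x)) => // x xab.
  by apply: isdN; exact: df.
by rewrite oppr_le0; exact: f'0.
Qed.

Lemma isd_const f : (forall x, isd f x 0) ->
  forall a b, f a = f b.
Proof.
move=> df; suff le a b : a <= b -> f a = f b.
  by move=> a b; case: (leP a b) => [|/ltW] /le.
move=> ab; apply/eqP; rewrite eq_le.
rewrite (@isd_nincr f (fun=> 0) a b) ?(@isd_ndecr f (fun=> 0) a b) //.
Qed.

Lemma isd_lip f (f' : R -> R) (M : R) a b :
  (forall x, isd f x (f' x)) ->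
  (forall x, `|f' x| <= M) -> `|f a - f b| <= M * `|a - b|.
Proof.
move=> df f'M; wlog ab : a b / a <= b.
  move=> H; case: (leP a b) => [/H //|/ltW /H].
  by rewrite distrC (distrC b).
rewrite (distrC a) (ger0_norm (_ : 0 <= b - a)) ?subr_ge0 //.
rewrite ler_norml; apply/andP; split.
  suff : f b - M * b <= f a - M * a by lra.
  apply: (@isd_nincr (fun x => f x - M * x)
    (fun x => f' x - (0 * x + M * 1))) => // x _.
    by apply: isdD => //; apply: isdN; apply: isdM;
      [exact: isd_cst|exact: isd_id].
  by have := f'M x; rewrite ler_norml; lra.
suff : f a + M * a <= f b + M * b by lra.
apply: (@isd_ndecr (fun x => f x + M * x)
  (fun x => f' x + (0 * x + M * 1))) => // x _.
  by apply: isdD => //; apply: isdM; [exact: isd_cst|exact: isd_id].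
by have := f'M x; rewrite ler_norml; lra.
Qed.

End derivatives.

Ltac isd := repeat first [eassumption | apply: isdN | apply: isdD
  | apply: isdM | apply: isdX | apply: isd_expR
  | apply: isd_cst | apply: isd_id | apply: isdV].

Section hermite.
Variable R : realType.
Implicit Types (x : R) (n : nat).

(* Coefficient of the ladder operators [(x -/+ d/dx) / 2]. *)
Definition lad n : R := Num.sqrt (n%:R / 2).

Lemma lad0 : lad 0 = 0.
Proof. by rewrite /lad mul0r sqrtr0. Qed.

Lemma ladK n : lad n ^+ 2 = n%:R / 2.
Proof. by rewrite sqr_sqrtr // divr_ge0. Qed.

Lemma lad_ge0 n : 0 <= lad n.
Proof. exact: sqrtr_ge0. Qed.

Lemma lad_neq0 n : lad n.+1 != 0.
Proof. by rewrite gt_eqF // sqrtr_gt0 divr_gt0. Qed.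

(* Normalised Hermite polynomials; the value of [hp 0.-1] is irrelevant since
   [lad 0 = 0]. *)
Fixpoint hp n : {poly R} :=
  if n is m.+1 then (lad m.+1)^-1 *: ('X * hp m - lad m *: hp m.-1) else 1.

Lemma hpS n : lad n.+1 *: hp n.+1 = 'X * hp n - lad n *: hp n.-1.
Proof. by rewrite /= scalerA mulfV ?lad_neq0 // scale1r. Qed.

(** Strong induction: differentiate the three-term recurrence and use 2 [lad n.+2]^2 = 1 + 2
    [lad n.+1]^2. *)
Lemma deriv_hp n : (hp n)^`() = (2 * lad n) *: hp n.-1.
Proof.
elim/ltn_ind: n => -[_|n IH].
  by rewrite /= derivC lad0 mulr0 scale0r.
apply: (scalerI (lad_neq0 n)); rewrite -derivZ hpS derivB derivM derivZ derivX.
rewrite IH // mul1r; case: n IH => [|n] IH.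
  rewrite lad0 mulr0 !scale0r mulr0 subr0 addr0 scalerA mulrCA -expr2 ladK.
  by rewrite mulrCA mulfV ?mulr1 ?scale1r.
rewrite (IH n) //.
have E := hpS n; have := ladK n.+2; have := ladK n.+1.
move: (lad n.+2) (lad n.+1) (lad n) (hp n.+1) (hp n) (hp n.-1) E.
move=> a b c p q r E bE aE.
have {}aE : 2 * a ^+ 2 = 1 + 2 * b ^+ 2.
  by rewrite aE bE -[n.+2%:R]natr1; field.
rewrite -!mul_polyC in E *.
transitivity (p + 2%:P * b%:P * ('X * q - c%:P * r)); first by rewrite ?polyCM; ring.
rewrite -E; transitivity ((1 + 2 * b ^+ 2)%:P * p); last first.
  by rewrite -aE !rmorphM /=; ring.
by rewrite !(rmorphD, rmorphM, rmorph1, rmorphXn) /=; ring.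
Qed.

Definition gauss x : R := expR (- (x ^+ 2 / 2)).

(** This is pi^(-1/4), the factor that gives [h 0] norm 1 in L^2(R). *)
Definition c0 : R := Num.sqrt (Num.sqrt pi)^-1.

End hermite.

HB.lock Definition h (R : realType) (n : nat) (x : R) : R :=
  c0 R * (hp R n).[x] * gauss x.

Arguments h {R} n x.

Lemma hE (R : realType) n (x : R) : h n x = c0 R * (hp R n).[x] * gauss x.
Proof. by rewrite unlock. Qed.

Section hermite_functions.
Variable R : realType.
Implicit Types (x : R) (n : nat).
Local Notation c0 := (c0 R).
Local Notation lad := (lad R).
Local Notation hp := (hp R).

Lemma c0_gt0 : 0 < c0.
Proof. by rewrite sqrtr_gt0 invr_gt0 sqrtr_gt0 pi_gt0. Qed.

Lemma c0K : c0 ^+ 2 = (Num.sqrt pi)^-1.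
Proof. by rewrite sqr_sqrtr // invr_ge0 sqrtr_ge0. Qed.

Lemma c0_le1 : c0 ^+ 2 <= 1.
Proof.
rewrite c0K invf_le1 ?sqrtr_gt0 ?pi_gt0 //.
rewrite -[leLHS]sqrtr1 ler_wsqrtr //.
by have := @pi_ge2 R; lra.
Qed.

Lemma hS n x : lad n.+1 * h n.+1 x = x * h n x - lad n * h n.-1 x.
Proof.
rewrite !hE; move: (hp n.+1) (hpS R n) => p /(congr1 (horner^~ x)).
rewrite hornerD hornerN hornerM !hornerZ hornerX => hn.
transitivity (c0 * gauss x * (lad n.+1 * p.[x])); first by ring.
by rewrite hn; ring.
Qed.

Lemma isd_gauss x : isd (@gauss R) x (- x * gauss x).
Proof.
apply: isd_eq.
  apply: isd_expR; apply: isdN; apply: isdM; last exact: isd_cst.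
  by apply: isdX; exact: isd_id.
by rewrite /gauss; field.
Qed.

(** Lowering form of the derivative; the raising and the symmetric forms below follow by [hS]. Each
    computation uses the form in which its cross terms cancel. *)
Lemma isd_h_down n x : isd (h n) x (- x * h n x + 2 * lad n * h n.-1 x).
Proof.
have -> : h n = fun y => c0 * (hp n).[y] * gauss y by apply/funext => y; rewrite hE.
apply: isd_eq.
  apply: isdM; last exact: isd_gauss.
  by apply: isdM; [exact: isd_cst|exact: is_derive_poly].
by rewrite !hE deriv_hp hornerZ; ring.
Qed.

Lemma isd_h_up n x : isd (h n) x (x * h n x - 2 * lad n.+1 * h n.+1 x).
Proof.
apply: isd_eq (isd_h_down n x) _.
by rewrite -[in RHS]mulrA hS; ring.
Qed.

Lemma isd_h n x : isd (h n) x (lad n * h n.-1 x - lad n.+1 * h n.+1 x).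
Proof. by apply: isd_eq (isd_h_down n x) _; rewrite hS; ring. Qed.

End hermite_functions.

(** * One-dimensional bounds *)

Section christoffel.
Variable R : realType.
Implicit Types (x : R) (n k : nat).

Definition K k x : R := \sum_(n < k.+1) h n x ^+ 2.

(** By [isd_h] the derivative of each square is a difference of consecutive products, and the sum
    telescopes. *)
Lemma isd_K k x : isd (K k) x (- (2 * lad R k.+1 * h k x * h k.+1 x)).
Proof.
elim: k => [|k IH].
  have -> : K 0 = fun x => h 0 x ^+ 2.
    by apply/funext => y; rewrite /K big_ord1.
  apply: isd_eq; first by apply: isdX; exact: isd_h.
  by rewrite lad0; ring.
have -> : K k.+1 = fun x => K k x + h k.+1 x ^+ 2.
  by apply/funext => y; rewrite /K big_ord_recr.
apply: isd_eq; first by apply: isdD; [exact: IH|apply: isdX; exact: isd_h].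
by rewrite -[k.+1.-1]/k; ring.
Qed.

Lemma sqr_h_le_K k x : h k x ^+ 2 <= K k x.
Proof. by rewrite /K big_ord_recr /= ler_wpDl // sumr_ge0 // => i _; rewrite sqr_ge0. Qed.

Lemma K_homo k l x : (k <= l)%N -> K k x <= K l x.
Proof.
move=> /subnKC <-; elim: (l - k)%N => [|m IH]; first by rewrite addn0.
rewrite addnS; apply: le_trans IH _.
by rewrite [leRHS]/K big_ord_recr /= lerDl sqr_ge0.
Qed.

(* [2 K k - h_k ^ 2 = K k + K (k - 1)] has derivative [- 2 x h_k ^ 2], hence is
   maximal at the origin. *)
Lemma K_le_K0 k x : K k x <= 2 * K k 0.
Proof.
pose T y := 2 * K k y - h k y ^+ 2.
have dT y : isd T y (- (2 * y * h k y ^+ 2)).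
  apply: isd_eq.
    apply: isdD; first by apply: isdM; [exact: isd_cst|exact: isd_K].
    by apply: isdN; apply: isdX; exact: isd_h_up.
  by rewrite /=; ring.
have T0 : T x <= T 0.
  case: (leP 0 x) => x0.
    apply: (isd_nincr x0 (fun y _ => dT y)) => y /andP[y0 _].
    by rewrite oppr_le0 mulr_ge0 ?sqr_ge0 ?mulr_ge0.
  apply: (isd_ndecr (ltW x0) (fun y _ => dT y)) => y /andP[_ y0].
  by rewrite oppr_ge0 mulr_le0_ge0 ?sqr_ge0 ?pmulr_rle0.
have := sqr_h_le_K k x; have := sqr_ge0 (h k (0 : R)).
rewrite /T in T0; lra.
Qed.

(** At the origin the recurrence relates [h n.+2] to [h n] only, and the induction closes because (n
    + 1) (n + 3) <= (n + 2)^2. *)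
Lemma h0_le n : n.+1%:R * h n (0 : R) ^+ 4 <= 1.
Proof.
elim/ltn_ind: n => -[_|[_|n IH]].
- rewrite mul1r hE /= hornerC /gauss expr0n /= mul0r oppr0 expR0 !mulr1.
  rewrite (exprM _ 2 2) expr_le1 ?c0_le1 ?sqr_ge0 //.
- have := @hS R 0 0; rewrite lad0 !mul0r subr0 => /eqP.
  by rewrite mulf_eq0 (negPf (lad_neq0 _ _)) /= => /eqP ->; rewrite expr0n mulr0.
have := @hS R n.+1 0; rewrite mul0r sub0r -[n.+1.-1]/n => /(congr1 (fun y => y ^+ 2)).
have := IH n (ltnW (ltnSn _)).
move: (h n.+2 0) (h n 0) => a b bE; rewrite sqrrN !exprMn !ladK => aE.
have n0 : 0 <= n%:R :> R by [].
rewrite -[n.+3%:R]natr1 -[n.+2%:R]natr1 -[n.+1%:R]natr1 in bE aE *.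
move: (n%:R : R) n0 bE aE => {IH}n n0 bE aE.
have -> : a ^+ 4 = ((n + 1) / (n + 1 + 1)) ^+ 2 * b ^+ 4.
  rewrite (exprM a 2 2) (exprM b 2 2) -exprMn; congr (_ ^+ 2).
  by apply: (@mulfI _ ((n + 1 + 1) / 2)); [apply/negP; lra|rewrite aE; field; lra].
apply: (@le_trans _ _ (((n + 1 + 1 + 1) * (n + 1) / (n + 1 + 1) ^+ 2) *
   ((n + 1) * b ^+ 4))); first by rewrite le_eqVlt; apply/orP; left; apply/eqP; field; lra.
apply: mulr_ile1 => //.
- by rewrite divr_ge0 ?sqr_ge0 //; nra.
- by rewrite mulr_ge0 ?exprn_even_ge0 //; lra.
- by rewrite ler_pdivrMr; nra.
Qed.

(** By [h0_le] the terms are at most (n + 1)^(-1/2), which are summed by comparison with increments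
    of 2 sqrt. *)
Lemma K0_le k : K k 0 <= 2 * Num.sqrt k.+1%:R.
Proof.
have step n : h n (0 : R) ^+ 2 <= (Num.sqrt n.+1%:R)^-1.
  rewrite -[leRHS]mul1r ler_pdivlMr ?sqrtr_gt0 //.
  rewrite -(@ler_pXn2r _ 2) ?nnegrE ?(mulr_ge0 (sqr_ge0 _) (sqrtr_ge0 _)) //.
  by rewrite exprMn sqr_sqrtr // -exprM expr1n mulrC h0_le.
elim: k => [|k IH].
  rewrite /K; by rewrite big_ord1; apply: le_trans (step 0%N) _; rewrite sqrtr1; lra.
rewrite /K big_ord_recr /= -/(K k 0); apply: le_trans (lerD IH (step _)) _.
have a0 : 0 <= Num.sqrt k.+1%:R :> R by rewrite sqrtr_ge0.
have b0 : 0 < Num.sqrt k.+2%:R :> R by rewrite sqrtr_gt0.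
have a2 : Num.sqrt k.+1%:R ^+ 2 = k.+1%:R :> R by rewrite sqr_sqrtr.
have b2 : Num.sqrt k.+2%:R ^+ 2 = Num.sqrt k.+1%:R ^+ 2 + 1 :> R.
  by rewrite a2 sqr_sqrtr // natr1.
move: (Num.sqrt k.+1%:R) (Num.sqrt k.+2%:R) a0 b0 b2 => a b a0 b0 b2.
rewrite -(ler_pM2r b0) mulrDl mulVf ?gt_eqF //.
by have := sqr_ge0 (a - b); nra.
Qed.

Lemma K_le k x : K k x <= 4 * Num.sqrt k.+1%:R.
Proof. by have := K_le_K0 k x; have := K0_le k; lra. Qed.

Lemma sqrt_le_id (a : R) : 1 <= a -> Num.sqrt a <= a.
Proof.
move=> a1; rewrite -[leRHS]sqr_sqrtr; last lra.
by rewrite expr2 ler_peMl ?sqrtr_ge0 // -[leLHS]sqrtr1 ler_wsqrtr.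
Qed.

(** A crude polynomial bound is enough: it only serves to choose the mesh of the grid, where a power
    of the degree costs a constant factor once the logarithm is taken. *)
Lemma h_le n x : `|h n x| <= 2 * n.+1%:R.
Proof.
have n1 : 1 <= n.+1%:R :> R by rewrite ler1n.
rewrite -(@ler_pXn2r _ 2) ?nnegrE ?mulr_ge0 // real_normK ?num_real //.
apply: le_trans (le_trans (sqr_h_le_K n x) (K_le n x)) _.
by have := sqrt_le_id n1; nra.
Qed.

Lemma lad_le n : lad R n <= n%:R.
Proof.
case: n => [|n]; first by rewrite lad0.
rewrite -(@ler_pXn2r _ 2) ?nnegrE ?lad_ge0 // ladK.
have n1 : 1 <= n.+1%:R :> R by rewrite ler1n.
by nra.
Qed.

(** Both the derivative of [h n] and [x * h n x] are made of these two terms, so one estimate gives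
    a Lipschitz constant and the decay at infinity. *)
Lemma ladder_le n x :
  lad R n * `|h n.-1 x| + lad R n.+1 * `|h n.+1 x| <= 8 * n.+1%:R ^+ 2.
Proof.
have l0 := lad_ge0 R n; have l1 := lad_ge0 R n.+1.
have := lad_le n; have := lad_le n.+1; have := h_le n.-1 x; have := h_le n.+1 x.
have n1 : n.-1.+1%:R <= n.+1%:R :> R by rewrite ler_nat; case: (n).
have n0 := ler0n R n; have a0 := normr_ge0 (h n.-1 x); have b0 := normr_ge0 (h n.+1 x).
rewrite -[n.+2%:R]natr1 -[n.+1%:R]natr1 in n1 *.
move: (n%:R : R) (n.-1.+1%:R : R) (lad R n) (lad R n.+1) `|h n.-1 x| `|h n.+1 x| n0 a0 b0 l0 l1 n1.
move=> m m' a b u v m0 u0 v0 a0 b0 m'm vb ub bb ab.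
have : a * u <= m * (2 * (m + 1)) by apply: ler_pM => //; lra.
have : b * v <= (m + 1) * (2 * (m + 1 + 1)) by apply: ler_pM => //; lra.
by nra.
Qed.

Lemma dh_le n x : `|lad R n * h n.-1 x - lad R n.+1 * h n.+1 x| <= 8 * n.+1%:R ^+ 2.
Proof.
apply: le_trans (ladder_le n x); apply: le_trans (ler_normB _ _) _.
by rewrite !normrM !(ger0_norm (lad_ge0 _ _)).
Qed.

Lemma xh_le n x : `|x * h n x| <= 8 * n.+1%:R ^+ 2.
Proof.
have -> : x * h n x = lad R n * h n.-1 x + lad R n.+1 * h n.+1 x.
  by rewrite hS; ring.
apply: le_trans (ladder_le n x); apply: le_trans (ler_normD _ _) _.
by rewrite !normrM !(ger0_norm (lad_ge0 _ _)).
Qed.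

End christoffel.

(** * Laguerre functions up to and beyond the turning point *)

Section laguerre.
Variable R : realType.
Implicit Types (r : R) (k : nat).

(* [(-1)^k L_k(2 X)], with [L_k] the Laguerre polynomial. *)
Definition lp k : {poly R} :=
  \poly_(i < k.+1) ((-1) ^+ (k + i) * 'C(k, i)%:R * 2 ^+ i / (i`!)%:R).

Lemma coef_lp k i :
  (lp k)`_i = (-1) ^+ (k + i) * 'C(k, i)%:R * 2 ^+ i / (i`!)%:R.
Proof.
rewrite coef_poly; case: ltnP => // ki.
by rewrite bin_small // mulr0 !mul0r.
Qed.

Lemma lp_at0 k : (lp k).[0] = (-1) ^+ k.
Proof. by rewrite horner_coef0 coef_lp addn0 bin0 fact0 expr0 !mulr1 divr1. Qed.

(** Rescaled form of L_(k+1)' - L_k' = - L_k, checked coefficient by coefficient. *)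
Lemma lp_rec k : (lp k.+1)^`() + (lp k)^`() = 2 *: lp k.
Proof.
apply/polyP => i; rewrite coefD !coef_deriv coefZ !coef_lp -mulrnDl -[LHS]mulr_natl.
rewrite addSn addnS binS factS natrM natrD.
have f0 : (i`!)%:R != 0 :> R by rewrite pnatr_eq0 -lt0n fact_gt0.
have i0 : i.+1%:R != 0 :> R by rewrite pnatr_eq0.
rewrite !(exprS _ (k + i).+1) !(exprS _ (k + i)) (exprS 2).
move: (i`!%:R) (i.+1%:R) ('C(k, i.+1)%:R) ('C(k, i)%:R) (_ ^+ (k + i)) (2 ^+ i) f0 i0.
by move=> a b u v c e a0 b0; field; rewrite a0 b0.
Qed.

Lemma lp_euler k : 'X * (lp k.+1)^`() = k.+1%:R *: (lp k.+1 + lp k).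
Proof.
apply/polyP => i; rewrite coefXM coefZ coefD.
case: i => [|i] /=; rewrite ?coef_deriv !coef_lp.
  by rewrite !addn0 !bin0 exprS; ring.
rewrite -[LHS]mulr_natl.
have := congr1 (fun m => m%:R : R) (mul_bin_diag k.+1 i).
have f0 : (i`!)%:R != 0 :> R by rewrite pnatr_eq0 -lt0n fact_gt0.
have i0 : i.+1%:R != 0 :> R by rewrite pnatr_eq0.
rewrite addSn addnS binS factS !natrM natrD /=.
rewrite !(exprS _ (k + i).+1) !(exprS _ (k + i)) (exprS 2).
move: (i`!%:R) (i.+1%:R) (k.+1%:R) ('C(k, i.+1)%:R) ('C(k, i)%:R)
  (_ ^+ (k + i)) (2 ^+ i) f0 i0.
move=> a b c u v d e a0 b0 E.
transitivity (d * 2 * e / (b * a) * (b * (u + v))); first by field; rewrite a0 b0.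
by rewrite -E; field; rewrite a0 b0.
Qed.

(** Differentiate [lp_euler] and insert [lp_rec]; [lp_euler] itself then removes the polynomial of
    lower index. *)
Lemma lp_ode k :
  'X * (lp k)^`()^`() + (1 - 2 *: 'X) * (lp k)^`() + (2 * k%:R) *: lp k = 0.
Proof.
case: k => [|k].
  have -> : lp 0 = 1.
    apply/polyP => i; rewrite coef_lp coef1; case: i => [|i].
      by rewrite bin0 !mulr1 divr1.
    by rewrite bin_small // mulr0 !mul0r.
  by rewrite derivC deriv0 !mulr0 scale0r !addr0.
have E := congr1 (@deriv R) (lp_euler k).
rewrite derivM derivX mul1r derivZ derivD lp_rec in E.
have E2 := lp_euler k.
transitivity ((lp k.+1)^`() + 'X * (lp k.+1)^`()^`() - 2 *: ('X * (lp k.+1)^`()) +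
  (2 * k.+1%:R) *: lp k.+1).
  by rewrite -!mul_polyC; ring.
rewrite E E2 !scalerA scalerDr -!mul_polyC.
by rewrite (mulrC k.+1%:R 2); ring.
Qed.

(** Functions of this form are stable under differentiation, which acts on the polynomial as p' - p,
    so the calculus below reduces to polynomial identities. *)
Definition pe (p : {poly R}) r := p.[r] * expR (- r).

Lemma isd_pe p r : isd (pe p) r (pe (p^`() - p) r).
Proof.
apply: isd_eq.
  apply: isdM; first exact: is_derive_poly.
  by apply: isd_expR; apply: isdN; exact: isd_id.
by rewrite /pe hornerD hornerN; ring.
Qed.

Lemma pe_vanish p e : 0 < e -> exists A, forall r, A <= r -> `|pe p r| <= e.
Proof.
set n := size p; pose S := \sum_(i < n) `|p`_i|.
have S0 : 0 <= S by apply: sumr_ge0.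
have f0 : 0 < n.+1`!%:R :> R by rewrite ltr0n fact_gt0.
move=> e0; exists (1 + S * n.+1`!%:R / e) => r rA.
have Sf0 : 0 <= S * n.+1`!%:R / e by rewrite (divr_ge0 (mulr_ge0 S0 (ltW f0)) (ltW e0)).
have r1 : 1 <= r by lra.
have r0 : 0 < r by lra.
have pS : `|p.[r]| <= S * r ^+ n.
  rewrite horner_coef mulr_suml; apply: le_trans (ler_norm_sum _ _ _) _.
  apply: ler_sum => i _; rewrite normrM ler_wpM2l // normrX (ger0_norm (ltW r0)).
  by rewrite ler_weXn2l // ltnW.
have er : r ^+ n.+1 / n.+1`!%:R <= expR r.
  by apply: le_trans (expR_ge1Dxn n (ltW r0)); rewrite lerDr.
rewrite /pe normrM expRN normfV (gtr0_norm (expR_gt0 _)) ler_pdivrMr ?expR_gt0 //.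
apply: le_trans pS _; apply: le_trans (ler_wpM2l (ltW e0) er).
rewrite exprS !mulrA ler_pdivlMr // (mulrAC S) ler_wpM2r ?exprn_ge0 ?(ltW r0) //.
by rewrite (mulrC e) -ler_pdivrMr //; lra.
Qed.

Definition q k := pe (lp k).
Definition dq k := pe ((lp k)^`() - lp k).
Definition ddq k := pe (((lp k)^`() - lp k)^`() - ((lp k)^`() - lp k)).

Lemma q_ode k r : r * ddq k r + dq k r + (2 * k%:R + 1 - r) * q k r = 0.
Proof.
have /(congr1 (horner^~ r)) := lp_ode k.
rewrite !(hornerE, derivB) /= => E.
rewrite /ddq /dq /q /pe !hornerE.
transitivity (expR (- r) * 0); last by rewrite mulr0.
by rewrite -E; ring.
Qed.

Definition sp k := \sum_(i < k.+1) lp i.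

(** For k > 0 this is e^(-r) ([sp k] + [sp k.-1]). Unlike [sp k] alone, it is a primitive of -
    [q k], so that a bound on the sum follows from integrating [q k]. *)
Definition P k r := 2 * pe (sp k) r - q k r.

Lemma isd_q k r : isd (q k) r (dq k r).
Proof. exact: isd_pe. Qed.

Lemma isd_dq k r : isd (dq k) r (ddq k r).
Proof. exact: isd_pe. Qed.

Lemma spS k : sp k.+1 = sp k + lp k.+1.
Proof. by rewrite /sp big_ord_recr. Qed.

Lemma sp_deriv k : 2 *: ((sp k)^`() - sp k) = (lp k)^`() - 2 *: lp k.
Proof.
elim: k => [|k IH].
  have -> : sp 0 = lp 0 by rewrite /sp big_ord1.
  suff -> : (lp 0)^`() = 0 by rewrite sub0r sub0r scalerN.
  apply/polyP => i; rewrite coef_deriv coef_lp bin_small //.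
  by rewrite mulr0 !mul0r mul0rn coef0.
rewrite spS derivD.
transitivity (2 *: ((sp k)^`() - sp k) + 2 *: (lp k.+1)^`() - 2 *: lp k.+1).
  by rewrite -!mul_polyC; ring.
by rewrite IH -(lp_rec k) -!mul_polyC; ring.
Qed.

Lemma P_pe k r : P k r = pe (2 *: sp k - lp k) r.
Proof. by rewrite /P /q /pe hornerD hornerN hornerZ; ring. Qed.

Lemma isd_P k r : isd (P k) r (- q k r).
Proof.
rewrite (_ : P k = pe (2 *: sp k - lp k)); last by apply/funext => ?; rewrite P_pe.
apply: isd_eq; first exact: isd_pe.
rewrite /q /pe -mulNr -hornerN; congr (_.[_] * _).
rewrite derivB derivZ.
transitivity (2 *: ((sp k)^`() - sp k) - (lp k)^`() + lp k); last first.
  by rewrite sp_deriv -!mul_polyC; ring.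
by rewrite -!mul_polyC; ring.
Qed.

(** The expression is again a polynomial times e^(-r). By the differential equation its derivative
    is - [P k], which makes it useful beyond the turning point. *)
Lemma W_vanish k e : 0 < e -> exists A, forall r, A <= r ->
  `|- (r * dq k r) + (2 * k%:R + 1 - r) * P k r| <= e.
Proof.
move=> /(pe_vanish (- ('X * ((lp k)^`() - lp k)) +
  ((2 * k%:R + 1)%:P - 'X) * (2 *: sp k - lp k)))[A HA].
exists A => r /HA; rewrite P_pe /dq /pe.
congr (`|_| <= _); rewrite !(hornerD, hornerN, hornerM, hornerX, hornerC).
by ring.
Qed.

Lemma q_at0 k : q k 0 = (-1) ^+ k.
Proof. by rewrite /q /pe lp_at0 oppr0 expR0 mulr1. Qed.

Lemma P_at0 k : P k 0 = 1.
Proof.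
rewrite /P /q /pe lp_at0 oppr0 expR0 !mulr1.
suff -> : 2 * (sp k).[0] = 1 + (-1) ^+ k by ring.
elim: k => [|k IH]; first by rewrite /sp big_ord1 lp_at0 expr0; ring.
by rewrite /sp big_ord_recr hornerD mulrDr IH lp_at0 exprS; ring.
Qed.

End laguerre.

(** Arithmetic of the window before the turning point, with the numerical factors kept as variables:
    [w] is at most twice the width [m], and [r] is at least of order [m ^ 3]. *)
Lemma quartic_bound (R : realType) (m r w x c d : R) : 0 < m -> 0 < d ->
  0 <= w -> w <= 2 * m -> m ^+ 3 / d <= r ->
  x ^+ 4 * r ^+ 3 <= c ^+ 2 * w ^+ 5 -> (x * m) ^+ 4 <= c ^+ 2 * 2 ^+ 5 * d ^+ 3.
Proof.
move=> m0 d0 w0 wm mr H.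
have md : 0 <= m ^+ 3 / d by rewrite divr_ge0 ?exprn_ge0 ?ltW.
have r3 : (m ^+ 3 / d) ^+ 3 <= r ^+ 3.
  by rewrite ler_pXn2r ?nnegrE // (le_trans md).
have m2 : 0 <= 2 * m by rewrite mulr_ge0 ?ltW.
have w5 : w ^+ 5 <= (2 * m) ^+ 5 by rewrite ler_pXn2r ?nnegrE.
have x4 : 0 <= x ^+ 4 by rewrite (exprM _ 2 2) sqr_ge0.
have := le_trans (le_trans (ler_wpM2l x4 r3) H) (ler_wpM2l (sqr_ge0 c) w5).
have dm : 0 < d ^+ 3 / m ^+ 5 by rewrite divr_gt0 ?exprn_gt0.
rewrite -(ler_pM2r dm); congr (_ <= _); move: (2 : R) => two.
  by field; rewrite !gt_eqF.
by field; rewrite gt_eqF.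
Qed.

(** * Energy estimates for the radial equation *)

Section edge_estimate.
Variables (R : realType) (L : R) (q dq ddq P : R -> R).
Implicit Types r s e : R.
Hypothesis L1 : 1 <= L.
Hypothesis isd_q : forall r, isd q r (dq r).
Hypothesis isd_dq : forall r, isd dq r (ddq r).
Hypothesis isd_P : forall r, isd P r (- q r).
Hypothesis ode : forall r, r * ddq r + dq r + (L - r) * q r = 0.
Hypothesis q0 : q 0 ^+ 2 = 1.
Hypothesis P0 : P 0 = 1.
Hypothesis P_ge0 : forall r : R, 0 <= r -> 0 <= P r.
Hypothesis q_vanish : forall e : R, 0 < e -> exists A, forall r, A <= r -> `|q r| <= e.
Hypothesis W_vanish : forall e : R, 0 < e -> exists A, forall r, A <= r ->
  `|- (r * dq r) + (L - r) * P r| <= e.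

(** The function W = - s q' + (L - s) P has derivative - P <= 0 and tends to 0, so W >= 0. Beyond L
    this forces q' <= 0; as q tends to 0, q >= 0, and P decreases. *)
Lemma P_after r : L <= r -> P r <= P L.
Proof.
have Wge0 s : 0 <= s -> 0 <= - (s * dq s) + (L - s) * P s.
  move=> s0; apply/ler_addgt0Pl => e e0; have [A HA] := W_vanish e0.
  have : - (Num.max A s * dq (Num.max A s)) + (L - Num.max A s) * P (Num.max A s)
      <= - (s * dq s) + (L - s) * P s.
    apply: (@isd_nincr _ (fun s => - (s * dq s) + (L - s) * P s)
      (fun s => - (1 * dq s + s * ddq s) + ((0 - 1) * P s + (L - s) * - q s))).
    - by rewrite le_max lexx orbT.
    - move=> x _; isd => //.
    - move=> x /andP[sx _]; have := ode x; have := P_ge0 (le_trans s0 sx).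
      by lra.
  have := HA (Num.max A s); rewrite le_max lexx /= => /(_ isT).
  by rewrite ler_norml => /andP[+ _]; lra.
have qge0 s : L <= s -> 0 <= q s.
  move=> Ls; apply/ler_addgt0Pl => e e0; have [A HA] := q_vanish e0.
  have : q (Num.max A s) <= q s.
    apply: (@isd_nincr _ q dq) => [|//|x /andP[sx _]].
      by rewrite le_max lexx orbT.
    have x0 : 0 < x := lt_le_trans ltr01 (le_trans L1 (le_trans Ls sx)).
    have := Wge0 x (ltW x0); have := P_ge0 (ltW x0).
    rewrite -(pmulr_rle0 _ x0) => Px Wx.
    have : (L - x) * P x <= 0 by rewrite mulr_le0_ge0 //; lra.
    by lra.
  have := HA (Num.max A s); rewrite le_max lexx /= => /(_ isT).
  by rewrite ler_norml => /andP[+ _]; lra.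
move=> Lr; apply: (@isd_nincr _ P (fun s => - q s)) => // x /andP[Lx _].
by rewrite oppr_le0 qge0.
Qed.

(** Nonincreasing by the equation, with value L at 0. Its control of [q] degenerates at [r = L], so
    it is only used near the origin, on [0, [r0]]. *)
Definition Qen r := r * dq r ^+ 2 + (L - r) * q r ^+ 2.

Lemma Qen_le r : 0 <= r -> Qen r <= L.
Proof.
move=> r0; have -> : L = Qen 0 by rewrite /Qen q0; ring.
apply: (@isd_nincr _ Qen (fun r => - (dq r ^+ 2 + q r ^+ 2))) => // x _.
  apply: isd_eq; first by rewrite /Qen; isd.
  have : 2 * dq x * (x * ddq x + dq x + (L - x) * q x) = 0 by rewrite ode mulr0.
  by rewrite /=; lra.
by rewrite oppr_le0 addr_ge0 ?sqr_ge0.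
Qed.

Variable mu : R.
Hypothesis mu3 : mu ^+ 3 = 8 * L.

Lemma mu_ge2 : 2 <= mu.
Proof.
have mu0 : 0 <= mu.
  rewrite leNgt; apply/negP => mu0; have := L1.
  have : mu * mu ^+ 2 <= 0 by rewrite mulr_le0_ge0 ?sqr_ge0 ?ltW.
  by rewrite -exprS mu3; lra.
rewrite -(@ler_pXn2r _ 3) ?nnegrE // mu3 -natrX.
by have := L1; rewrite (_ : (2 ^ 3)%N = 8%N) //; lra.
Qed.

(** The shift moves the singularity of the weight past the turning point. The weight [f] below is (r
    (nu - r))^(-1/2), written with [expR] and [ln] to be differentiated easily. *)
Let nu := L + mu.
Let f r := expR (- ((ln r + ln (nu - r)) / 2)).

Let f_gt0 r : 0 < f r.
Proof. exact: expR_gt0. Qed.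

Let fK r : 0 < r -> r < nu -> f r ^+ 2 * (r * (nu - r)) = 1.
Proof.
move=> r0 rnu; have w0 : 0 < nu - r by lra.
have -> : r * (nu - r) = expR (ln r + ln (nu - r)) by rewrite expRD !lnK.
by rewrite /f -expRM_natl -expRD -[RHS]expR0; congr expR; field.
Qed.

Let isd_f r : 0 < r -> r < nu ->
  isd f r (f r * (- (r^-1 / 2) + (nu - r)^-1 / 2)).
Proof.
move=> r0 rnu; have w0 : 0 < nu - r by lra.
apply: isd_eq.
  apply: isd_expR; apply: isdN; apply: isdM; last exact: isd_cst.
  apply: isdD; first exact: is_derive1_ln.
  apply: isd_comp; last exact: is_derive1_ln.
  by apply: isdD; [exact: isd_cst|apply: isdN; exact: isd_id].
by rewrite /f; field; rewrite !gt_eqF.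
Qed.

(* An energy whose weight [f] compensates the decay of the amplitude of [q]: it
   is monotone up to the turning point [L]. *)
Let G r := (r * dq r) ^+ 2 - (r * (nu - r)^-1 - 1) / 2 * (r * dq r) * q r +
  (r * (L - r) + 3 / 8 * (r * (nu - r)^-1) ^+ 2 + 1 / 8) * q r ^+ 2.

Let F r := f r * G r.

(** With z = r / (nu - r), the cross term is absorbed by half the square of r q' - (z - 1) q / 2,
    and the remainder z q^2 / 4 is nonnegative. *)
Let G_ge r : 0 <= r -> r < nu -> 2^-1 * (r * dq r) ^+ 2 +
  (r * (L - r) + 4^-1 * (r * (nu - r)^-1) ^+ 2) * q r ^+ 2 <= G r.
Proof.
move=> r0 rnu; have z0 : 0 <= r * (nu - r)^-1 by rewrite mulr_ge0 ?invr_ge0; lra.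
rewrite /G; move: (r * (nu - r)^-1) z0 (r * dq r) (r * (L - r)) (q r).
move=> z z0 v a b; have : 0 <= (v - (z - 1) / 2 * b) ^+ 2 by exact: sqr_ge0.
have : 0 <= z * b ^+ 2 by rewrite mulr_ge0 ?sqr_ge0.
by lra.
Qed.

(** The cross term and the corrections in [G] are those for which all terms in q' drop out of the
    derivative of [F], leaving a multiple of q^2. Its sign rests on 8 z <= mu w, where w = nu - r
    and z = r / w: indeed 8 z w = 8 r <= 8 L = mu^3 <= mu w^2. *)
Let F_nincr a b : 0 < a -> a <= b -> b <= L -> F b <= F a.
Proof.
move=> a0 ab bL; have mu2 := mu_ge2.
pose z r := r * (nu - r)^-1.
apply: (@isd_nincr _ F (fun r => f r * q r ^+ 2 / r *
   ((15 * z r ^+ 3 + 9 * z r ^+ 2 + z r - 1) / 16 - mu * r * z r))) => //.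
  move=> r /andP[ar rb].
  have r0 : 0 < r by lra.
  have rnu : r < nu by rewrite /nu; lra.
  have w0 : nu - r != 0 by apply/eqP; lra.
  apply: isd_eq.
    apply: isdM; first exact: isd_f.
    rewrite /G; isd => //.
  have := ode r; rewrite /z /G /=.
  have -> : mu = nu - L by rewrite /nu; lra.
  move: (f r) (q r) (dq r) (ddq r) => A B C D E.
  have -> : D = (- C - (L - r) * B) / r.
    by apply: (@mulIf _ r); rewrite ?gt_eqF // divfK ?gt_eqF //; lra.
  by field; rewrite w0 gt_eqF.
move=> r /andP[ar rb].
have r0 : 0 < r by lra.
have w0 : mu <= nu - r by rewrite /nu; lra.
have z0 : 0 <= z r by rewrite mulr_ge0 ?invr_ge0; lra.
have zw : r = z r * (nu - r) by rewrite /z divfK //; apply/eqP; lra.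
rewrite mulr_ge0_le0 //; first by rewrite divr_ge0 ?(ltW r0) // mulr_ge0 ?sqr_ge0 ?(ltW (f_gt0 _)).
have rL : r <= L by lra.
move: (nu - r) (z r) w0 z0 zw => w y muw y0 ryw.
have mu0 : 0 < mu by lra.
have ymu : 8 * y * w <= mu * mu * mu.
  by have := mu3; lra.
have muww : mu * mu * mu <= mu * w * w by apply: ler_pM; nra.
have yw : 8 * y <= mu * w by rewrite -(@ler_pM2r _ w); lra.
have four : 4 <= mu * w by nra.
have y2 : 0 <= y ^+ 2 by exact: sqr_ge0.
have yy := ler_wpM2l y2 yw.
have y4 := ler_wpM2l y2 four.
have := sqr_ge0 (y - 2); rewrite ryw; lra.
Qed.

Let v r := r * dq r.

(** The weight [f] is singular at 0, so the energy is started at a small positive point. There r0 L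
    is a constant, and [Qen_le] bounds q and r q' by constants. *)
Let r0 : R := (2 * L)^-1.

Let r0_gt0 : 0 < r0.
Proof. by rewrite invr_gt0; have := L1; lra. Qed.

Let r0L : r0 * L = 2^-1.
Proof. by rewrite /r0; field; apply/eqP; have := L1; lra. Qed.

Let r0_le : r0 <= L / 2.
Proof. by have := L1; have := r0L; have := r0_gt0; nra. Qed.

Let q_start r : 0 <= r -> r <= r0 -> q r ^+ 2 <= 2.
Proof.
move=> rge0 rr0; have := Qen_le rge0; rewrite /Qen => Q.
have : 0 <= r * dq r ^+ 2 by rewrite mulr_ge0 ?sqr_ge0.
have := sqr_ge0 (q r); have := L1; have := r0_le; nra.
Qed.

Let v_start : v r0 ^+ 2 <= 2^-1.
Proof.
have := Qen_le (ltW r0_gt0); rewrite /Qen => Q.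
have q2 : 0 <= (L - r0) * q r0 ^+ 2.
  by rewrite mulr_ge0 ?sqr_ge0 //; have := r0_le; have := L1; lra.
have : r0 * (r0 * dq r0 ^+ 2) <= r0 * L by rewrite ler_pM2l ?r0_gt0 //; lra.
by rewrite r0L /v; lra.
Qed.

Let F_start : F r0 <= 8.
Proof.
have rg := r0_gt0; have rL := r0L; have L1' := L1; have mu2 := mu_ge2.
have r2 : r0 <= 2^-1 by nra.
have w0 : L <= nu - r0 by rewrite /nu; lra.
have rnu : r0 < nu by lra.
have f2 : f r0 <= 2.
  rewrite -(@ler_pXn2r _ 2) ?nnegrE ?ltW //.
  have := fK rg rnu; have := sqr_ge0 (f r0).
  have : r0 * L <= r0 * (nu - r0) by rewrite ler_pM2l.
  by rewrite rL; nra.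
suff G4 : G r0 <= 4.
  have : f r0 * G r0 <= f r0 * 4 by rewrite ler_pM2l.
  by rewrite /F; lra.
rewrite /G; have := v_start; have := q_start (ltW rg) (lexx _).
have z0 : 0 <= r0 * (nu - r0)^-1 by rewrite mulr_ge0 ?invr_ge0; lra.
have z1 : r0 * (nu - r0)^-1 <= 1 by rewrite ler_pdivrMr; lra.
have a1 : r0 * (L - r0) <= 2^-1 by nra.
rewrite -/(v r0).
move: (r0 * (nu - r0)^-1) (v r0) (q r0) (r0 * (L - r0)) z0 z1 a1.
move=> z x y a z0 z1 a1 y2 x2.
have : 0 <= (1 - z) * (x - y) ^+ 2 by rewrite mulr_ge0 ?sqr_ge0 //; lra.
have : 0 <= z * (x ^+ 2 + y ^+ 2) by rewrite mulr_ge0 // addr_ge0 ?sqr_ge0.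
have : (a + 3 / 8 * z ^+ 2 + 1 / 8) * y ^+ 2 <= y ^+ 2.
  by rewrite ler_piMl ?sqr_ge0 //; nra.
by lra.
Qed.

Let F_le r : r0 <= r -> r <= L -> F r <= 8.
Proof. by move=> rr rL; apply: le_trans F_start; exact: F_nincr. Qed.

Let P_start r : 0 <= r -> r <= r0 -> P r <= 2.
Proof.
move=> rge rr.
have : P r - 2 * r <= P 0 - 2 * 0.
  apply: (@isd_nincr _ (fun r => P r - 2 * r) (fun r => - q r - (0 * r + 2 * 1))) => //.
    by move=> x _; isd.
  move=> x /andP[x0 xr]; have := q_start x0 (le_trans xr rr).
  have := sqr_ge0 (q x + 1); nra.
by rewrite P0; have := r0_le; have := r0L; have := L1; nra.
Qed.

Let energy_le r : r0 <= r -> r <= L ->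
  (f r * v r ^+ 2 <= 16) /\ (f r * ((r * (nu - r)^-1) ^+ 2 * q r ^+ 2) <= 32).
Proof.
move=> rr rL; have mu2 := mu_ge2.
have rg : 0 < r := lt_le_trans r0_gt0 rr.
have rnu : r < nu by rewrite /nu; lra.
have := F_le rr rL; rewrite /F => Ff.
have {Ff} := le_trans (ler_wpM2l (ltW (f_gt0 r)) (G_ge (ltW rg) rnu)) Ff.
rewrite -/(v r).
have A : 0 <= f r * v r ^+ 2 by rewrite mulr_ge0 ?sqr_ge0 ?(ltW (f_gt0 r)).
have Lr : 0 <= L - r by lra.
have B : 0 <= f r * (r * (L - r) * q r ^+ 2).
  apply: mulr_ge0; first exact: ltW.
  by apply: mulr_ge0; [apply: mulr_ge0 => //; exact: ltW|exact: sqr_ge0].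
have C : 0 <= f r * ((r * (nu - r)^-1) ^+ 2 * q r ^+ 2).
  apply: mulr_ge0; first exact: ltW.
  by apply: mulr_ge0; exact: sqr_ge0.
by move=> H; split; lra.
Qed.

Let unweight r a c : r0 <= r -> r <= L -> 0 <= a -> f r * a <= c ->
  a ^+ 2 <= c ^+ 2 * (r * (nu - r)).
Proof.
move=> rr rL a0 fa; have mu2 := mu_ge2.
have rg : 0 < r := lt_le_trans r0_gt0 rr.
have rnu : r < nu by rewrite /nu; lra.
have w0 : 0 < r * (nu - r) by rewrite mulr_gt0 //; lra.
have -> : a ^+ 2 = (f r * a) ^+ 2 * (r * (nu - r)).
  by rewrite exprMn -mulrA (mulrC (a ^+ 2)) mulrA fK // mul1r.
rewrite ler_pM2r // ler_pXn2r ?nnegrE //.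
  by rewrite mulr_ge0 ?(ltW (f_gt0 r)).
by apply: le_trans fa; rewrite mulr_ge0 ?(ltW (f_gt0 r)).
Qed.

(** From f v^2 <= 16 one gets v^4 <= 256 r (nu - r) <= 512 L (L - r) = 64 mu^3 (L - r), since nu - r
    <= 2 (L - r) here; then mu <= L - r trades one factor mu for L - r. *)
Let v_le r : r0 <= r -> r <= L - mu ->
  `|v r| <= 3 * (Num.sqrt mu * Num.sqrt (L - r)).
Proof.
move=> rr rLm; have mu2 := mu_ge2; have rL : r <= L by lra.
have [Ev _] := energy_le rr rL.
have := unweight rr rL (sqr_ge0 _) Ev.
have rg : 0 < r := lt_le_trans r0_gt0 rr.
have k0 : 0 <= L - r by lra.
have le1 : r * (nu - r) <= L * (2 * (L - r)).
  by apply: ler_pM; rewrite /nu; lra.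
have le2 : mu ^+ 3 * (L - r) <= mu ^+ 2 * (L - r) ^+ 2.
  rewrite exprSr -mulrA ler_wpM2l ?sqr_ge0 // expr2 ler_wpM2r //; lra.
move=> le3.
have le4 : (v r ^+ 2) ^+ 2 <= (8 * (mu * (L - r))) ^+ 2.
  have e : 8 * L * (L - r) = mu ^+ 3 * (L - r) by rewrite mu3.
  by lra.
have m0 : 0 <= mu by lra.
rewrite -(@ler_pXn2r _ 2) ?nnegrE ?mulr_ge0 ?sqrtr_ge0 // real_normK ?num_real //.
have -> : (3 * (Num.sqrt mu * Num.sqrt (L - r))) ^+ 2 = 9 * (mu * (L - r)).
  by rewrite !exprMn !sqr_sqrtr //; ring.
have : v r ^+ 2 <= 8 * (mu * (L - r)).
  by rewrite -(@ler_pXn2r _ 2) ?nnegrE ?sqr_ge0 ?mulr_ge0.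
have : 0 <= mu * (L - r) by rewrite mulr_ge0.
lra.
Qed.

Hypothesis L8 : 8 <= L.

Let muL : mu <= L / 2.
Proof.
rewrite leNgt; apply/negP => muL.
have := mu_ge2; have := mu3; have := L8 => ? ? ?.
have : (L / 2) * ((L / 2) * (L / 2)) <= mu * (mu * mu).
  by apply: ler_pM; rewrite ?mulr_ge0; try lra; apply: ler_pM; lra.
have : 8 * 8 <= L * L by apply: ler_pM.
have : 0 <= L by lra.
nra.
Qed.

(** Integration by parts: the equation reads v' = - (L - s) q, so P - v / (L - s) has derivative - v
    / (L - s)^2. By [v_le] this is at most 3 sqrt mu (L - s)^(-3/2), whose primitive is the last
    term of [J]; that term stays at most 6 up to distance mu from L. *)
Let P_bulk r : 0 <= r -> r <= L - mu -> P r <= 13.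
Proof.
move=> rge rLm; have mu2 := mu_ge2; have r0g := r0_gt0.
have [rr|rr] := leP r r0; first by have := P_start rge rr; lra.
have sm0 : 0 < Num.sqrt mu by rewrite sqrtr_gt0; lra.
pose sk r := Num.sqrt (L - r).
have sk0 s : s <= L - mu -> 0 < sk s by rewrite sqrtr_gt0; lra.
have skK s : s <= L - mu -> sk s ^+ 2 = L - s by move=> ?; rewrite sqr_sqrtr //; lra.
pose J s := P s - v s / (L - s) - 6 * Num.sqrt mu / sk s.
have : J r <= J r0.
  apply: (@isd_nincr _ J (fun s => - v s / (L - s) ^+ 2 -
    3 * Num.sqrt mu / (sk s ^+ 3))); first exact: ltW.
    move=> s /andP[s0 sr].
    have sL : s <= L - mu by lra.
    have s2 := skK _ sL; have s1 := sk0 _ sL.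
    have dsk : isd sk s (- (2 * sk s)^-1).
      apply: isd_eq.
        apply: isd_comp; last by apply: is_derive1_sqrt; lra.
        by isd.
      by rewrite /sk; ring.
    have Ls : L - s != 0 by apply/eqP; lra.
    apply: isd_eq.
      rewrite /J /v; isd => //.
      by rewrite gt_eqF.
    have := ode s; rewrite /v.
    move: (sk s) s1 s2 (q s) (dq s) (ddq s) Ls => a a0 aE B C D Ls E.
    have -> : s * D = - C - (L - s) * B by lra.
    by rewrite -aE; field; rewrite gt_eqF.
  move=> s /andP[s0 sr]; have sL : s <= L - mu by lra.
  have := v_le s0 sL; rewrite -/(sk s).
  have := skK _ sL; move: (sk s) (sk0 _ sL) (v s) => a a0 x <-.
  rewrite ler_norml => /andP[lo _].
  have -> : - x / (a ^+ 2) ^+ 2 - 3 * Num.sqrt mu / a ^+ 3 =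
      - (x + 3 * (Num.sqrt mu * a)) / a ^+ 4 by field; rewrite gt_eqF.
  rewrite mulNr oppr_le0 divr_ge0 ?exprn_ge0 ?(ltW a0) //; lra.
have smk s : s <= L - mu -> Num.sqrt mu / sk s <= 1.
  by move=> sL; rewrite ler_pdivrMr ?sk0 // mul1r /sk ler_wsqrtr //; lra.
have smk0 s : s <= L - mu -> 0 <= Num.sqrt mu / sk s.
  by move=> sL; rewrite divr_ge0 ?(ltW sm0) ?(ltW (sk0 _ sL)).
have r0Lm : r0 <= L - mu by lra.
have v0 : `|v r0 / (L - r0)| <= 1.
  have Lr : 1 <= L - r0 by have := r0_le; have := L8; lra.
  rewrite normrM normfV (ger0_norm (_ : 0 <= L - r0)); last lra.
  rewrite ler_pdivrMr; last lra.
  rewrite mul1r; apply: le_trans Lr.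
  rewrite -(@ler_pXn2r _ 2) ?nnegrE // real_normK ?num_real //.
  by have := v_start; lra.
have v1 : `|v r / (L - r)| <= 3.
  have Lr : 0 < L - r by lra.
  rewrite normrM normfV (gtr0_norm Lr) ler_pdivrMr //.
  apply: le_trans (v_le (ltW rr) rLm) _; rewrite ler_pM2l // -/(sk r) -(skK _ rLm).
  by rewrite expr2 ler_wpM2r ?(ltW (sk0 _ rLm)) // /sk ler_wsqrtr //; lra.
rewrite /J; have := P_start (ltW r0g) (lexx _).
have := smk _ r0Lm; have := smk _ rLm; have := smk0 _ r0Lm; have := smk0 _ rLm.
move: v0 v1; rewrite !ler_norml => /andP[? ?] /andP[? ?].
rewrite -!(mulrA 6); lra.
Qed.

(** With w = nu - r, the second bound of [energy_le] becomes q^4 r^3 <= 32^2 w^5. On this window w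
    <= 2 mu and r >= L / 2 = mu^3 / 16, so q is of the Airy size 1 / mu. *)
Let q_edge r : L - mu <= r -> r <= L -> `|q r| <= (32 * 16) / mu.
Proof.
move=> rl rL; have mu2 := mu_ge2; have := muL => muL'.
have r2 : L / 2 <= r by lra.
have rr : r0 <= r by have := r0_le; lra.
have rg : 0 < r := lt_le_trans r0_gt0 rr.
have [_ Eq] := energy_le rr rL.
have zq : 0 <= (r * (nu - r)^-1) ^+ 2 * q r ^+ 2.
  by apply: mulr_ge0; exact: sqr_ge0.
have := unweight rr rL zq Eq.
have w1 : mu <= nu - r by rewrite /nu; lra.
have w2 : nu - r <= 2 * mu by rewrite /nu; lra.
move: (nu - r) (q r) w1 w2 => w x w1 w2 H.
have w0 : 0 < w by lra.
have {}H : x ^+ 4 * r ^+ 3 <= 32 ^+ 2 * w ^+ 5.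
  move: (32 : R) H => c H.
  rewrite -(@ler_pM2r _ (r * w^-4)) ?mulr_gt0 ?invr_gt0 ?exprn_gt0 //.
  have -> : c ^+ 2 * w ^+ 5 * (r / w ^+ 4) = c ^+ 2 * (r * w).
    by field; rewrite gt_eqF.
  by apply: le_trans H; rewrite le_eqVlt; apply/orP; left; apply/eqP; field; rewrite gt_eqF.
have m16 : mu ^+ 3 / 16 <= r by rewrite mu3; lra.
have mu0 : 0 < mu by lra.
have H3 := @quartic_bound R mu r w x 32 16 mu0 ltac:(lra) (ltW w0) w2 m16 H.
rewrite ler_pdivlMr // -(@ler_pXn2r _ 4) ?nnegrE ?mulr_ge0 ?(ltW mu0) //.
have -> : (`|x| * mu) ^+ 4 = (x * mu) ^+ 4.
  by rewrite !exprMn -normrX ger0_norm // (exprM _ 2 2) sqr_ge0.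
apply: le_trans H3 _; rewrite [leRHS]exprMn.
have -> : 32 ^+ 4 * 16 ^+ 4 = 32 ^+ 2 * (32 ^+ 2 * 16) * 16 ^+ 3 :> R.
  by move: (32 : R) (16 : R) => a b; ring.
rewrite ler_wpM2r ?exprn_ge0 // ler_wpM2l ?exprn_ge0 //.
by rewrite !exprS expr0; lra.
Qed.

(** The constant is 13 from the bulk plus 512 = (512 / mu) mu from the window of length mu; beyond
    L, [P] decreases. *)
Lemma P_le r : 0 <= r -> P r <= 525.
Proof.
move=> rg; have mu2 := mu_ge2; have muL' := muL.
have [rl|rl] := leP r (L - mu); first by have := P_bulk rg rl; lra.
have edge s : L - mu <= s -> s <= L -> P s <= 525.
  move=> s1 s2.
  have : P s - (32 * 16) / mu * s <= P (L - mu) - (32 * 16) / mu * (L - mu).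
    apply: (@isd_nincr _ (fun s => P s - (32 * 16) / mu * s)
      (fun s => - q s - (0 * s + (32 * 16) / mu * 1))) => //.
      by move=> x _; apply: isdD => //; apply: isdN; apply: isdM; isd.
    move=> x /andP[x1 x2]; have := q_edge x1 (le_trans x2 s2).
    by rewrite ler_norml => /andP[? ?]; lra.
  have := P_bulk _ (lexx (L - mu)) => /(_ ltac:(lra)).
  have : (32 * 16) / mu * (s - (L - mu)) <= (32 * 16) / mu * mu.
    by rewrite ler_wpM2l ?divr_ge0; lra.
  by rewrite divfK ?gt_eqF; lra.
have [rL|rL] := leP r L; first by apply: edge; lra.
by apply: le_trans (P_after (ltW rL)) _; apply: edge; lra.
Qed.

End edge_estimate.

(** * Spectral function of an eigenspace *)

Section shell2.
Variable R : realType.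
Implicit Types (x y : R) (k : nat).

Definition shell2 k x y : R := \sum_(i < k.+1) h i x ^+ 2 * h (k - i) y ^+ 2.

Lemma shell2_ge0 k x y : 0 <= shell2 k x y.
Proof. by apply: sumr_ge0 => i _; rewrite mulr_ge0 ?sqr_ge0. Qed.

Lemma shell2C k x y : shell2 k x y = shell2 k y x.
Proof.
rewrite /shell2 (reindex_inj rev_ord_inj) /=; apply: eq_bigr => i _.
by rewrite subSS subKn 1?mulrC // -ltnS.
Qed.

Lemma shell2_le_K k x y : shell2 k x y <= K k x * K k y.
Proof.
rewrite /shell2 [K k x]/K mulr_suml; apply: ler_sum => i _.
rewrite ler_wpM2l ?sqr_ge0 //; apply: le_trans (sqr_h_le_K _ _) (K_homo _ _).
exact: leq_subr.
Qed.

Lemma isd_hh k x : isd (fun x => h k.+1 x ^+ 2 + h k x ^+ 2) x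
  (- (2 * x) * (h k.+1 x ^+ 2 - h k x ^+ 2)).
Proof.
apply: isd_eq.
  by apply: isdD; apply: isdX; [exact: isd_h_down|exact: isd_h_up].
by rewrite /=; ring.
Qed.

(** Adding two consecutive levels pairs [h i.+1] with [h i], and the cross terms of the two
    derivatives cancel by [isd_hh]. The unpaired term has the same form because h_0' = - x h_0. *)
Lemma isd_shell2 k x y :
  isd (fun x => shell2 k.+1 x y + shell2 k x y) x
    (- (2 * x) * (shell2 k.+1 x y - shell2 k x y)).
Proof.
have E x' : shell2 k.+1 x' y + shell2 k x' y = h 0 x' ^+ 2 * h k.+1 y ^+ 2 +
    \sum_(i < k.+1) (h i.+1 x' ^+ 2 + h i x' ^+ 2) * h (k - i) y ^+ 2.
  rewrite /shell2 big_ord_recl /= subn0 -addrA -big_split /=; congr (_ + _).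
  by apply: eq_bigr => i _; rewrite /bump /= add1n subSS; ring.
have -> : shell2 k.+1 x y - shell2 k x y = h 0 x ^+ 2 * h k.+1 y ^+ 2 +
    \sum_(i < k.+1) (h i.+1 x ^+ 2 - h i x ^+ 2) * h (k - i) y ^+ 2.
  rewrite /shell2 big_ord_recl /= subn0 -addrA -sumrN -big_split /=; congr (_ + _).
  by apply: eq_bigr => i _; rewrite /bump /= add1n subSS; ring.
under [X in isd X _ _]eq_fun do rewrite E.
apply: isd_eq.
  apply: isdD.
    by apply: isdM; [apply: isdX; exact: isd_h_down|exact: isd_cst].
  apply: isd_sum => i; apply: isdM; first exact: isd_hh.
  exact: isd_cst.
rewrite [RHS]mulrDr mulr_sumr lad0; congr (_ + _); first by rewrite /=; ring.
by apply: eq_bigr => i _ /=; ring.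
Qed.

Lemma sqr_h0S k : k.+2%:R * h k.+2 (0 : R) ^+ 2 = k.+1%:R * h k (0 : R) ^+ 2.
Proof.
have /(congr1 (fun z : R => 2 * z ^+ 2)) := @hS R k.+1 0.
rewrite mul0r sub0r sqrrN -[k.+1.-1]/k; move: (h k.+2 (0 : R)) (h k (0 : R)) => a b.
rewrite !exprMn !ladK; move: (k.+2%:R) (k.+1%:R) => u v H.
by transitivity (2 * (u / 2 * a ^+ 2)); [field|rewrite H; field].
Qed.

Lemma h1_at0 : h 1 (0 : R) = 0.
Proof.
have := @hS R 0 0; rewrite lad0 !mul0r subr0 => /eqP.
by rewrite mulf_eq0 (negPf (lad_neq0 _ _)) => /eqP.
Qed.

(** The symmetry between i and m - i turns the factor m into 2 i, and i h_i(0)^2 is exactly what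
    [sqr_h0S] shifts by two. *)
Lemma shell2_at0SS k : shell2 k.+2 0 0 = shell2 k 0 0.
Proof.
have sym m : m%:R * shell2 m 0 0 =
    2 * \sum_(i < m.+1) i%:R * (h i (0 : R) ^+ 2 * h (m - i) (0 : R) ^+ 2).
  rewrite mulr_natl (_ : 2 = 1 + 1 :> R) // mulrDl mul1r.
  rewrite {2}(reindex_inj rev_ord_inj) -big_split /= /shell2 -sumrMnl.
  apply: eq_bigr => i _; have im : (i <= m)%N by rewrite -ltnS.
  rewrite subSS subKn // natrB // mulrBl (mulrC (h (m - i) 0 ^+ 2)) addrC subrK.
  by rewrite mulr_natl.
apply: (@mulfI _ k.+2%:R); first by rewrite pnatr_eq0.
rewrite sym big_ord_recl big_ord_recl /= mul0r add0r.
rewrite (_ : bump 0 0 = 1%N) // h1_at0 expr0n mul0r mulr0 add0r.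
have -> : \sum_(i < k.+1) (bump 0 (bump 0 i))%:R *
   (h (bump 0 (bump 0 i)) (0 : R) ^+ 2 * h (k.+2 - bump 0 (bump 0 i)) (0 : R) ^+ 2) =
   \sum_(i < k.+1) (i%:R * (h i (0 : R) ^+ 2 * h (k - i) (0 : R) ^+ 2)) +
   shell2 k 0 0.
  rewrite /shell2 -big_split; apply: eq_bigr => i _ /=.
  rewrite /bump /= !add1n !subSS mulrA sqr_h0S -natr1; ring.
by rewrite mulrDr -sym -!natr1; ring.
Qed.

Lemma sp_at0SS k : (sp R k.+2).[0] = (sp R k).[0].
Proof.
rewrite /sp !big_ord_recr !hornerD /= !lp_at0 !exprS; ring.
Qed.

Lemma shell2_at0 k : shell2 k 0 0 = c0 R ^+ 4 * (sp R k).[0].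
Proof.
have h00 : h 0 (0 : R) = c0 R.
  by rewrite hE /= hornerC /gauss expr0n /= mul0r oppr0 expR0 !mulr1.
elim/ltn_ind: k => -[_|[_|k IH]].
- rewrite /shell2 /sp !big_ord1 subn0 lp_at0 mulr1 h00; ring.
- rewrite /shell2 /sp !big_ord_recr !big_ord0 !hornerD horner0 !lp_at0 /=.
  by rewrite h1_at0 expr0n expr0 expr1 !mul0r !mulr0; ring.
- by rewrite shell2_at0SS sp_at0SS IH.
Qed.

Lemma isd_pe_sp k r :
  isd (fun r => pe (sp R k.+1) r + pe (sp R k) r) r (- pe (lp R k.+1) r).
Proof.
have E r' : pe (sp R k.+1) r' + pe (sp R k) r' = P k.+1 r'.
  by rewrite /P /q spS /pe !hornerD; ring.
by under [X in isd X _ _]eq_fun do rewrite E; exact: isd_P.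
Qed.

(* In the variable [x], [exp(x^2)] times the difference of the two sides has
   derivative zero, by induction on [k]. *)
Lemma shell2_radial k x y :
  shell2 k x y = c0 R ^+ 4 * pe (sp R k) (x ^+ 2 + y ^+ 2).
Proof.
pose e k x y := shell2 k x y - c0 R ^+ 4 * pe (sp R k) (x ^+ 2 + y ^+ 2).
have eC m u v : e m u v = e m v u by rewrite /e shell2C [u ^+ 2 + _]addrC.
have step m u v : (forall u, isd (fun u => e m u v) u (- (2 * u) * e m u v)) ->
    e m u v * expR (u ^+ 2) = e m 0 v.
  move=> de.
  have := @isd_const R (fun u => e m u v * expR (u ^+ 2)).
  move=> /(_ _ u 0) -> //; first by rewrite expr0n expR0 mulr1.
  move=> t; apply: isd_eq.
    by apply: isdM; [exact: de|apply: isd_expR; apply: isdX; exact: isd_id].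
  by rewrite /=; ring.
suff H m : forall u v, e m u v = 0.
  by apply/eqP; rewrite -subr_eq0; apply/eqP; exact: H.
have Z n (de : forall u v, isd (fun u => e n u v) u (- (2 * u) * e n u v)) :
    forall u v, e n u v = 0.
  move=> u v; apply: (@mulIf _ (expR (u ^+ 2))); first by rewrite gt_eqF ?expR_gt0.
  rewrite mul0r step // eC; apply: (@mulIf _ (expR (v ^+ 2))).
    by rewrite gt_eqF ?expR_gt0.
  rewrite mul0r step // /e shell2_at0 /pe expr0n add0r oppr0 expR0 mulr1.
  by rewrite subrr.
elim: m => [|m IH].
  apply: Z => u v; rewrite /e /shell2 /sp.
  under [X in isd X _ _]eq_fun do rewrite !big_ord1.
  rewrite !big_ord1 /=.
  apply: isd_eq.
    apply: isdD.
      by apply: isdM; [apply: isdX; exact: isd_h_down|exact: isd_cst].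
    apply: isdN; apply: isdM; first exact: isd_cst.
    apply: isd_comp; last exact: isd_pe.
    by apply: isdD; [apply: isdX; exact: isd_id|exact: isd_cst].
  have -> : lp R 0 = 1.
    apply/polyP => i; rewrite coef_lp coef1; case: i => [|i].
      by rewrite bin0 !mulr1 divr1.
    by rewrite bin_small // mulr0 !mul0r.
  by rewrite derivC /pe sub0r hornerN lad0 /=; ring.
apply: Z => u v.
have -> : (fun u => e m.+1 u v) = fun u => (shell2 m.+1 u v + shell2 m u v) -
   c0 R ^+ 4 * (pe (sp R m.+1) (u ^+ 2 + v ^+ 2) + pe (sp R m) (u ^+ 2 + v ^+ 2)).
  by apply/funext => t; have := IH t v; rewrite /e; lra.
apply: isd_eq.
  apply: isdD; first exact: isd_shell2.
  apply: isdN; apply: isdM; first exact: isd_cst.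
  apply: (@isd_comp _ (fun t => t ^+ 2 + v ^+ 2)
    (fun r => pe (sp R m.+1) r + pe (sp R m) r)); last exact: isd_pe_sp.
  by apply: isdD; [apply: isdX; exact: isd_id|exact: isd_cst].
have := IH u v; rewrite /e.
have -> : pe (lp R m.+1) (u ^+ 2 + v ^+ 2) =
    pe (sp R m.+1) (u ^+ 2 + v ^+ 2) - pe (sp R m) (u ^+ 2 + v ^+ 2).
  by rewrite spS /pe hornerD; ring.
move: (shell2 m.+1 u v) (shell2 m u v) (pe (sp R m.+1) _) (pe (sp R m) _) (c0 R ^+ 4).
by move=> a b a' b' c E; rewrite /= (_ : b = c * b'); [ring|lra].
Qed.

(** By [shell2_radial], up to a positive factor this is the sum of squares at the point (sqrt r,
    0). *)
Lemma pe_sp_ge0 k (r : R) : 0 <= r -> 0 <= pe (sp R k) r.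
Proof.
move=> r0; have := shell2_ge0 k (Num.sqrt r) 0.
rewrite shell2_radial sqr_sqrtr // expr0n addr0 pmulr_rge0 //.
by rewrite exprn_gt0 // c0_gt0.
Qed.

Lemma P_ge_sp k (r : R) : 0 <= r -> pe (sp R k) r <= P k r.
Proof.
move=> r0; have : 0 <= P k r - pe (sp R k) r; last by lra.
case: k => [|k].
  rewrite /P /q /pe /sp big_ord1.
  by rewrite (_ : _ - _ = 0) //; ring.
have := pe_sp_ge0 k r0; congr (0 <= _).
by rewrite /P /q spS /pe hornerD; ring.
Qed.

(** [P_le] asks for L = 2 k + 1 >= 8, that is k >= 4; for smaller k each factor [K k] is at most 8.
    The width [mu] is the cube root of 8 L, written through [expR] and [ln]. *)
Lemma shell2_le k x y : shell2 k x y <= 525.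
Proof.
case: (leqP 4 k) => k4; last first.
  apply: le_trans (shell2_le_K _ _ _) _.
  have K4 (z : R) : K k z <= 8.
    apply: le_trans (K_le _ _) _.
    have : Num.sqrt k.+1%:R <= Num.sqrt (2 ^+ 2) :> R.
      by rewrite ler_wsqrtr // -natrX ler_nat.
    by rewrite sqrtr_sqr ger0_norm //; lra.
  apply: (@le_trans _ _ (8 * 8)); last by lra.
  by apply: ler_pM => //; apply: sumr_ge0 => i _; exact: sqr_ge0.
rewrite shell2_radial.
have r0 : 0 <= x ^+ 2 + y ^+ 2 by rewrite addr_ge0 ?sqr_ge0.
apply: (@le_trans _ _ (pe (sp R k) (x ^+ 2 + y ^+ 2))).
  rewrite ler_piMl ?pe_sp_ge0 // (exprM _ 2 2) expr_le1 ?c0_le1 ?sqr_ge0 //.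
apply: le_trans (P_ge_sp k r0) _.
have k4' : 4 <= k%:R :> R by rewrite ler_nat.
have L0 : 0 < 8 * (2 * k%:R + 1) :> R by lra.
apply: (@P_le R (2 * k%:R + 1) (q k) (dq k) (ddq k) (P k) _ _ _ _ _ _ _ _ _ _
  (expR (ln (8 * (2 * k%:R + 1)) / 3))) => //.
- by lra.
- exact: isd_q.
- exact: isd_dq.
- exact: isd_P.
- exact: q_ode.
- by rewrite q_at0 sqrr_sign.
- exact: P_at0.
- by move=> r /[dup] rr /(P_ge_sp k); apply: le_trans; exact: pe_sp_ge0.
- by move=> e; exact: pe_vanish.
- by move=> e; exact: W_vanish.
- by rewrite -expRM_natl mulrC divfK // lnK.
- by lra.
Qed.

End shell2.

(** * Multi-indices of given weight *)

Section multi_index.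
Variable R : realType.
Implicit Types (d k : nat).

Definition prodh d (a : 'I_d -> nat) (X : 'I_d -> R) : R :=
  \prod_(i < d) h (a i) (X i).

(* Multi-indices of weight [k]: they index the Hermite functions spanning the
   eigenspace of the eigenvalue [2 k + d]. *)
Definition mi d k : {set {ffun 'I_d -> 'I_k.+1}} :=
  [set a : {ffun 'I_d -> 'I_k.+1} | (\sum_(i < d) a i)%N == k].

(** Generating function: the constraint on the weight becomes the extraction of one coefficient of a
    product of one-variable polynomials. *)
Lemma sum_mi_coef d k (c : 'I_d -> nat -> R) :
  \sum_(a in mi d k) \prod_(i < d) c i (a i) =
  (\prod_(i < d) \sum_(n < k.+1) c i n *: 'X^n)`_k.
Proof.
rewrite bigA_distr_bigA coef_sum /= big_mkcond /=; apply: eq_bigr => a _.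
rewrite inE; have -> : \prod_(i < d) (c i (a i) *: 'X^(a i)) =
    (\prod_(i < d) c i (a i)) *: 'X^(\sum_(i < d) a i)%N.
  by rewrite scaler_prod; congr (_ *: _); rewrite -expr_sum.
by rewrite coefZ coefXn eq_sym; case: eqP; rewrite (mulr1, mulr0).
Qed.

Lemma sum_coef_le (p : {poly R}) n : (forall i, 0 <= p`_i) ->
  \sum_(i < n) p`_i <= p.[1].
Proof.
move=> p0; rewrite (@horner_coef_wide _ (n + size p)) ?leq_addl //.
rewrite big_split_ord /= [leRHS]addrC -[leLHS]add0r; apply: lerD.
  by apply: sumr_ge0 => i _; rewrite expr1n mulr1.
by apply: ler_sum => i _; rewrite expr1n mulr1.
Qed.

Lemma prod_coef_ge0 m (F : 'I_m -> {poly R}) :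
  (forall i j, 0 <= (F i)`_j) -> forall j, 0 <= (\prod_i F i)`_j.
Proof.
move=> F0; elim/big_ind: _ => [j|p q p0 q0 j|i _ //].
  by rewrite coef1 ler0n.
by rewrite coefM sumr_ge0 // => i _; rewrite mulr_ge0.
Qed.

(** The coefficients of the product of the first two factors are values of [shell2], each at most
    525. The other m factors have nonnegative coefficients, so the sum of those of their product is
    at most its value at 1, a product of [K k]. *)
Lemma shell_le m k (X : 'I_m.+2 -> R) :
  \sum_(a in mi m.+2 k) prodh (fun i => a i) X ^+ 2 <=
  525 * (4 * Num.sqrt k.+1%:R) ^+ m.
Proof.
have C0 : 0 <= 525 :> R by exact: ler0n.
have := @shell2_le R; move: (525 : R) C0 => C C0 s2le.
pose A i : {poly R} := \sum_(n < k.+1) h n (X i) ^+ 2 *: 'X^n.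
have cA i j : (A i)`_j = if (j < k.+1)%N then h j (X i) ^+ 2 else 0.
  rewrite /A -(poly_def k.+1 (fun n => h n (X i) ^+ 2)) coef_poly //.
have A0 i j : 0 <= (A i)`_j by rewrite cA; case: ifP => // _; exact: sqr_ge0.
under eq_bigr do rewrite /prodh -prodrXl.
rewrite (sum_mi_coef k (fun i n => h n (X i) ^+ 2)).
change ((\prod_(i < m.+2) A i)`_k <= C * (4 * Num.sqrt k.+1%:R) ^+ m).
rewrite !big_ord_recl mulrA.
set i0 : 'I_m.+2 := ord0; set i1 : 'I_m.+2 := lift _ _.
set B := \prod_(i < m) _.
have B0 j : 0 <= B`_j by apply: prod_coef_ge0.
rewrite coefM.
apply: (@le_trans _ _ (\sum_(j < k.+1) C * B`_(k - j))).
  apply: ler_sum => j _; rewrite ler_wpM2r // coefM.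
  apply: le_trans (s2le j (X i0) (X i1)); rewrite /shell2.
  rewrite le_eqVlt; apply/orP; left; apply/eqP; apply: eq_bigr => i _.
  rewrite !cA (leq_trans (ltn_ord i) (ltn_ord j)).
  by rewrite (leq_ltn_trans (leq_subr _ _) (ltn_ord j)).
rewrite -mulr_sumr ler_wpM2l //.
rewrite (reindex_inj rev_ord_inj) /=.
under eq_bigr => i _ do rewrite subSS subKn -1?ltnS //.
apply: le_trans (sum_coef_le _ B0) _; rewrite horner_prod.
have -> : (4 * Num.sqrt k.+1%:R) ^+ m = \prod_(i < m) (4 * Num.sqrt k.+1%:R) :> R.
  by rewrite prodr_const card_ord.
apply: ler_prod => i _.
have -> : (A (lift i0 (lift ord0 i))).[1] = K k (X (lift i0 (lift ord0 i))).
  rewrite /A horner_sum; apply: eq_bigr => n _.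
  by rewrite hornerZ hornerXn expr1n mulr1.
by rewrite K_le andbT; apply: sumr_ge0 => n _; exact: sqr_ge0.
Qed.

Lemma card_mi_le d k : (#|mi d k| <= k.+1 ^ d)%N.
Proof.
by apply: leq_trans (max_card _) _; rewrite card_ffun !card_ord.
Qed.

(** All coordinates but one are free up to k / (m + 1), and the first one restores the weight. This
    gives the order k^(d - 1) with d = m + 2. *)
Lemma card_mi_ge m k : ((k %/ m.+1).+1 ^ m.+1 <= #|mi m.+2 k|)%N.
Proof.
set q := (k %/ m.+1)%N.
have -> : (q.+1 ^ m.+1 = #|{: {ffun 'I_m.+1 -> 'I_q.+1}}|)%N.
  by rewrite card_ffun !card_ord.
have sum_le (b : {ffun 'I_m.+1 -> 'I_q.+1}) : (\sum_i b i <= k)%N.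
  apply: (@leq_trans (\sum_(i < m.+1) q)).
    by apply: leq_sum => i _; rewrite -ltnS.
  by rewrite sum_nat_const card_ord mulnC leq_divM.
have qk : (q <= k)%N by exact: leq_div.
pose F (b : {ffun 'I_m.+1 -> 'I_q.+1}) : {ffun 'I_m.+2 -> 'I_k.+1} :=
  [ffun i => if unlift ord0 i is Some j then inord (b j)
             else inord (k - \sum_i b i)].
have Fj b j : F b (lift ord0 j) = b j :> nat.
  by rewrite ffunE liftK inordK // ltnS (leq_trans _ qk) // -ltnS.
have F0 b : F b ord0 = (k - \sum_i b i)%N :> nat.
  by rewrite ffunE unlift_none inordK // ltnS leq_subr.
have injF : injective F.
  move=> b c bc; apply/ffunP => j; apply: val_inj => /=.
  by rewrite -Fj bc Fj.
rewrite -(card_imset _ injF); apply: subset_leq_card; apply/fintype.subsetP => a.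
move=> /imsetP[b _ ->]; rewrite inE big_ord_recl F0.
have -> : (\sum_(i < m.+1) F b (lift ord0 i) = \sum_(i < m.+1) b i)%N.
  by apply: eq_bigr => i _; exact: Fj.
by rewrite subnK.
Qed.

End multi_index.

(** * Choice of signs with subgaussian tails *)

Section signs.
Variable R : realType.

Implicit Types x a b : R.

Definition cosh (x : R) : R := (expR x + expR (- x)) / 2.

Lemma cosh_ge0 x : 0 <= cosh x.
Proof. by rewrite /cosh divr_ge0 // addr_ge0 ?expR_ge0. Qed.

Lemma coshM a b : cosh (a + b) + cosh (a - b) = 2 * (cosh a * cosh b).
Proof. by rewrite /cosh !opprD opprK !expRD; field. Qed.

Lemma isd_cosh x : isd cosh x ((expR x - expR (- x)) / 2).
Proof.
apply: isd_eq.
  apply: isdM; last exact: isd_cst.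
  by apply: isdD; [exact: is_derive_expR|apply: isd_expR; apply: isdN; exact: isd_id].
by rewrite /=; field.
Qed.

Lemma sinh_le_cosh x : 0 <= x -> expR x - expR (- x) <= x * (expR x + expR (- x)).
Proof.
move=> x0; rewrite -subr_ge0.
have -> : 0 = 0 * (expR 0 + expR (- 0)) - (expR 0 - expR (- 0 : R)) :> R.
  by rewrite oppr0; ring.
apply: (@isd_ndecr _ (fun x => x * (expR x + expR (- x)) - (expR x - expR (- x)))
  (fun x => x * (expR x - expR (- x)))) => //.
  move=> y _; apply: isd_eq.
    have dm : isd (fun t : R => expR (- t)) y (expR (- y) * -1).
      by apply: isd_expR; apply: isdN; exact: isd_id.
    have de : isd (@expR R) y (expR y) by exact: is_derive_expR.
    exact: (isdD (isdM (isd_id y) (isdD de dm)) (isdN (isdD de (isdN dm)))).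
  by rewrite /=; ring.
move=> y /andP[y0 _]; rewrite mulr_ge0 // subr_ge0 ler_expR; lra.
Qed.

(** Subgaussian bound for one random sign: cosh x e^(-x^2/2) is nonincreasing for x >= 0, because
    sinh x <= x cosh x. *)
Lemma cosh_le x : cosh x <= expR (x ^+ 2 / 2).
Proof.
wlog x0 : x / 0 <= x.
  move=> H; case: (leP 0 x) => [/H //|/ltW x0].
  have -> : cosh x = cosh (- x) by rewrite /cosh opprK addrC.
  by rewrite -sqrrN; apply: H; lra.
have : cosh x * expR (- (x ^+ 2 / 2)) <= cosh 0 * expR (- (0 ^+ 2 / 2)).
  apply: (@isd_nincr _ (fun x => cosh x * expR (- (x ^+ 2 / 2)))
    (fun x => ((expR x - expR (- x)) - x * (expR x + expR (- x))) / 2 *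
       expR (- (x ^+ 2 / 2)))) => // [y _|y /andP[y0 _]].
    apply: isd_eq.
      apply: isdM; first exact: isd_cosh.
      apply: isd_expR; apply: isdN; apply: isdM; last exact: isd_cst.
      by apply: isdX; exact: isd_id.
    by rewrite /cosh /=; field.
  rewrite mulr_le0_ge0 ?expR_ge0 //; have := sinh_le_cosh y0; lra.
rewrite expr0n /= mul0r oppr0 expR0 mulr1 expRN ler_pdivrMr ?expR_gt0 //.
by move=> /le_trans -> //; rewrite /cosh oppr0 expR0; lra.
Qed.

(* Derandomised Rademacher estimate: at each step one of the two signs does not
   increase the potential by more than the average. *)
Lemma signs_potential (I : finType) N (w S : I -> R) (b : I -> nat -> R) :
  (forall l, 0 <= w l) -> exists e : nat -> bool,
  \sum_l w l * cosh (S l + \sum_(i < N) (-1) ^+ e i * b l i) <=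
  \sum_l w l * (cosh (S l) * expR (\sum_(i < N) b l i ^+ 2 / 2)).
Proof.
elim: N w S b => [|N IH] w S b w0.
  exists (fun=> false); apply: ler_sum => l _.
  by rewrite !big_ord0 addr0 expR0 mulr1.
have w'0 l : 0 <= w l * expR (b l N ^+ 2 / 2) by rewrite mulr_ge0 ?expR_ge0.
have [e He] := IH _ S b w'0.
pose T l := S l + \sum_(i < N) (-1) ^+ e i * b l i.
have [s Hs] : exists s : bool, \sum_l w l * cosh (T l + (-1) ^+ s * b l N) <=
    \sum_l w l * (cosh (T l) * expR (b l N ^+ 2 / 2)).
  have avg : \sum_l w l * cosh (T l + b l N) + \sum_l w l * cosh (T l - b l N) <=
      2 * \sum_l w l * (cosh (T l) * expR (b l N ^+ 2 / 2)).
    rewrite -big_split mulr_sumr /=; apply: ler_sum => l _.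
    rewrite -mulrDr coshM mulrCA ler_wpM2l // ler_wpM2l // ler_wpM2l ?cosh_ge0 //.
    exact: cosh_le.
  have [H|H] := leP (\sum_l w l * cosh (T l + b l N))
      (\sum_l w l * (cosh (T l) * expR (b l N ^+ 2 / 2))).
    by exists false; under eq_bigr do rewrite mul1r.
  by exists true; under eq_bigr do rewrite mulN1r; lra.
exists (fun i => if (i < N)%N then e i else s).
under eq_bigr => l _.
  rewrite big_ord_recr /= ltnn addrA.
  under eq_bigr => i _ do rewrite ltn_ord.
  over.
apply: le_trans Hs _; under eq_bigr => l _ do rewrite (mulrC (cosh _)) mulrA.
apply: le_trans He _; rewrite le_eqVlt; apply/orP; left; apply/eqP.
by apply: eq_bigr => l _; rewrite big_ord_recr /= expRD; ring.
Qed.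

(** With the coefficients scaled by t / sg, the potential is at most |I| e^(t^2/2), while a single
    term is at least e^|y| / 2, with y the scaled sum. As t^2 = 1 + ln (2 |I|), this gives |y| <= 2
    t^2, whence the factor 2. *)
Lemma signs_bound (I : finType) N (b : I -> nat -> R) (sg : R) : 0 < sg ->
  (0 < #|I|)%N ->
  (forall l, \sum_(i < N) b l i ^+ 2 <= sg ^+ 2) -> exists e : nat -> bool,
  forall l, `|\sum_(i < N) (-1) ^+ e i * b l i| <=
    2 * sg * Num.sqrt (1 + ln (#|I|%:R * 2)).
Proof.
move=> sg0 I0 bs; set n := #|I|.
have n1 : 1 <= n%:R :> R by rewrite ler1n.
have ln0 : 0 <= ln (n%:R * 2 : R) by rewrite ln_ge0 //; lra.
pose t := Num.sqrt (1 + ln (n%:R * 2 : R)).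
have t1 : 1 <= t by rewrite -[leLHS]sqrtr1 ler_wsqrtr // lerDl.
have t2 : t ^+ 2 = 1 + ln (n%:R * 2) by rewrite sqr_sqrtr //; lra.
have [e He] := @signs_potential I N (fun=> 1) (fun=> 0)
  (fun l i => t / sg * b l i) (fun=> ler01).
exists e => l; rewrite -/t; set s := \sum_(i < N) _.
have cosh1 : cosh (t / sg * s) <= n%:R * expR (t ^+ 2 / 2).
  apply: (@le_trans _ _ (\sum_(l : I) 1 * expR (t ^+ 2 / 2))); last first.
    by rewrite sumr_const mul1r mulr_natl.
  apply: le_trans (le_trans _ He) _.
    rewrite (bigD1 l) //= mul1r add0r ler_wpDr //.
      by apply: sumr_ge0 => l' _; rewrite mul1r cosh_ge0.
    rewrite le_eqVlt; apply/orP; left; apply/eqP; congr cosh.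
    by rewrite mulr_sumr; apply: eq_bigr => i _; ring.
  apply: ler_sum => l' _; rewrite !mul1r (_ : cosh 0 = 1) ?mul1r; last first.
    by rewrite /cosh oppr0 expR0; field.
  rewrite ler_expR -mulr_suml ler_wpM2r //.
  under eq_bigr do rewrite exprMn.
  rewrite -mulr_sumr exprMn.
  apply: le_trans (ler_wpM2l _ (bs l')) _; first by rewrite mulr_ge0 ?sqr_ge0.
  by rewrite le_eqVlt; apply/orP; left; apply/eqP; field; rewrite gt_eqF.
have exp1 : expR `|t / sg * s| / 2 <= cosh (t / sg * s).
  rewrite /cosh ler_wpM2r // ; have := expR_ge0 (t / sg * s).
  have := expR_ge0 (- (t / sg * s)).
  by case: (ger0P (t / sg * s)) => _; lra.
have : expR `|t / sg * s| <= expR (2 * t ^+ 2).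
  apply: le_trans (_ : expR (ln (n%:R * 2 : R)) * expR (t ^+ 2 / 2) <= _).
    by rewrite lnK ?posrE; lra.
  by rewrite -expRD ler_expR t2; lra.
rewrite ler_expR normrM (ger0_norm (_ : 0 <= t / sg)); last first.
  by rewrite divr_ge0; lra.
rewrite (mulrC _ `|s|) mulrA ler_pdivrMr // => H.
have t0 : 0 < t by lra.
by rewrite -(ler_pM2r t0); lra.
Qed.

End signs.

(** * Discretisation of the supremum *)

Section net.
Variable R : realType.
Implicit Types t s : R.

Definition grid (D : nat) (j : nat) : R := j%:R / D%:R - D%:R.

(** One grid point serves all [n] at once. A point outside [-D, D] is clamped to the boundary, since
    [xh_le] makes [h n] of size (n + 1)^2 / D out there. The constant is 24 = 8 + 16: the mesh, and
    the two values compared when clamping. *)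
Lemma grid_near D t : (0 < D)%N -> exists j : 'I_((2 * D ^ 2).+1),
  forall n, `|h n t - h n (grid D j)| <= 24 * n.+1%:R ^+ 2 / D%:R.
Proof.
move=> D0; have D0' : 0 < D%:R :> R by rewrite ltr0n.
pose s := Num.max (- D%:R) (Num.min t D%:R).
have s1 : - D%:R <= s by rewrite le_max lexx.
have s2 : s <= D%:R by rewrite ge_max ge_min lexx orbT andbT; lra.
have z0 : 0 <= (s + D%:R) * D%:R by rewrite mulr_ge0 //; lra.
have /andP[z1 z2] := truncn_itv z0.
set j := Num.truncn _ in z1 z2.
have jD : (j < (2 * D ^ 2).+1)%N.
  rewrite ltnS -(ler_nat R); apply: le_trans z1 _.
  by rewrite natrM natrX; have : (s + D%:R) * D%:R <= (2 * D%:R) * D%:R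
    by [rewrite ler_wpM2r //; lra|]; lra.
exists (Ordinal jD) => n /=; set B := n.+1%:R ^+ 2.
have B0 : 0 <= B by exact: sqr_ge0.
have near : `|h n s - h n (grid D j)| <= 8 * B / D%:R.
  apply: le_trans (isd_lip _ _ (isd_h n) (dh_le n)) _.
  rewrite ler_wpM2l ?mulr_ge0 // /grid opprB addrA.
  have -> : s + D%:R - j%:R / D%:R = ((s + D%:R) * D%:R - j%:R) / D%:R.
    by field; rewrite gt_eqF.
  rewrite normrM normfV (gtr0_norm D0') ler_piMl ?invr_ge0 //.
  by rewrite -natr1 in z2; rewrite ger0_norm; lra.
have far u : D%:R <= `|u| -> `|h n u| <= 8 * B / D%:R.
  move=> Du; rewrite ler_pdivlMr // mulrC; apply: le_trans (xh_le n u).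
  by rewrite normrM ler_wpM2r.
have clamp : `|h n t - h n s| <= 16 * B / D%:R.
  have [tD|tD] := leP `|t| D%:R.
    have -> : s = t.
      move: tD; rewrite /s ler_norml => /andP[t1 t2].
      by rewrite (min_idPl t2) (max_idPr t1).
    by rewrite subrr normr0 divr_ge0 ?mulr_ge0 ?ltW.
  have sD : D%:R <= `|s|.
    rewrite /s; have [t0|t0] := ger0P t; rewrite ?(ger0_norm t0) ?(ltr0_norm t0) in tD.
      rewrite (min_idPr (ltW tD)) (max_idPr _) ?ger0_norm //; lra.
    rewrite (min_idPl _) ?(max_idPl _) ?normrN ?ger0_norm //; lra.
  apply: le_trans (ler_normB _ _) _.
  by have := far _ sD; have := far _ (ltW tD); lra.
have -> : h n t - h n (grid D j) = (h n t - h n s) + (h n s - h n (grid D j)) by ring.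
by apply: le_trans (ler_normD _ _) _; lra.
Qed.

Lemma prod_dist d (u v : 'I_d -> R) (H e : R) : 1 <= H -> 0 <= e ->
  (forall i, `|u i| <= H) -> (forall i, `|v i| <= H) ->
  (forall i, `|u i - v i| <= e) ->
  `|\prod_i u i - \prod_i v i| <= d%:R * H ^+ d * e.
Proof.
move=> H1 e0; elim: d u v => [|d IH] u v uH vH uv.
  by rewrite !big_ord0 subrr normr0 !mul0r.
rewrite !big_ord_recl; set U := \prod_(i < d) _; set V := \prod_(i < d) _.
have UV : `|U - V| <= d%:R * H ^+ d * e by apply: IH.
have VH : `|V| <= H ^+ d.
  rewrite normr_prod -[X in _ <= _ ^+ X]card_ord -prodr_const.
  by apply: ler_prod => i _; rewrite normr_ge0 vH.
have -> : u ord0 * U - v ord0 * V = u ord0 * (U - V) + (u ord0 - v ord0) * V by ring.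
apply: le_trans (ler_normD _ _) _; rewrite !normrM.
have H0 : 0 <= H by lra.
have Hd : 0 <= H ^+ d by rewrite exprn_ge0.
have h1 := ler_pM (normr_ge0 _) (normr_ge0 _) (uH ord0) UV.
have h2 := ler_pM (normr_ge0 _) (normr_ge0 _) (uv ord0) VH.
apply: le_trans (lerD h1 h2) _; rewrite exprS -[d.+1%:R]natr1.
have : 0 <= (H - 1) * (H ^+ d * e) by rewrite mulr_ge0 ?mulr_ge0 //; lra.
by lra.
Qed.

Definition gridp d D (y : {ffun 'I_d -> 'I_((2 * D ^ 2).+1)}) (i : 'I_d) : R :=
  grid D (y i).

Lemma prodh_near d D (X : 'I_d -> R) : (0 < D)%N ->
  exists y : {ffun 'I_d -> 'I_((2 * D ^ 2).+1)},
  forall k (a : 'I_d -> nat), (forall i, (a i <= k)%N) ->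
  `|prodh a X - prodh a (gridp y)| <=
    24 * d%:R * 2 ^+ d * k.+1%:R ^+ (d + 2) / D%:R.
Proof.
move=> D0.
have /all_sig[f Hf] : forall i, {j : 'I_((2 * D ^ 2).+1) |
    forall n, `|h n (X i) - h n (grid D j)| <= 24 * n.+1%:R ^+ 2 / D%:R}.
  by move=> i; apply: cid; exact: grid_near.
exists [ffun i => f i] => k a ak.
have k1 : 1 <= k.+1%:R :> R by rewrite ler1n.
have bnd n t : (n <= k)%N -> `|h n t| <= 2 * k.+1%:R.
  move=> nk; apply: le_trans (h_le _ _) _.
  by rewrite ler_wpM2l // ler_nat.
apply: le_trans (@prod_dist _ _ _ (2 * k.+1%:R) (24 * k.+1%:R ^+ 2 / D%:R) _ _ _ _ _) _.
- by lra.
- by rewrite divr_ge0 ?mulr_ge0 ?sqr_ge0.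
- by move=> i; exact: bnd.
- by move=> i; exact: bnd.
- move=> i; rewrite /gridp ffunE; apply: le_trans (Hf i _) _.
  rewrite ler_wpM2r ?invr_ge0 // ler_wpM2l // ler_pXn2r ?nnegrE //.
  by rewrite ler_nat ltnS.
rewrite exprMn exprD le_eqVlt; apply/orP; left; apply/eqP; ring.
Qed.

End net.

(** * A unitary change of basis with flat rows *)

Section dft.
Variable R : realType.
Local Open Scope complex_scope.

(** X^N - 1 splits over [R[i]] and is separable in characteristic 0; a group formed by N distinct
    roots of unity is cyclic. *)
Lemma prim_root_complex N : (0 < N)%N -> exists z : R[i], N.-primitive_root z.
Proof.
move=> N0; have [rs E] := closed_field_poly_normal ('X^N - 1 : {poly R[i]}).
rewrite (monicP (monicXnsubC _ N0)) scale1r in E.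
have unity : all N.-unity_root rs.
  by apply/allP => z; rewrite -root_prod_XsubC -E.
have size_rs : (N <= size rs)%N.
  by rewrite -ltnS -(size_prod_XsubC rs id) -E size_XnsubC.
have uniq_rs : uniq rs.
  by rewrite -separable.separable_prod_XsubC -E cyclotomic.separable_Xn_sub_1 // pnatr_eq0 -lt0n.
by have /hasP[z _ pz] := cyclic.has_prim_root N0 unity uniq_rs size_rs; exists z.
Qed.

Lemma normc_rootC N (z : R[i]) : N.-primitive_root z -> z * conjc z = 1.
Proof.
move=> pz; have N0 := prim_order_gt0 pz.
have := congr1 Num.norm (prim_expr_order pz); rewrite normrX normr1 => /eqP.
by rewrite pexpr_eq1 // => /eqP z1; rewrite -sqr_normc z1 expr1n.
Qed.

(** Off the diagonal, the products of rows are geometric sums over an N-th root of unity w = z^(i -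
    l) different from 1, hence vanish. *)
Lemma dft N : (0 < N)%N -> exists V : 'M[R[i]]_N,
  V *m (map_mx conjc V)^T = 1%:M /\
  forall i j, V i j * conjc (V i j) = (N%:R^-1)%:C.
Proof.
move=> N0; have [z pz] := prim_root_complex N0; have zz := normc_rootC pz.
have z0 : z != 0 by apply/eqP => z0; move/eqP: zz; rewrite z0 mul0r eq_sym oner_eq0.
have zJ : conjc z = z^-1 by apply: (mulfI z0); rewrite zz mulfV.
pose s : R[i] := (Num.sqrt N%:R^-1)%:C.
have ss : s * s = (N%:R^-1)%:C.
  by rewrite /s -rmorphM -expr2 sqr_sqrtr // invr_ge0.
have sJ : conjc s = s by exact: conjc_real.
pose V : 'M[R[i]]_N := \matrix_(i, j) (z ^+ (i * j) * s).
exists V.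
have cM (a b : R[i]) : conjc (a * b) = conjc a * conjc b by exact: rmorphM.
have zXJ n : conjc (z ^+ n) = z ^- n by rewrite rmorphXn /= zJ exprVn.
split=> [|i j]; last first.
  rewrite mxE cM zXJ sJ mulrACA ss mulfV ?mul1r //.
  by rewrite expf_neq0.
apply/matrixP => i l; rewrite !mxE.
pose w := z ^+ i / z ^+ l.
have -> : \sum_j V i j * (map_mx conjc V)^T j l =
    (\sum_(j < N) w ^+ j) * (N%:R^-1)%:C.
  rewrite mulr_suml; apply: eq_bigr => j _.
  rewrite !mxE cM zXJ sJ mulrACA ss /w expr_div_n -!exprM; congr (_ * _).
have [il|il] := eqVneq i l.
  have -> : w = 1 by rewrite /w il mulfV ?expf_neq0.
  under eq_bigr do rewrite expr1n.
  rewrite sumr_const card_ord -(rmorph_nat (real_complex R)) -rmorphM /= mulfV //.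
  by rewrite pnatr_eq0 -lt0n.
have w1 : w - 1 != 0.
  rewrite subr_eq0 /w; apply/eqP => /(congr1 (fun y => y * z ^+ l)).
  rewrite mul1r divfK ?expf_neq0 // => /eqP; rewrite (eq_prim_root_expr pz).
  by rewrite !modn_small // => /eqP /val_inj /eqP; rewrite (negPf il).
have wN : w ^+ N = 1.
  rewrite /w expr_div_n -!exprM !(mulnC _ N) !exprM (prim_expr_order pz).
  by rewrite !expr1n divr1.
suff -> : \sum_(j < N) w ^+ j = 0 by rewrite mul0r.
by apply: (mulfI w1); rewrite -subrX1 wN subrr mulr0.
Qed.

End dft.

Section flat_basis.
Variable R : realType.
Local Open Scope complex_scope.
Implicit Types (m d k : nat).

Lemma normc_le_ReIm (z : R[i]) : Normc.normc z <= `|complex.Re z| + `|complex.Im z|.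
Proof.
case: z => a b /=; rewrite -(@ler_pXn2r _ 2) ?nnegrE ?sqrtr_ge0 ?addr_ge0 //.
rewrite sqr_sqrtr ?addr_ge0 ?sqr_ge0 // sqrrD !real_normK ?num_real //.
by have := mulr_ge0 (normr_ge0 a) (normr_ge0 b); lra.
Qed.

Lemma Re_sum (I : finType) (F : I -> R[i]) (c : I -> R) :
  complex.Re (\sum_a F a * (c a)%:C) = \sum_a complex.Re (F a) * c a.
Proof.
rewrite (big_morph (@complex.Re R) (id1 := 0) (op1 := +%R)) //; last by case=> ? ? [].
by apply: eq_bigr => a _; case: (F a) => x y /=; rewrite mulr0 subr0.
Qed.

Lemma Im_sum (I : finType) (F : I -> R[i]) (c : I -> R) :
  complex.Im (\sum_a F a * (c a)%:C) = \sum_a complex.Im (F a) * c a.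
Proof.
rewrite (big_morph (@complex.Im R) (id1 := 0) (op1 := +%R)) //; last by case=> ? ? [].
by apply: eq_bigr => a _; case: (F a) => x y /=; rewrite mulr0 add0r.
Qed.

Definition cpart (c : bool) (z : R[i]) := if c then complex.Re z else complex.Im z.

Lemma cpart_sum c (I : finType) (F : I -> R[i]) (x : I -> R) :
  cpart c (\sum_a F a * (x a)%:C) = \sum_a cpart c (F a) * x a.
Proof. by case: c; [exact: Re_sum|exact: Im_sum]. Qed.

Lemma cpart_le c (z : R[i]) N : z * conjc z = (N%:R^-1)%:C -> cpart c z ^+ 2 <= N%:R^-1.
Proof.
case: z => a b; rewrite /cpart; case=> <- _.
by case: c; rewrite /= mulrN opprK -!expr2 ?lerDl ?lerDr sqr_ge0.
Qed.

Lemma sign_cpart c (e : bool) (z : R[i]) : cpart c ((-1) ^+ e * z) = (-1) ^+ e * cpart c z.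
Proof. by case: c; case: e; case: z => a b /=; rewrite ?expr0 ?expr1 /=; ring. Qed.

(* Flipping the columns of the discrete Fourier matrix by suitable signs makes
   all the rows small at the finitely many points of the grid. *)
Lemma flat_rows d k D (S : R) : (0 < D)%N -> 0 < S -> (0 < #|mi d k|)%N ->
  (forall X : 'I_d -> R, \sum_(a in mi d k) prodh (fun i => a i) X ^+ 2 <= S) ->
  exists U : 'M[R[i]]_#|mi d k|, U *m (map_mx conjc U)^T = 1%:M /\
  forall j X, Normc.normc (\sum_a U j a *
      (prodh (fun i => enum_val a i) X)%:C) <=
    2 * (2 * Num.sqrt (S / #|mi d k|%:R) *
      Num.sqrt (1 + ln ((2 * #|mi d k| * ((2 * D ^ 2).+1) ^ d)%:R * 2)) +
    #|mi d k|%:R * (24 * d%:R * 2 ^+ d * k.+1%:R ^+ (d + 2) / D%:R)).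
Proof.
move=> D0 S0; set N := #|mi d k| => N0 shellS.
have N0' : 0 < N%:R :> R by rewrite ltr0n.
have [V [VV Vf]] := @dft R N N0.
pose p (a : 'I_N) (X : 'I_d -> R) := prodh (fun i => enum_val a i) X.
have pS X : \sum_a p a X ^+ 2 <= S.
  apply: le_trans (shellS X); rewrite [leRHS]big_enum_val /=.
  by rewrite lexx.
(* The tests are indexed by real or imaginary part, row, and grid point. In [b] the default 0 is
   never reached in the sums, where the column index stays below N. *)
pose I := (bool * 'I_N * {ffun 'I_d -> 'I_((2 * D ^ 2).+1)})%type.
pose b (l : I) (i : nat) : R := if insub i is Some a then
   cpart l.1.1 (V l.1.2 a) * p a (gridp R l.2) else 0.
have bE l (a : 'I_N) : b l a = cpart l.1.1 (V l.1.2 a) * p a (gridp R l.2).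
  by rewrite /b valK.
have cardI : #|{: I}| = (2 * N * ((2 * D ^ 2).+1) ^ d)%N.
  by rewrite !card_prod card_bool card_ffun !card_ord.
have sg0 : 0 < Num.sqrt (S / N%:R) by rewrite sqrtr_gt0 divr_gt0.
have [||e He] := @signs_bound R I N b _ sg0.
- by rewrite cardI !muln_gt0 N0 expn_gt0.
- move=> l; rewrite (sqr_sqrtr (divr_ge0 (ltW S0) (ltW N0'))) [leRHS]mulrC.
  apply: le_trans (ler_wpM2l _ (pS (gridp R l.2))); last by rewrite invr_ge0.
  rewrite mulr_sumr; apply: ler_sum => a _; rewrite bE exprMn.
  by rewrite ler_wpM2r ?sqr_ge0 // cpart_le.
pose U : 'M[R[i]]_N := \matrix_(j, a) ((-1) ^+ e a * V j a).
exists U; split.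
  rewrite -VV; apply/matrixP => i j; rewrite !mxE; apply: eq_bigr => a _.
  rewrite !mxE; have -> : conjc ((-1) ^+ e a * V j a) = (-1) ^+ e a * conjc (V j a).
    by case: (e a); rewrite ?expr0 ?expr1 ?mul1r // !mulN1r; exact: rmorphN.
  by rewrite mulrACA -expr2 sqrr_sign mul1r.
move=> j X; apply: le_trans (normc_le_ReIm _) _.
have [y Hy] := prodh_near X D0.
suff C c : `|cpart c (\sum_a U j a * (prodh (fun i => enum_val a i) X)%:C)| <=
   2 * Num.sqrt (S / N%:R) *
      Num.sqrt (1 + ln ((2 * N * ((2 * D ^ 2).+1) ^ d)%:R * 2)) +
    N%:R * (24 * d%:R * 2 ^+ d * k.+1%:R ^+ (d + 2) / D%:R).
  by rewrite [X in _ <= X]mulrDl mul1r; apply: lerD; [exact: (C true)|exact: (C false)].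
rewrite cpart_sum.
have -> : \sum_a cpart c (U j a) * prodh (fun i => enum_val a i) X =
    \sum_(a < N) (-1) ^+ e a * b (c, j, y) a +
    \sum_(a < N) cpart c (U j a) * (p a X - p a (gridp R y)).
  rewrite -big_split; apply: eq_bigr => a _ /=.
  by rewrite bE /= mxE sign_cpart /p; ring.
apply: le_trans (ler_normD _ _) _; apply: lerD.
  by have := He (c, j, y); rewrite cardI.
apply: le_trans (ler_norm_sum _ _ _) _.
set E := (X in _ <= N%:R * X); apply: (@le_trans _ _ (\sum_(a < N) E)); last first.
  by rewrite sumr_const card_ord mulr_natl.
apply: ler_sum => a _.
rewrite normrM -[leRHS]mul1r; apply: ler_pM => //.
  rewrite mxE sign_cpart normrM normrX normrN1 expr1n mul1r.
  rewrite -(@ler_pXn2r _ 2) ?nnegrE // real_normK ?num_real // expr1n.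
  apply: le_trans (cpart_le c (Vf j a)) _.
  by rewrite invf_le1 // ler1n.
by apply: Hy => i; rewrite -ltnS.
Qed.

End flat_basis.

(** * Constants in terms of the eigenvalue *)

Section constants.
Variable R : realType.
Implicit Types (m d k : nat) (x y : R).
Local Open Scope complex_scope.

(** Passing to fourth powers turns square roots and the exponent d / 4 into polynomial inequalities;
    1 + B is a convenient majorant of the fourth root of B. *)
Lemma quarter_power d (lam y B : R) : 1 <= lam -> 0 <= y -> 0 <= B ->
  y ^+ 4 * lam ^+ d <= B -> y <= (1 + B) * lam `^ (- (d%:R / 4)).
Proof.
move=> lam1 y0 B0 H.
have w0 : 0 <= (1 + B) * lam `^ (- (d%:R / 4)) by rewrite mulr_ge0 ?powR_ge0; lra.
have ld : 0 < lam ^+ d by rewrite exprn_gt0; lra.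
rewrite -(@ler_pXn2r _ 4) ?nnegrE // -(ler_pM2r ld); apply: le_trans H _.
have -> : ((1 + B) * lam `^ (- (d%:R / 4))) ^+ 4 * lam ^+ d = (1 + B) ^+ 4.
  rewrite exprMn -mulrA -[X in _ * X]mulr1 -[RHS]mulr1; congr (_ * _).
  rewrite mulr1 -[X in X * _]powR_mulrn ?powR_ge0 // -powRrM.
  rewrite -[X in _ * X]powR_mulrn; last by lra.
  rewrite -powRD; last by apply/implyP => _; rewrite gt_eqF //; lra.
  by rewrite (_ : _ + _ = 0) ?powRr0 //; field.
have B1 : 1 <= 1 + B by lra.
rewrite exprS; have : 1 <= (1 + B) ^+ 3 by rewrite exprn_ege1.
by have := B0; nra.
Qed.

(* [S / N <= const * (k + 1) ^ (- d / 2)] *)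
Lemma variance_quarter m k (N : nat) (lam C : R) : (0 < N)%N -> 0 <= C ->
  ((k %/ m.+1).+1 ^ m.+1 <= N)%N -> 0 <= lam -> lam <= m.+2%:R * k.+1%:R ->
  Num.sqrt (C * (4 * Num.sqrt k.+1%:R) ^+ m / N%:R) ^+ 4 * lam ^+ m.+2 <=
  C ^+ 2 * 16 ^+ m * m.+1%:R ^+ (2 * m.+1) * m.+2%:R ^+ m.+2.
Proof.
move=> N0 C0 Nge lam0 lamle.
have N0' : 0 < N%:R :> R by rewrite ltr0n.
set n := k.+1%:R : R; have n0 : 0 < n by rewrite ltr0n.
have sn0 : 0 <= 4 * Num.sqrt n by rewrite mulr_ge0 ?sqrtr_ge0.
have S0 : 0 <= C * (4 * Num.sqrt n) ^+ m / N%:R.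
  by rewrite divr_ge0 ?(ltW N0') // mulr_ge0 // exprn_ge0.
have sq4 : ((4 * Num.sqrt n) ^+ m) ^+ 2 = 16 ^+ m * n ^+ m.
  rewrite -exprM (mulnC m) exprM -[RHS]exprMn; congr (_ ^+ m).
  by rewrite exprMn sqr_sqrtr ?(ltW n0) // expr2; lra.
have -> : Num.sqrt (C * (4 * Num.sqrt n) ^+ m / N%:R) ^+ 4 =
    C ^+ 2 * (16 ^+ m * n ^+ m) / N%:R ^+ 2.
  by rewrite (exprM _ 2 2) sqr_sqrtr // [LHS]exprMn exprVn [in LHS]exprMn sq4.
have nN : n ^+ m.+1 <= m.+1%:R ^+ m.+1 * N%:R.
  rewrite -!natrX -natrM ler_nat; apply: leq_trans (leq_mul (leqnn _) Nge).
  by rewrite -expnMn leq_exp2r // mulnC ltn_ceil.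
have lamd : lam ^+ m.+2 <= m.+2%:R ^+ m.+2 * n ^+ m.+2.
  by rewrite -exprMn ler_pXn2r ?nnegrE // mulr_ge0.
have nn : n ^+ m * n ^+ m.+2 <= m.+1%:R ^+ (2 * m.+1) * N%:R ^+ 2.
  have -> : n ^+ m * n ^+ m.+2 = (n ^+ m.+1) ^+ 2.
    by rewrite -exprD -exprM; congr (_ ^+ _); lia.
  rewrite mulnC exprM -exprMn ler_pXn2r ?nnegrE //.
    by rewrite exprn_ge0 // ltW.
have c0 : 0 <= C ^+ 2 * 16 ^+ m by rewrite mulr_ge0 ?exprn_ge0.
have nm0 : 0 <= n ^+ m by rewrite exprn_ge0 // ltW.
have N2 : 0 < N%:R ^+ 2 :> R by rewrite exprn_gt0.
have d0 : 0 <= m.+2%:R ^+ m.+2 :> R by rewrite exprn_ge0.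
move: (C ^+ 2) (16 ^+ m) (N%:R ^+ 2) (lam ^+ m.+2) (n ^+ m) (n ^+ m.+2)
  (m.+1%:R ^+ (2 * m.+1)) (m.+2%:R ^+ m.+2) c0 nm0 N2 d0 lamd nn.
move=> a b c x y z u v c0 nm0 N2 d0 lamd nn.
have -> : a * (b * y) / c * x = a * b * (y * x) / c by ring.
rewrite ler_pdivrMr // -!(mulrA (a * b)) ler_wpM2l //.
apply: le_trans (ler_wpM2l nm0 lamd) _.
have -> : y * (v * z) = v * (y * z) by ring.
have -> : u * v * c = v * (u * c) by ring.
by rewrite ler_wpM2l.
Qed.

Lemma error_quarter d k (lam : R) : 0 <= lam -> lam <= d%:R * k.+1%:R ->
  ((k.+1%:R ^+ d)^-1) ^+ 4 * lam ^+ d <= d%:R ^+ d.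
Proof.
move=> lam0 lamle; set n := k.+1%:R : R.
have n1 : 1 <= n by rewrite ler1n.
have nd1 : 1 <= n ^+ d by rewrite exprn_ege1.
have nd0 : 0 < n ^+ d by lra.
rewrite exprVn mulrC ler_pdivrMr ?exprn_gt0 //.
apply: (@le_trans _ _ (d%:R ^+ d * n ^+ d)).
  by rewrite -exprMn; apply: lerXn2r; rewrite ?nnegrE // (le_trans lam0).
rewrite ler_wpM2l ?exprn_ge0 // exprS ler_peMr ?(ltW nd0) //.
by rewrite exprn_ege1.
Qed.

(* With [D = (k + 1) ^ (3 d + 2)] the number of tests is polynomial in [k]. *)
Lemma ln_tests d k (N : nat) (lam : R) :
  (0 < N)%N -> (N <= k.+1 ^ d)%N -> k.+1%:R <= lam ->
  1 + ln ((2 * N * ((2 * (k.+1 ^ (3 * d + 2)) ^ 2).+1) ^ d)%:R * 2 : R) <=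
  (1 + ln (4 * 3 ^+ d) + (d + (6 * d + 4) * d)%:R) * (1 + ln lam).
Proof.
move=> N0 Nle klam; set n := k.+1%:R : R.
have n1 : 1 <= n by rewrite ler1n.
have lnlam : 0 <= ln lam by rewrite ln_ge0 //; apply: le_trans klam.
set e := (d + (6 * d + 4) * d)%N.
have le1 : (2 * N * ((2 * (k.+1 ^ (3 * d + 2)) ^ 2).+1) ^ d * 2 <=
    (4 * 3 ^ d) * k.+1 ^ e)%N.
  have D2 : ((2 * (k.+1 ^ (3 * d + 2)) ^ 2).+1 <= 3 * k.+1 ^ (6 * d + 4))%N.
    rewrite -expnM (_ : (3 * d + 2) * 2 = 6 * d + 4)%N; last by lia.
    by have : (0 < k.+1 ^ (6 * d + 4))%N by [rewrite expn_gt0]; lia.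
  have D2d : (((2 * (k.+1 ^ (3 * d + 2)) ^ 2).+1) ^ d <=
      (3 * k.+1 ^ (6 * d + 4)) ^ d)%N.
    by case: (posnP d) => [->//|d0]; rewrite leq_exp2r.
  have E : (k.+1 ^ d * (3 * k.+1 ^ (6 * d + 4)) ^ d = 3 ^ d * k.+1 ^ e)%N.
    by rewrite expnMn -expnM mulnCA -expnD.
  have := leq_mul Nle D2d; rewrite E.
  move: (_ ^ d)%N (3 ^ d)%N (k.+1 ^ e)%N => X Y Z NX.
  by rewrite (_ : 2 * N * X * 2 = 4 * (N * X))%N -?mulnA ?leq_mul2l //; lia.
have p3 : 0 < 4 * 3 ^+ d :> R by rewrite mulr_gt0 ?exprn_gt0.
have n0 : 0 < n by lra.
have le2 : ln ((2 * N * ((2 * (k.+1 ^ (3 * d + 2)) ^ 2).+1) ^ d)%:R * 2 : R) <=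
    ln (4 * 3 ^+ d) + e%:R * ln n.
  rewrite [X in _ <= _ + X]mulr_natl -lnXn // -lnM ?posrE ?exprn_gt0 // ler_ln ?posrE.
  - by rewrite -natrM; apply: le_trans (_ : ((4 * 3 ^ d) * k.+1 ^ e)%:R <= _);
      rewrite ?ler_nat // !natrM !natrX.
  - by rewrite mulr_gt0 // ltr0n !muln_gt0 N0 expn_gt0.
  - by rewrite mulr_gt0 // exprn_gt0.
have l3 : 0 <= ln (4 * 3 ^+ d : R).
  rewrite ln_ge0 // -natrX -natrM ler1n muln_gt0 expn_gt0 //.
have lnn : ln n <= ln lam by rewrite ler_ln ?posrE //; lra.
have lnn0 : 0 <= ln n by rewrite ln_ge0.
have e0 : 0 <= e%:R :> R by [].
have := ler_wpM2l e0 lnn; have := mulr_ge0 l3 lnlam; have := mulr_ge0 e0 lnlam.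
by lra.
Qed.

(** With n = k + 1 and D = n^(3 d + 2), at most n^d terms, each with error of order n^(d + 2) / D,
    contribute O(n^(-d)), which a constant times lam^(-d/4) dominates. In the main term D only
    appears under the logarithm. *)
Lemma flat_basis m : exists2 M : R, 0 < M & forall k,
  exists U : 'M[R[i]]_#|mi m.+2 k|, U *m (map_mx conjc U)^T = 1%:M /\
  forall j X, Normc.normc (\sum_a U j a *
      (prodh (fun i => enum_val a i) X)%:C) <=
    M * (2 * k + m.+2)%:R `^ (- (m.+2%:R / 4)) *
    (1 + ln (2 * k + m.+2)%:R) `^ 2^-1.
Proof.
set d := m.+2.
have eD : (3 * d + 2 = d + (d + (d + 2)))%N by lia.
have C0 : 0 < 525 :> R by rewrite ltr0n.
have := @shell_le R m; move: (525 : R) C0 => C C0 shellC.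
pose B1 : R := C ^+ 2 * 16 ^+ m * m.+1%:R ^+ (2 * m.+1) * d%:R ^+ d.
pose B2 : R := d%:R ^+ d.
pose CT : R := 1 + ln (4 * 3 ^+ d) + (d + (6 * d + 4) * d)%:R.
pose c : R := 24 * d%:R * 2 ^+ d.
have B10 : 0 <= B1.
  by rewrite /B1 mulr_ge0 ?exprn_ge0 // mulr_ge0 ?exprn_ge0 // mulr_ge0 ?exprn_ge0 // ltW.
have B20 : 0 <= B2 by rewrite exprn_ge0.
have c0 : 0 < c by rewrite /c mulr_gt0 ?exprn_gt0 // mulr_gt0 // ltr0n.
have cB : 0 < c * (1 + B2) by rewrite mulr_gt0 //; lra.
have BT : 0 <= 2 * (1 + B1) * Num.sqrt CT by rewrite mulr_ge0 ?sqrtr_ge0 //; lra.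
exists (2 * (2 * (1 + B1) * Num.sqrt CT + c * (1 + B2))).
  by rewrite mulr_gt0 //; lra.
move=> k; set N := #|mi d k|; set lam : R := (2 * k + d)%:R; set n : R := k.+1%:R.
have n0 : 0 < n by rewrite ltr0n.
have N0 : (0 < N)%N by apply: leq_trans (card_mi_ge m k); rewrite expn_gt0.
have nlam : n <= lam by rewrite ler_nat /d; lia.
have lamn : lam <= d%:R * n by rewrite -natrM ler_nat /d; lia.
have lam1 : 1 <= lam by rewrite ler1n /d; lia.
have lam0 : 0 <= lam by lra.
have lnlam : 0 <= ln lam by rewrite ln_ge0.
pose D := (k.+1 ^ (3 * d + 2))%N.
have D0 : (0 < D)%N by rewrite expn_gt0.
pose S := C * (4 * Num.sqrt n) ^+ m.
have S0 : 0 < S by rewrite mulr_gt0 ?exprn_gt0 // mulr_gt0 // sqrtr_gt0.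
have [U [UU HU]] := flat_rows D0 S0 N0 (shellC k).
exists U; split=> // j X; apply: le_trans (HU j X) _.
rewrite -/N -/n; set w := lam `^ _.
have w0 : 0 <= w by exact: powR_ge0.
rewrite powR12_sqrt; last by lra.
set Lg := Num.sqrt (1 + ln lam).
have Lg1 : 1 <= Lg by rewrite -[leLHS]sqrtr1 ler_wsqrtr //; lra.
have sg : Num.sqrt (S / N%:R) <= (1 + B1) * w.
  apply: (quarter_power lam1 (sqrtr_ge0 _) B10).
  by apply: variance_quarter => //; [exact: ltW|exact: card_mi_ge].
have T : Num.sqrt (1 + ln ((2 * N * ((2 * D ^ 2).+1) ^ d)%:R * 2)) <= Num.sqrt CT * Lg.
  rewrite -sqrtrM; last first.
    rewrite /CT addr_ge0 // addr_ge0 // ln_ge0 //.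
    by rewrite -natrX -natrM ler1n muln_gt0 expn_gt0.
  by rewrite ler_wsqrtr //; apply: ln_tests => //; exact: card_mi_le.
have err : N%:R * (24 * d%:R * 2 ^+ d * n ^+ (d + 2) / D%:R) <= c * ((1 + B2) * w).
  rewrite -/c; apply: (@le_trans _ _ (c * (n ^+ d)^-1)); last first.
    rewrite ler_wpM2l ?(ltW c0) //.
    have x0 : 0 <= (n ^+ d)^-1 by rewrite invr_ge0 exprn_ge0 // ltW.
    by apply: (quarter_power lam1 x0 B20); exact: error_quarter.
  have nd : 0 < n ^+ d by rewrite exprn_gt0.
  have -> : D%:R = n ^+ d * (n ^+ d * n ^+ (d + 2)) by rewrite /D eD natrX !exprD.
  have nd2 : 0 < n ^+ (d + 2) by rewrite exprn_gt0.
  have Nn : N%:R <= n ^+ d :> R by rewrite -natrX ler_nat card_mi_le.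
  move: (n ^+ d) (n ^+ (d + 2)) (N%:R) nd nd2 Nn => x y z x0 y0 zx.
  have -> : z * (c * y / (x * (x * y))) = c * x^-1 * (z / x).
    by field; rewrite !gt_eqF.
  have cx : 0 <= c * x^-1 by rewrite divr_ge0 ?ltW.
  have zx1 : z / x <= 1 by rewrite ler_pdivrMr // mul1r.
  exact: ler_piMr.
have sT := ler_pM (sqrtr_ge0 _) (sqrtr_ge0 _) sg T.
have cw : c * ((1 + B2) * w) <= c * ((1 + B2) * w) * Lg.
  by rewrite ler_peMr // mulr_ge0 ?(ltW c0) // mulr_ge0 //; lra.
apply: (@le_trans _ _ (2 * (2 * ((1 + B1) * w * (Num.sqrt CT * Lg)) +
  c * ((1 + B2) * w) * Lg))).
  rewrite ler_wpM2l // -mulrA; apply: lerD; first by rewrite ler_wpM2l.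
  exact: le_trans err cw.
by rewrite le_eqVlt; apply/orP; left; apply/eqP; ring.
Qed.

End constants.

(** * Orthonormality of the Hermite functions *)

Section gaussian_integrals.
Variable R : realType.
Local Notation mu1 := (@lebesgue_measure R).
Local Open Scope classical_set_scope.
Implicit Types (p q : {poly R}) (x : R).

Lemma measurable_gauss : measurable_fun [set: R] (@gauss R).
Proof.
apply: continuous_measurable_fun => x.
apply: differentiable_continuous; apply/derivable1_diffP.
by have [] := isd_gauss x.
Qed.

Lemma integrable_gauss : mu1.-integrable [set: R] (EFin \o @gauss R).
Proof.
have := @integrable_normal_pdf R 0 1; rewrite /normal_pdf oner_eq0 /=.
move=> /(integrableZl measurableT (normal_peak 1)^-1); apply: eq_integrable => // x _.
rewrite /= -EFinM mulrA mulVf; last by rewrite gt_eqF // normal_peak_gt0 // oner_eq0.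
by rewrite mul1r /normal_fun /gauss subr0 expr1n mulNr mulr2n.
Qed.

Lemma le_gauss_integrable (f : R -> R) C : measurable_fun [set: R] f ->
  (forall x, `|f x| <= C * gauss x) -> mu1.-integrable [set: R] (EFin \o f).
Proof.
move=> mf fC.
apply: (le_integrable measurableT _ _ (integrableZl measurableT C integrable_gauss)).
  exact/measurable_EFinP.
move=> x _ /=; rewrite lee_fin; apply: le_trans (fC x) _; exact: ler_norm.
Qed.

Lemma exp_ge_pow (y : R) n : 0 <= y -> y ^+ n <= n`!%:R * expR y.
Proof.
move=> y0; case: n => [|n].
  by rewrite fact0 mul1r expr0 -[leLHS]addr0; apply: le_trans (expR_ge1Dx y); lra.
rewrite mulrC -ler_pdivrMr ?ltr0n ?fact_gt0 //.
by apply: le_trans (expR_ge1Dxn n y0); rewrite lerDr.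
Qed.

(** Half of the Gaussian exponent pays for the polynomial and half for the exponential, through c
    |x| <= c^2 + x^2 / 4. *)
Lemma poly_gauss_bounded p (c : R) : exists2 C, 0 <= C &
  forall x, `|p.[x]| * expR (c * `|x|) * gauss x <= C.
Proof.
pose S := \sum_(i < size p) `|p`_i| * (1 + 4 ^+ i * i`!%:R).
have S0 : 0 <= S.
  by apply: sumr_ge0 => i _; rewrite mulr_ge0 // addr_ge0 // mulr_ge0 ?exprn_ge0.
exists (S * expR (c ^+ 2)) => [|x]; first by rewrite mulr_ge0 ?expR_ge0.
set y := x ^+ 2 / 4; have y0 : 0 <= y by rewrite divr_ge0 ?sqr_ge0.
have e1 : 1 <= expR y by apply: le_trans (expR_ge1Dx y); lra.
have pS : `|p.[x]| <= S * expR y.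
  rewrite horner_coef mulr_suml; apply: le_trans (ler_norm_sum _ _ _) _.
  apply: ler_sum => i _; rewrite normrM -mulrA ler_wpM2l // normrX.
  have le1 : `|x| ^+ i <= 1 + (x ^+ 2) ^+ i.
    have x2 : 0 <= (x ^+ 2) ^+ i by rewrite exprn_ge0 ?sqr_ge0.
    have [x1|x1] := leP `|x| 1.
      by apply: (@le_trans _ _ 1); [exact: exprn_ile1|lra].
    rewrite -(real_normK (num_real x)) -exprM mul2n.
    have : `|x| ^+ i <= `|x| ^+ i.*2 by rewrite ler_weXn2l ?ltW // -addnn leq_addr.
    by lra.
  have le2 : (x ^+ 2) ^+ i <= 4 ^+ i * i`!%:R * expR y.
    rewrite (_ : x ^+ 2 = 4 * y); last by rewrite /y; field.
    rewrite exprMn -mulrA ler_wpM2l ?exprn_ge0 //; exact: exp_ge_pow.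
  by apply: le_trans le1 _; rewrite mulrDl mul1r; lra.
have le3 : expR (c * `|x|) * gauss x <= expR (c ^+ 2) * expR (- y).
  rewrite /gauss -!expRD ler_expR /y.
  have := sqr_ge0 (c - `|x| / 2); have := real_normK (num_real x) => <-; nra.
rewrite -mulrA; apply: le_trans (ler_pM _ _ pS le3) _ => //.
  by rewrite mulr_ge0 ?expR_ge0.
rewrite mulrACA mulrA -(mulrA _ (expR y)) [expR y * _]mulrC !mulrA.
by rewrite -(mulrA _ (expR (- y))) -expRD addNr expR0 mulr1.
Qed.

Lemma measurable_horner p : measurable_fun [set: R] (horner p).
Proof. by apply: continuous_measurable_fun => x; exact: continuous_horner. Qed.

Lemma poly_gauss_integrable p :
  mu1.-integrable [set: R] (EFin \o (fun x => p.[x] * gauss x ^+ 2)).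
Proof.
have [C C0 HC] := poly_gauss_bounded p 0.
apply: (@le_gauss_integrable _ C) => [|x].
  apply: measurable_funM; first exact: measurable_horner.
  by apply: measurable_funX; exact: measurable_gauss.
rewrite normrM normrX (ger0_norm (expR_ge0 _)) expr2 mulrA.
rewrite ler_wpM2r ?expR_ge0 //.
by have := HC x; rewrite mul0r expR0 mulr1.
Qed.

Lemma int_gauss2 : \int[mu1]_x (gauss x ^+ 2) = Num.sqrt pi.
Proof.
rewrite /Rintegral; under eq_integral => x _.
  have -> : gauss x ^+ 2 = gauss_fun x.
    by rewrite /gauss /gauss_fun -expRM_natl mulrN; congr expR; field.
  over.
by rewrite integralT_gauss.
Qed.

(* The integral over [-n, n] is [F n - F (- n)], which tends to 0. *)
Lemma int_deriv_gauss p :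
  \int[mu1]_x ((p^`() - 2 *: ('X * p)).[x] * gauss x ^+ 2) = 0.
Proof.
set r := p^`() - _; pose F x := p.[x] * gauss x ^+ 2.
have dF x : isd F x (r.[x] * gauss x ^+ 2).
  apply: isd_eq.
    by apply: isdM; [exact: is_derive_poly|apply: isdX; exact: isd_gauss].
  by rewrite /r hornerD hornerN hornerZ hornerM hornerX /=; ring.
pose g x := r.[x] * gauss x ^+ 2.
have cg : continuous g.
  move=> x; apply: cvgM; first exact: continuous_horner.
  apply: cvgM; apply: differentiable_continuous; apply/derivable1_diffP;
    by have [] := isd_gauss x.
have ig := poly_gauss_integrable r.
pose gn n := (EFin \o g) \_ `[- n.+1%:R, n.+1%:R].
have mg : measurable_fun setT g by exact: continuous_measurable_fun.
have cvg1 : (\int[mu1]_x gn n x)%E @[n --> \oo] --> (\int[mu1]_x (EFin \o g) x)%E.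
  have := @dominated_cvg _ _ R mu1 setT measurableT gn (EFin \o g) (abse \o (EFin \o g)). apply => //.
  - move=> n; apply/(measurable_restrictT _ _).1 => //.
    by apply: measurable_funTS; exact/measurable_EFinP.
  - move=> x _; apply: cvg_near_cst; exists (Num.truncn `|x|) => // n /= xn.
    rewrite /gn patchE mem_set //= in_itv /= -ler_norml.
    have /andP[_ /ltW xt] := truncn_itv (normr_ge0 x).
    by apply: le_trans xt _; rewrite ler_nat.
  - exact: integrable_abse.
  - move=> n x _; rewrite /gn patchE; case: ifPn => // _.
    by rewrite abse0 abse_ge0.
have int_gn n : (\int[mu1]_x gn n x)%E = (F n.+1%:R - F (- n.+1%:R))%:E.
  rewrite /gn -integral_mkcond (@continuous_FTC2 R g F) //.
  - have n0 : 0 < n.+1%:R :> R by rewrite ltr0n.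
    by lra.
  - by apply: continuous_subspaceT.
  - have cF x : {for x, continuous F}.
      by apply: differentiable_continuous; apply/derivable1_diffP; have [] := dF x.
    split=> [x _||]; first by have [] := dF x.
      exact/cvg_at_right_filter/cF.
    exact/cvg_at_left_filter/cF.
  - by move=> x _; rewrite derive1E; have [_ ->] := dF x.
have [C C0 HC] := poly_gauss_bounded p 0.
have FC n x : `|x| = n.+1%:R -> `|F x| <= C * (2 * harmonic n).
  move=> xn; have gn2 : gauss x <= 2 * harmonic n.
    have n0 : 0 < n.+1%:R :> R by rewrite ltr0n.
    have e : n.+1%:R / 2 <= expR (x ^+ 2 / 2).
      apply: le_trans (expR_ge1Dx _); rewrite -(real_normK (num_real x)) xn.
      have := sqr_ge0 (n.+1%:R - 1 : R); lra.
    rewrite /gauss /harmonic /= expRN -[leLHS]mul1r ler_pdivrMr ?expR_gt0 //.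
    rewrite -(@ler_pM2l _ (n.+1%:R / 2)) ?divr_gt0 // mulr1; apply: le_trans e _.
    rewrite le_eqVlt; apply/orP; left; apply/eqP.
    by move: (n.+1%:R : R) n0 => z z0; field; rewrite gt_eqF.
  have := HC x; rewrite mul0r expR0 mulr1 => Hx.
  rewrite /F normrM normrX (ger0_norm (expR_ge0 _)) expr2 mulrA.
  by apply: ler_pM => //; rewrite ?mulr_ge0 ?expR_ge0.
have cvg0 : (F n.+1%:R - F (- n.+1%:R)) @[n --> \oo] --> (0 : R).
  apply: (@squeeze_cvgr _ _ _ _ (fun n => - (4 * C) * harmonic n)
    (fun n => 4 * C * harmonic n)).
  - near=> n; rewrite mulNr -ler_norml; apply: le_trans (ler_normB _ _) _.
    have n0 : 0 <= n.+1%:R :> R by [].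
    have := FC n n.+1%:R (ger0_norm n0).
    have := FC n (- n.+1%:R); rewrite normrN => /(_ (ger0_norm n0)); lra.
  - by rewrite -(mulr0 (- (4 * C))); apply: cvgM; [exact: cvg_cst|exact: cvg_harmonic].
  - by rewrite -(mulr0 (4 * C)); apply: cvgM; [exact: cvg_cst|exact: cvg_harmonic].
have cvg2 : (\int[mu1]_x gn n x)%E @[n --> \oo] --> 0%:E.
  under eq_fun do rewrite int_gn.
  by apply: cvg_EFin => //; exact: nearW.
rewrite /Rintegral; have -> := cvg_unique _ cvg1 cvg2 => //.
Unshelve. all: by end_near. Qed.

Let I p := \int[mu1]_x (p.[x] * gauss x ^+ 2).

Let ID p q : I (p + q) = I p + I q.
Proof.
rewrite /I -RintegralD //; try exact: poly_gauss_integrable.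
by apply: eq_Rintegral => x _; rewrite hornerD mulrDl.
Qed.

Let IZ a p : I (a *: p) = a * I p.
Proof.
rewrite /I -RintegralZl //; last exact: poly_gauss_integrable.
by apply: eq_Rintegral => x _; rewrite hornerZ -mulrA.
Qed.

Let IN p : I (- p) = - I p.
Proof. by rewrite -scaleN1r IZ mulN1r. Qed.

Let I_deriv p : I (2 *: ('X * p)) = I p^`().
Proof.
have : I (p^`() - 2 *: ('X * p)) = 0 by exact: int_deriv_gauss.
by rewrite ID IN => /eqP; rewrite subr_eq0 => /eqP.
Qed.

(** Integration by parts against e^(-x^2) combined with the recurrence: raising the index of [hp]
    is, up to the factor 1/2, adjoint to differentiation. *)
Let I_up p n : lad R n.+1 * I (p * hp R n.+1) = 2^-1 * I (p^`() * hp R n).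
Proof.
rewrite -IZ scalerAr hpS.
have -> : p * ('X * hp R n - lad R n *: hp R n.-1) =
    2^-1 *: (2 *: ('X * (p * hp R n)) - p * ((2 * lad R n) *: hp R n.-1)).
  apply: (@scalerI _ _ (2 : R)); first by rewrite pnatr_eq0.
  rewrite [RHS]scalerA mulfV ?pnatr_eq0 // scale1r.
  by rewrite -!mul_polyC polyCM; ring.
by rewrite -deriv_hp IZ ID IN I_deriv derivM ID addrK.
Qed.

(** [I_up] and [deriv_hp] lower both indices together. When only one index reaches 0, the derivative
    of a constant gives zero; when both do, the Gaussian integral remains. *)
Lemma hp_orthogonal m n : I (hp R m * hp R n) = (m == n)%:R * Num.sqrt pi.
Proof.
have sym p q : I (p * q) = I (q * p) by rewrite mulrC.
have zero n' : I (1 * hp R n'.+1) = 0.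
  apply: (mulfI (lad_neq0 R n')); rewrite I_up derivC mul0r mulr0.
  by rewrite -(scale0r 0) IZ mul0r mulr0.
elim: m n => [|m IH] [|n].
- rewrite /= mulr1 mul1r -int_gauss2.
  by apply: eq_Rintegral => x _; rewrite hornerC mul1r.
- by rewrite [hp R 0]/(1 : {poly R}) zero mul0r.
- by rewrite sym [hp R 0]/(1 : {poly R}) zero mul0r.
- apply: (mulfI (lad_neq0 R n)); rewrite I_up deriv_hp /= -scalerAl IZ IH eqSS.
  by case: eqP => [->|_]; rewrite ?mul0r ?mulr0 // mul1r; field.
Qed.

Lemma h_integrable m n : mu1.-integrable [set: R] (EFin \o (fun x => h m x * h n x)).
Proof.
pose g x := (hp R m * hp R n).[x] * gauss x ^+ 2.
have -> : (EFin \o (fun x => h m x * h n x)) = fun x => ((c0 R ^+ 2)%:E * (EFin \o g) x)%E.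
  by apply/funext => x /=; rewrite /g !hE hornerM -EFinM; congr _%:E; ring.
by apply: integrableZl => //; exact: poly_gauss_integrable.
Qed.

Lemma h_orthonormal m n : \int[mu1]_x (h m x * h n x) = (m == n)%:R.
Proof.
transitivity (c0 R ^+ 2 * I (hp R m * hp R n)).
  rewrite /I -RintegralZl //; last exact: poly_gauss_integrable.
  by apply: eq_Rintegral => x _; rewrite !hE hornerM; ring.
rewrite hp_orthogonal mulrCA c0K mulVf ?mulr1 //.
by rewrite gt_eqF // sqrtr_gt0 pi_gt0.
Qed.

End gaussian_integrals.

(** * Integrals of tensor products *)

Section product_integrals.
Variable R : realType.
Local Notation mu1 := (@lebesgue_measure R).
Local Open Scope classical_set_scope.
Local Open Scope ereal_scope.

Lemma measurable_prod_rV n (f : 'I_n -> R -> R) :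
  (forall i, measurable_fun [set: R] (f i)) ->
  measurable_fun [set: 'rV[R]_n] (fun x => \prod_(i < n) f i (x 0%R i))%R.
Proof.
move=> mf; apply: measurable_prod => i _.
apply: (measurableT_comp (mf i)); exact: measurable_rV_coor.
Qed.

Lemma integral_tensor n (g : R -> R) (F : 'rV[R]_n -> R) :
  mu1.-integrable [set: R] (EFin \o g) ->
  (lebesgue_rV R n).-integrable [set: 'rV[R]_n] (EFin \o F) ->
  (mu1 \x lebesgue_rV R n).-integrable [set: _] (fun z => (g z.1 * F z.2)%R%:E) /\
  \int[mu1 \x lebesgue_rV R n]_z (g z.1 * F z.2)%R%:E =
    (\int[mu1]_x (g x)%:E) * (\int[lebesgue_rV R n]_x (F x)%:E).
Proof.
move=> ig iF.
have mg : measurable_fun setT g by case/integrableP : ig => /measurable_EFinP.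
have mF : measurable_fun setT F by case/integrableP : iF => /measurable_EFinP.
have mG : measurable_fun setT (fun z : measurableTypeR R * 'rV[R]_n => (g z.1 * F z.2)%R%:E).
  apply/measurable_EFinP; apply: measurable_funM.
    exact: (measurableT_comp mg).
  exact: (measurableT_comp mF).
have iG : (mu1 \x lebesgue_rV R n).-integrable setT (fun z => (g z.1 * F z.2)%R%:E).
  apply: (integrable12ltyP mu1 (lebesgue_rV R n) mG).2.
  have Ffin : \int[lebesgue_rV R n]_y `|(F y)%:E| \is a fin_num.
    by rewrite ge0_fin_numE ?integral_ge0 //; case/integrableP : iF.
  under eq_integral => x _.
    under eq_integral => y _ do rewrite /= normrM EFinM.
    rewrite ge0_integralZl_EFin //; last first.
      by apply/measurable_EFinP; apply: measurableT_comp.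
    over.
  rewrite -(fineK Ffin); under eq_integral do rewrite muleC.
  rewrite ge0_integralZl_EFin //.
  - rewrite lte_mul_pinfty ?lee_fin ?fine_ge0 ?integral_ge0 //.
    by case/integrableP : ig.
  - by do 2 apply: measurableT_comp => //.
  - by rewrite fine_ge0 // integral_ge0.
split=> //; rewrite -integral12_prod_meas1 // /fubini_F /=.
under eq_integral => x _.
  under eq_integral => y _ do rewrite /= EFinM.
  rewrite integralZl //.
  over.
rewrite /=; have Ffin : \int[lebesgue_rV R n]_x (F x)%:E \is a fin_num.
  exact: integrable_fin_num.
by rewrite -(fineK Ffin) integralZr.
Qed.

(** Induction on the dimension, as [lebesgue_rV] is built as the image of a product measure under
    [rV_cons]. *)
Lemma prod_integral n (f : 'I_n -> R -> R) :
  (forall i, mu1.-integrable [set: R] (EFin \o f i)) ->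
  (lebesgue_rV R n).-integrable [set: 'rV[R]_n]
     (EFin \o (fun x => \prod_(i < n) f i (x 0%R i))%R) /\
  \int[lebesgue_rV R n]_x (\prod_(i < n) f i (x 0%R i))%R%:E =
    (\prod_(i < n) \int[mu1]_x f i x)%R%:E.
Proof.
elim: n f => [|n IH] f fi.
  rewrite big_ord0; split; last first.
    under eq_integral do rewrite big_ord0.
    by rewrite /= integral_dirac // diracT mul1e.
  rewrite (_ : EFin \o _ = cst 1); last by apply/funext => x /=; rewrite big_ord0.
  apply/integrableP; split=> //=.
  under eq_integral do rewrite normr1.
  by rewrite integral_dirac // diracT mul1e ltry.
have mfi i : measurable_fun setT (f i) by case/integrableP : (fi i) => /measurable_EFinP.
have [iF intF] := IH (fun i => f (lift ord0 i)) (fun i => fi _).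
have [iG intG] := integral_tensor (fi ord0) iF.
have E : (EFin \o (fun x : 'rV[R]_n.+1 => \prod_(i < n.+1) f i (x 0%R i))%R) \o @rV_cons R n
   = fun z => (f ord0 z.1 * \prod_(i < n) f (lift ord0 i) (z.2 0%R i))%R%:E.
  apply/funext => -[t x] /=; rewrite big_ord_recl mxE unlift_none /=.
  by congr (_ * _)%R%:E; apply: eq_bigr => i _; rewrite mxE liftK.
have mP := @measurable_prod_rV n.+1 f mfi.
have mPE : measurable_fun setT (EFin \o (fun x : 'rV[R]_n.+1 => \prod_(i < n.+1) f i (x 0%R i))%R).
  exact/measurable_EFinP.
have mc := @measurable_rV_cons R n.
split.
  apply: (integrable_pushforward mc mPE) => //.
  by rewrite preimage_setT E.
rewrite /= /lebesgue_rV_step (integral_pushforward mc mPE) //; last first.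
  by rewrite preimage_setT E.
rewrite preimage_setT E intG intF big_ord_recl EFinM.
congr (_ * _); rewrite /Rintegral fineK //.
exact: (integrable_fin_num measurableT (fi ord0)).
Qed.

End product_integrals.

Section hermite_basis.
Variables (R : realType) (d : nat).
Local Notation mu1 := (@lebesgue_measure R).
Local Notation mu := (lebesgue_rV R d).
Local Open Scope classical_set_scope.
Implicit Types (a b : 'I_d -> nat) (x : 'rV[R]_d) (j : 'I_d).

Definition hr a x : R := prodh a (fun i => x 0 i).

Lemma continuous_h n : continuous (@h R n).
Proof.
move=> t; apply: differentiable_continuous; apply/derivable1_diffP.
by have [] := isd_h n t.
Qed.

Lemma measurable_h n : measurable_fun [set: R] (@h R n).
Proof. by apply: continuous_measurable_fun => t; exact: continuous_h. Qed.

Lemma measurable_hr a : measurable_fun [set: 'rV[R]_d] (hr a).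
Proof. by apply: (@measurable_prod_rV R d (fun i => h (a i))) => i; exact: measurable_h. Qed.

Lemma hr_orthonormal a b :
  mu.-integrable [set: 'rV[R]_d] (EFin \o (fun x => hr a x * hr b x)) /\
  (\int[mu]_x (hr a x * hr b x)%:E)%E = ([forall i, a i == b i]%:R)%:E.
Proof.
have E x : hr a x * hr b x = \prod_(i < d) (h (a i) (x 0 i) * h (b i) (x 0 i)).
  by rewrite /hr /prodh -big_split.
have [I1 I2] := @prod_integral R d (fun i t => h (a i) t * h (b i) t)
  (fun i => h_integrable R (a i) (b i)).
split.
  rewrite (_ : EFin \o _ = EFin \o (fun x : 'rV[R]_d =>
    \prod_(i < d) (h (a i) (x 0 i) * h (b i) (x 0 i)))) //.
  by apply/funext => x /=; rewrite E.
under eq_integral do rewrite E.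
rewrite I2; congr _%:E; under eq_bigr do rewrite h_orthonormal.
have [/forallP ab|] := boolP [forall i, a i == b i].
  by rewrite big1 // => i _; rewrite ab.
rewrite negb_forall => /existsP[i /negPf abi].
by rewrite (bigD1 i) //= abi mul0r.
Qed.

Lemma continuous_hr a : continuous (hr a).
Proof.
rewrite /hr /prodh; elim: (index_enum _) => [|i r IH].
  rewrite (_ : (fun x => _) = cst 1); first exact: cst_continuous.
  by apply/funext => x; rewrite big_nil.
rewrite (_ : (fun x => _) = fun x : 'rV[R]_d =>
    h (a i) (x 0 i) * \prod_(i <- r) h (a i) (x 0 i)); last first.
  by apply/funext => x; rewrite big_cons.
move=> x; have C : {for x, continuous (h (a i) \o (fun x : 'rV[R]_d => x 0 i))}.
  by apply: continuous_comp; [exact: coord_continuous|exact: continuous_h].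
by apply: continuousM; [exact: C|exact: IH].
Qed.

(** The two difference quotients are the same function of [t], which transfers the one-variable
    calculus to partial derivatives. *)
Lemma is_derive_line (f : 'rV[R]_d -> R) x j (v : R) :
  isd (fun t => f (t *: e_ R j + x)) 0 v -> is_derive x (e_ R j) f v.
Proof.
move=> [H1 H2]; have E : (fun t => t^-1 *: (((fun t => f (t *: e_ R j + x)) \o shift 0) (t *: 1) - f (0 *: e_ R j + x))) =
   (fun t => t^-1 *: ((f \o shift x) (t *: e_ R j) - f x)).
  by apply/funext => t /=; rewrite addr0 scale0r add0r /GRing.scale /= mulr1.
split; first by move: H1; rewrite /derivable E.
by move: H2; rewrite /derive E.
Qed.

Definition upd a j n : 'I_d -> nat := fun i => if i == j then n else a i.

Lemma hrE a j x : hr a x = h (a j) (x 0 j) * \prod_(i < d | i != j) h (a i) (x 0 i).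
Proof. by rewrite /hr /prodh (bigD1 j). Qed.

Lemma hr_upd a j n x :
  hr (upd a j n) x = h n (x 0 j) * \prod_(i < d | i != j) h (a i) (x 0 i).
Proof.
rewrite (hrE _ j) /upd eqxx; congr (_ * _).
by apply: eq_bigr => i /negPf ->.
Qed.

Lemma is_derive_hr a j x : is_derive x (e_ R j) (hr a)
  (lad R (a j) * hr (upd a j (a j).-1) x - lad R (a j).+1 * hr (upd a j (a j).+1) x).
Proof.
apply: is_derive_line; rewrite !hr_upd.
have -> : (fun t => hr a (t *: e_ R j + x)) =
    fun t => h (a j) (t + x 0 j) * \prod_(i < d | i != j) h (a i) (x 0 i).
  apply/funext => t; rewrite (hrE a j) /e_ !mxE !eqxx mulr1; congr (_ * _).
  by apply: eq_bigr => i /negPf ij; rewrite /e_ !mxE ij mulr0 add0r.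
apply: isd_eq.
  apply: isdM; last exact: isd_cst.
  apply: (@isd_comp _ (fun t => t + x 0 j)); last exact: isd_h.
  by apply: isdD; [exact: isd_id|exact: isd_cst].
by rewrite add0r; ring.
Qed.

End hermite_basis.

(** * Finite combinations of Hermite functions *)

Section combinations.
Variables (R : realType) (d : nat).
Local Notation mu := (lebesgue_rV R d).
Local Notation Re := (@complex.Re R).
Local Notation Im := (@complex.Im R).
Local Open Scope classical_set_scope.
Local Open Scope complex_scope.
Implicit Types (a : 'I_d -> nat) (x : 'rV[R]_d) (j : 'I_d).
Implicit Types (l : seq (('I_d -> nat) * R[i])).

(* A finite combination is encoded by the list of its (multi-index, coefficient)
   pairs. *)
Definition lc l x : R[i] := \sum_(s <- l) s.2 * (hr s.1 x)%:C.

Definition rc (l : seq (('I_d -> nat) * R)) x : R := \sum_(s <- l) s.2 * hr s.1 x.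

(* [h_n' = lad n * h_(n-1) - lad n.+1 * h_(n+1)]: differentiation acts on the
   encodings. *)
Definition dlc j l := flatten [seq [::
  (upd s.1 j (s.1 j).-1, s.2 * (lad R (s.1 j))%:C);
  (upd s.1 j (s.1 j).+1, - s.2 * (lad R (s.1 j).+1)%:C)] | s <- l].

Definition drc j (l : seq (('I_d -> nat) * R)) := flatten [seq [::
  (upd s.1 j (s.1 j).-1, s.2 * (lad R (s.1 j)));
  (upd s.1 j (s.1 j).+1, - s.2 * (lad R (s.1 j).+1))] | s <- l].

Lemma Re_mulC (z : R[i]) (t : R) : Re (z * t%:C) = Re z * t.
Proof. by case: z => u v /=; rewrite mulr0 subr0. Qed.

Lemma Im_mulC (z : R[i]) (t : R) : Im (z * t%:C) = Im z * t.
Proof. by case: z => u v /=; rewrite mulr0 add0r. Qed.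

Lemma ReD (z w : R[i]) : Re (z + w) = Re z + Re w. Proof. by case: z; case: w. Qed.

Lemma ImD (z w : R[i]) : Im (z + w) = Im z + Im w. Proof. by case: z; case: w. Qed.

Lemma Re_lc l x : Re (lc l x) = rc [seq (s.1, Re s.2) | s <- l] x.
Proof.
rewrite /lc /rc big_map; elim: l => [|s l IH]; first by rewrite !big_nil.
by rewrite !big_cons ReD Re_mulC IH.
Qed.

Lemma Im_lc l x : Im (lc l x) = rc [seq (s.1, Im s.2) | s <- l] x.
Proof.
rewrite /lc /rc big_map; elim: l => [|s l IH]; first by rewrite !big_nil.
by rewrite !big_cons ImD Im_mulC IH.
Qed.

Lemma Re_lcE l : (fun x => Re (lc l x)) = rc [seq (s.1, Re s.2) | s <- l].
Proof. by apply/funext => x; exact: Re_lc. Qed.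

Lemma Im_lcE l : (fun x => Im (lc l x)) = rc [seq (s.1, Im s.2) | s <- l].
Proof. by apply/funext => x; exact: Im_lc. Qed.

Lemma continuous_rc (l : seq (('I_d -> nat) * R)) : continuous (rc l).
Proof.
rewrite /rc; elim: l => [|s l IH].
  rewrite (_ : (fun x => _) = cst 0); first exact: cst_continuous.
  by apply/funext => x; rewrite big_nil.
rewrite (_ : (fun x => _) = fun x => s.2 * hr s.1 x + rc l x); last first.
  by apply/funext => x; rewrite big_cons.
move=> x; have C : {for x, continuous (fun x => s.2 * hr s.1 x)}.
  by apply: continuousM; [exact: cst_continuous|exact: continuous_hr].
exact: (@continuousD R R^o _ (fun x => s.2 * hr s.1 x) (rc l) x C (IH x)).
Qed.

Lemma is_derive_rc (l : seq (('I_d -> nat) * R)) j x : is_derive x (e_ R j) (rc l) (rc (drc j l) x).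
Proof.
rewrite /rc /drc; elim: l => [|s l IH].
  rewrite (_ : (fun x => _) = cst 0); last by apply/funext => y; rewrite big_nil.
  by rewrite big_nil; exact: is_derive_cst.
rewrite (_ : (fun x => _) = (fun x => s.2 *: hr s.1 x) + rc l); last first.
  by apply/funext => y; rewrite big_cons.
have D1 := is_deriveZ s.2 (is_derive_hr s.1 j x).
have D := is_deriveD D1 IH; apply: is_derive_eq D _.
rewrite /= 2!big_cons addrA /=; congr (_ + _).
by rewrite /GRing.scale /=; ring.
Qed.

Lemma partial_lc j l : partial j (lc l) = lc (dlc j l).
Proof.
apply/funext => x; rewrite /partial.
rewrite Re_lcE Im_lcE.
have [_ ->] := is_derive_rc [seq (s.1, Re s.2) | s <- l] j x.
have [_ ->] := is_derive_rc [seq (s.1, Im s.2) | s <- l] j x.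
apply/eqP; rewrite eq_complex /= Re_lc Im_lc.
apply/andP; split; apply/eqP; congr (rc _ _); rewrite /drc /dlc map_flatten -!map_comp;
  congr flatten; apply: eq_map => -[b [u v]] /=; rewrite !mulr0 ?subr0 ?add0r //.
Qed.

Lemma ccontinuous_lc l : ccontinuous (lc l).
Proof. by split; rewrite ?Re_lcE ?Im_lcE; exact: continuous_rc. Qed.

Lemma Ck_lc k l : Ck k (lc l).
Proof.
elim: k l => [|k IH] l; first exact: ccontinuous_lc.
split=> [|j x|j]; first exact: ccontinuous_lc.
  have [dR _] := is_derive_rc [seq (s.1, Re s.2) | s <- l] j x.
  have [dI _] := is_derive_rc [seq (s.1, Im s.2) | s <- l] j x.
  by rewrite Re_lcE Im_lcE.
by rewrite partial_lc.
Qed.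

Lemma upd_upd a j n m : upd (upd a j n) j m = upd a j m.
Proof. by apply/funext => i; rewrite /upd; case: eqP. Qed.

Lemma updj a j n : upd a j n j = n.
Proof. by rewrite /upd eqxx. Qed.

(** The eigenvalue equation - h'' + t^2 h = (2 n + 1) h in the shape produced by two applications of
    [dlc]. For n = 0 the terms with truncated predecessors carry the factor [lad 0] = 0. *)
Lemma h_oscillator n (t : R) :
  - (lad R n * (lad R n.-1 * h n.-1.-1 t - lad R n.-1.+1 * h n.-1.+1 t) -
     lad R n.+1 * (lad R n.+1 * h n t - lad R n.+2 * h n.+2 t)) + t ^+ 2 * h n t =
  (2 * n + 1)%:R * h n t.
Proof.
have E2 := hS n.+1 t; have E1 := hS n t; rewrite -[n.+1.-1]/n in E2.
have -> : t ^+ 2 * h n t = lad R n.+1 * (t * h n.+1 t) + lad R n * (t * h n.-1 t).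
  by rewrite expr2 -mulrA (_ : t * h n t = lad R n.+1 * h n.+1 t + lad R n * h n.-1 t);
    [ring|rewrite E1; ring].
have -> : t * h n.+1 t = lad R n.+2 * h n.+2 t + lad R n.+1 * h n t by rewrite E2; ring.
have := ladK R n.+1; have := ladK R n; rewrite natrD natrM -[n.+1%:R]natr1.
case: n {E1 E2} => [|n] l1 l2.
  rewrite lad0 !mul0r.
  transitivity (2 * lad R 1 ^+ 2 * h 0 t); first by ring.
  by rewrite l2; field.
have E0 := hS n t; rewrite -[n.+1.-1]/n.
have -> : t * h n t = lad R n.+1 * h n.+1 t + lad R n * h n.-1 t by rewrite E0; ring.
transitivity ((2 * lad R n.+1 ^+ 2 + 2 * lad R n.+2 ^+ 2) * h n.+1 t); first by ring.
by rewrite l1 l2; field.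
Qed.

Lemma lc_oscillator l j x :
  - lc (dlc j (dlc j l)) x + (x 0 j ^+ 2)%:C * lc l x =
  \sum_(s <- l) (2 * s.1 j + 1)%:R * (s.2 * (hr s.1 x)%:C).
Proof.
rewrite /lc; elim: l => [|s l IH]; first by rewrite /dlc !big_nil mulr0 oppr0 addr0.
rewrite [in RHS]big_cons -IH /dlc /= !big_cons /= !upd_upd.
set S := \sum_(_ <- _) _; set T := \sum_(_ <- _) _.
rewrite !updj !hr_upd (hrE s.1 j); move: (\prod_(i < d | _) _) => p.
have := congr1 (fun t => (t * p)%:C) (h_oscillator (s.1 j) (x 0 j)) => /=.
rewrite !(rmorphM, rmorphD, rmorphN, rmorphB, rmorphXn, rmorph_nat) /= => E.
move/eqP: E; rewrite -subr_eq0 => /eqP/(congr1 (fun z => s.2 * z))/esym/=.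
rewrite mulr0 => E; rewrite -[RHS]addr0 [X in _ = _ + X]E; ring.
Qed.

Lemma harmonic_oscillator_lc l (lam : nat) x :
  (forall s, s \in [seq s.1 | s <- l] -> (\sum_(j < d) (2 * s j + 1))%N = lam) ->
  harmonic_oscillator (lc l) x = (lam%:R)%:C * lc l x.
Proof.
move=> H; rewrite /harmonic_oscillator.
under eq_bigr do rewrite !partial_lc lc_oscillator.
rewrite exchange_big /= /lc mulr_sumr big_seq [in RHS]big_seq.
apply: eq_bigr => s sl; rewrite -mulr_suml -natr_sum H ?map_f //.
by rewrite rmorph_nat.
Qed.

End combinations.

Section inner_products.
Variables (R : realType) (d : nat).
Local Notation mu := (lebesgue_rV R d).
Local Notation Re := (@complex.Re R).
Local Notation Im := (@complex.Im R).
Local Open Scope classical_set_scope.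
Local Open Scope complex_scope.
Implicit Types (l : seq (('I_d -> nat) * R[i])) (f : 'rV[R]_d -> R[i]).

Lemma Rintegral_hr_sum (L : seq (('I_d -> nat) * ('I_d -> nat) * R)) :
  mu.-integrable setT (EFin \o fun x => \sum_(q <- L) q.2 * (hr q.1.1 x * hr q.1.2 x)) /\
  \int[mu]_x (\sum_(q <- L) q.2 * (hr q.1.1 x * hr q.1.2 x)) =
    \sum_(q <- L) q.2 * ([forall i, q.1.1 i == q.1.2 i] : nat)%:R.
Proof.
elim: L => [|q L [IH1 IH2]].
  rewrite (_ : (fun x => _) = cst 0); last by apply/funext => x; rewrite big_nil.
  split; first exact: integrable0.
  by rewrite big_nil; rewrite /Rintegral integral0.
have [I1 I2] := hr_orthonormal R q.1.1 q.1.2.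
have I3 : mu.-integrable setT (EFin \o fun x => q.2 * (hr q.1.1 x * hr q.1.2 x)).
  rewrite (_ : EFin \o _ = fun x => (q.2%:E * (EFin \o (fun x => hr q.1.1 x * hr q.1.2 x)%R) x)%E) //.
  exact: integrableZl.
rewrite big_cons (_ : (fun x => _) = fun x => q.2 * (hr q.1.1 x * hr q.1.2 x) +
  \sum_(q <- L) q.2 * (hr q.1.1 x * hr q.1.2 x)); last first.
  by apply/funext => x; rewrite big_cons.
split.
  rewrite (_ : EFin \o _ = fun x => ((EFin \o (fun x => q.2 * (hr q.1.1 x * hr q.1.2 x))%R) x +
    (EFin \o (fun x => \sum_(q <- L) q.2 * (hr q.1.1 x * hr q.1.2 x))%R) x)%E) //.
  exact: integrableD.
rewrite RintegralD // IH2 RintegralZl //; congr (_ * _ + _).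
by rewrite /Rintegral I2.
Qed.

Lemma cintegral_hr_sum (L : seq (('I_d -> nat) * ('I_d -> nat) * R[i])) :
  cintegral (fun x => \sum_(q <- L) q.2 * (hr q.1.1 x * hr q.1.2 x)%:C) =
    \sum_(q <- L) q.2 * ([forall i, q.1.1 i == q.1.2 i] : nat)%:R.
Proof.
have ER (F : ('I_d -> nat) * ('I_d -> nat) -> R) :
   Re (\sum_(q <- L) q.2 * (F q.1)%:C) = \sum_(q <- [seq (q.1, Re q.2) | q <- L]) q.2 * F q.1.
  rewrite big_map; elim: (L) => [|q L' IH]; first by rewrite !big_nil.
  by rewrite !big_cons ReD Re_mulC IH.
have EI (F : ('I_d -> nat) * ('I_d -> nat) -> R) :
   Im (\sum_(q <- L) q.2 * (F q.1)%:C) = \sum_(q <- [seq (q.1, Im q.2) | q <- L]) q.2 * F q.1.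
  rewrite big_map; elim: (L) => [|q L' IH]; first by rewrite !big_nil.
  by rewrite !big_cons ImD Im_mulC IH.
have NE q : ([forall i, q.1 i == q.2 i] : nat)%:R = (([forall i : 'I_d, q.1 i == q.2 i :> nat] : nat)%:R : R)%:C.
  by rewrite rmorph_nat.
rewrite (eq_bigr _ (fun q _ => congr1 (fun z => q.2 * z) (NE q.1))).
rewrite /cintegral; apply/eqP; rewrite eq_complex; apply/andP; split; apply/eqP.
  rewrite (ER (fun q => ([forall i : 'I_d, q.1 i == q.2 i :> nat] : nat)%:R)) /=.
  rewrite -(Rintegral_hr_sum _).2; congr Rintegral; apply/funext => x.
  exact: (ER (fun q => hr q.1 x * hr q.2 x)).
rewrite (EI (fun q => ([forall i : 'I_d, q.1 i == q.2 i :> nat] : nat)%:R)) /=.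
rewrite -(Rintegral_hr_sum _).2; congr Rintegral; apply/funext => x.
exact: (EI (fun q => hr q.1 x * hr q.2 x)).
Qed.

Lemma conjcMr (z : R[i]) (t : R) : conjc (z * t%:C) = conjc z * t%:C.
Proof. by apply/eqP; rewrite eq_complex; case: z => u v /=; rewrite !mulr0 !(addr0, add0r, subr0) !mulNr !eqxx. Qed.

Lemma inner_lc l l' : inner (lc l) (lc l') =
  \sum_(s <- l) \sum_(t <- l') s.2 * conjc t.2 * ([forall i, s.1 i == t.1 i] : nat)%:R.
Proof.
rewrite /inner.
pose L := [seq ((s.1, t.1), s.2 * conjc t.2) | s <- l, t <- l'].
rewrite (_ : (fun x => _) = fun x => \sum_(q <- L) q.2 * (hr q.1.1 x * hr q.1.2 x)%:C).
  by rewrite cintegral_hr_sum /L big_allpairs_dep.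
apply/funext => x; rewrite /L big_allpairs_dep /lc raddf_sum mulr_suml.
apply: eq_bigr => s _; rewrite mulr_sumr; apply: eq_bigr => t _ /=.
by rewrite conjcMr mulrACA rmorphM.
Qed.

Definition L2sq f : \bar R := \int[mu]_x (Re (f x) ^+ 2 + Im (f x) ^+ 2)%:E.

Lemma L2sq_ge0 f : (0 <= L2sq f)%E.
Proof. by apply: integral_ge0 => x _; rewrite lee_fin addr_ge0 ?sqr_ge0. Qed.

Lemma L2normE f : L2norm f = (L2sq f `^ 2^-1)%E.
Proof.
rewrite /L2norm unlock; congr (_ `^ _)%E; apply: eq_integral => x _.
rewrite /modulus /=.
rewrite powR_mulrn ?normr_ge0 // real_normK ?num_real //; congr _%:E.
by case: (f x) => u v /=; rewrite sqr_sqrtr // addr_ge0 ?sqr_ge0.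
Qed.

Lemma L2norm_lt f (e : R) : 0 < e -> (L2sq f < (e ^+ 2)%:E)%E -> (L2norm f < e%:E)%E.
Proof.
move=> e0; rewrite L2normE; have := L2sq_ge0 f.
case: (L2sq f) => [r| |] //=; rewrite lee_fin lte_fin => r0 re.
rewrite lte_fin powR12_sqrt //.
rewrite -[ltRHS]ger0_norm ?(ltW e0) // -sqrtr_sqr ltr_sqrt //.
by rewrite exprn_gt0.
Qed.

Lemma L2norm_lty f : (L2norm f < +oo)%E = (L2sq f < +oo)%E.
Proof.
rewrite L2normE; apply/idP/idP; last exact: poweR_lty.
by apply: lty_poweRy; rewrite invr_neq0.
Qed.

Lemma L2sq_lc l : L2sq (lc l) = (Re (inner (lc l) (lc l)))%:E.
Proof.
have E x : Re (lc l x) ^+ 2 + Im (lc l x) ^+ 2 = Re (lc l x * conjc (lc l x)).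
  by case: (lc l x) => u v /=; rewrite mulrN opprK !expr2.
rewrite /L2sq (eq_integral _ _ (fun x _ => congr1 EFin (E x))).
rewrite /inner /cintegral /= /Rintegral fineK //.
pose L := [seq ((s.1, t.1), Re (s.2 * conjc t.2)) | s <- l, t <- l].
apply: integrable_fin_num => //.
rewrite (_ : (fun x => _) = EFin \o (fun x => \sum_(q <- L) q.2 * (hr q.1.1 x * hr q.1.2 x))).
  exact: (Rintegral_hr_sum L).1.
apply/funext => x /=; congr EFin.
have Re_sum (I : Type) (r : seq I) (F : I -> R[i]) : Re (\sum_(i <- r) F i) = \sum_(i <- r) Re (F i).
  by elim: r => [|i r IH]; rewrite ?big_nil // !big_cons ReD IH.
rewrite /L big_allpairs_dep /lc raddf_sum mulr_suml Re_sum.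
apply: eq_bigr => s _; rewrite mulr_sumr Re_sum; apply: eq_bigr => t _ /=.
by rewrite conjcMr mulrACA -rmorphM /= Re_mulC.
Qed.

Lemma measurable_rc (l : seq (('I_d -> nat) * R)) : measurable_fun setT (rc l).
Proof.
rewrite /rc; elim: l => [|s l IH].
  rewrite (_ : (fun x => _) = cst 0); first exact: measurable_cst.
  by apply/funext => x; rewrite big_nil.
rewrite (_ : (fun x => _) = fun x => s.2 * hr s.1 x + rc l x); last first.
  by apply/funext => x; rewrite big_cons.
apply: measurable_funD => //; apply: measurable_funM => //; exact: measurable_hr.
Qed.

Lemma L2_lc l : L2 (lc l).
Proof.
split; [by rewrite Re_lcE; exact: measurable_rc|by rewrite Im_lcE; exact: measurable_rc|].
by rewrite L2norm_lty L2sq_lc ltry.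
Qed.

End inner_products.

(** * Completeness of the Hermite functions *)

Section hermite_closure.
Variables (R : realType) (d : nat).
Local Notation mu := (lebesgue_rV R d).
Local Notation T := ('rV[R]_d).
Local Open Scope classical_set_scope.
Implicit Types (f g : 'rV[R]_d -> R) (l : seq (('I_d -> nat) * R)).

Definition sqn f : \bar R := (\int[mu]_x (f x ^+ 2)%:E)%E.

(** Membership in the closed real span of the Hermite functions, in terms of the squared norm.
    Measurability is included so that integrals of sums can be split. *)
Definition approx f := measurable_fun [set: T] f /\
  forall e : R, 0 < e -> exists l, (sqn (fun x => (f x - rc l x)%R) < e%:E)%E.

Lemma sqn_ge0 f : (0 <= sqn f)%E.
Proof. by apply: integral_ge0 => x _; rewrite lee_fin sqr_ge0. Qed.

Lemma measurable_sq f : measurable_fun [set: T] f ->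
  measurable_fun [set: T] (fun x => (f x ^+ 2)%:E).
Proof. by move=> mf; apply/measurable_EFinP; apply: measurable_funX. Qed.

Lemma sqnM (c : R) f : 0 <= c -> measurable_fun [set: T] f ->
  (\int[mu]_x (c%:E * (f x ^+ 2)%:E) = c%:E * sqn f)%E.
Proof.
move=> c0 mf; apply: ge0_integralZl_EFin => //; last exact: measurable_sq.
by move=> x _; rewrite lee_fin sqr_ge0.
Qed.

Lemma sqnZ (c : R) f : measurable_fun [set: T] f ->
  sqn (fun x => (c * f x)%R) = ((c ^+ 2)%:E * sqn f)%E.
Proof.
move=> mf; rewrite -sqnM ?sqr_ge0 //.
by apply: eq_integral => x _; rewrite exprMn EFinM.
Qed.

Lemma sqnD f g : measurable_fun [set: T] f -> measurable_fun [set: T] g ->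
  (sqn (fun x => (f x + g x)%R) <= 2%:E * sqn f + 2%:E * sqn g)%E.
Proof.
move=> mf mg.
rewrite -!sqnM // /sqn.
rewrite -ge0_integralD //; last first.
- by apply: measurable_funeM; exact: measurable_sq.
- by move=> x _; rewrite -EFinM lee_fin mulr_ge0 ?sqr_ge0.
- by apply: measurable_funeM; exact: measurable_sq.
- by move=> x _; rewrite -EFinM lee_fin mulr_ge0 ?sqr_ge0.
apply: ge0_le_integral => //.
- by move=> x _; rewrite lee_fin sqr_ge0.
- by apply: measurable_sq; exact: measurable_funD.
- by apply: emeasurable_funD; apply: measurable_funeM; exact: measurable_sq.
- move=> x _; rewrite -!EFinM -EFinD lee_fin.
  have := sqr_ge0 (f x - g x); nra.
Qed.

Lemma approx_closed f : measurable_fun [set: T] f ->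
  (forall e : R, 0 < e -> exists g, approx g /\ (sqn (fun x => (f x - g x)%R) < e%:E)%E) -> approx f.
Proof.
move=> mf H; split=> // e e0.
have e4 : 0 < e / 4 by rewrite divr_gt0.
have [g [[mg Vg] gf]] := H _ e4; have [l lg] := Vg _ e4; exists l.
rewrite (_ : (fun x => _) = fun x => (f x - g x) + (g x - rc l x)); last first.
  by apply/funext => x; rewrite addrA subrK.
have ml := measurable_rc l.
apply: le_lt_trans.
  apply: sqnD; first exact: measurable_funB.
  exact: measurable_funB.
rewrite (_ : e%:E = 2%:E * (e / 4)%:E + 2%:E * (e / 4)%:E)%E.
  by apply: lteD; rewrite lte_pmul2l.
by rewrite -!EFinM -EFinD; congr EFin; field.
Qed.

Lemma approx_rc l : approx (rc l).
Proof.
split; first exact: measurable_rc.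
move=> e e0; exists l; rewrite /sqn (eq_integral (cst 0%E)); last first.
  by move=> x _; rewrite subrr expr0n.
by rewrite integral0 lte_fin.
Qed.

Lemma approx_ext f g : f =1 g -> approx f -> approx g.
Proof. by move=> /funext ->. Qed.

Lemma rc_cat l1 l2 x : rc (l1 ++ l2) x = rc l1 x + rc l2 x.
Proof. by rewrite /rc big_cat. Qed.

Lemma rc_scale (c : R) l x : rc [seq (s.1, c * s.2) | s <- l] x = c * rc l x.
Proof. by rewrite /rc big_map mulr_sumr; apply: eq_bigr => s _; rewrite mulrA. Qed.

Lemma approx_add f g : approx f -> approx g -> approx (fun x => f x + g x).
Proof.
move=> [mf Vf] [mg Vg]; split; first exact: measurable_funD.
move=> e e0; have e4 : 0 < e / 4 by rewrite divr_gt0.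
have [l1 f1] := Vf _ e4; have [l2 g2] := Vg _ e4; exists (l1 ++ l2).
rewrite (_ : (fun x => _) = fun x => (f x - rc l1 x) + (g x - rc l2 x)); last first.
  by apply/funext => x; rewrite rc_cat; ring.
have m1 := measurable_rc l1; have m2 := measurable_rc l2.
apply: le_lt_trans.
  apply: sqnD; exact: measurable_funB.
rewrite (_ : e%:E = 2%:E * (e / 4)%:E + 2%:E * (e / 4)%:E)%E.
  by apply: lteD; rewrite lte_pmul2l.
by rewrite -!EFinM -EFinD; congr EFin; field.
Qed.

Lemma approx_scale (c : R) f : approx f -> approx (fun x => c * f x).
Proof.
move=> [mf Vf]; split; first exact: measurable_funM.
move=> e e0; have c1 : 0 < c ^+ 2 + 1 by have := sqr_ge0 c; lra.
have e4 : 0 < e / (c ^+ 2 + 1) by rewrite divr_gt0.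
have [l fl] := Vf _ e4; exists [seq (s.1, c * s.2) | s <- l].
rewrite (_ : (fun x => _) = fun x => c * (f x - rc l x)); last first.
  by apply/funext => x; rewrite rc_scale mulrBr.
rewrite sqnZ; last by apply: measurable_funB => //; exact: measurable_rc.
have := sqn_ge0 (fun x => f x - rc l x).
case: (sqn _) fl => [r| |] //; rewrite !lte_fin lee_fin => rl r0.
rewrite ltr_pdivlMr // in rl; apply: le_lt_trans rl.
by rewrite mulrC ler_wpM2l // lerDl.
Qed.

Lemma approx_sum (I : Type) (r : seq I) (F : I -> 'rV[R]_d -> R) :
  (forall i, approx (F i)) -> approx (fun x => \sum_(i <- r) F i x).
Proof.
move=> VF; elim: r => [|i r IH].
  by apply: (approx_ext _ (approx_rc [::])) => x; rewrite /rc !big_nil.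
by apply: (approx_ext _ (approx_add (VF i) IH)) => x; rewrite big_cons.
Qed.

(** Dominated convergence for (f - f_n)^2, with majorant 4 g^2. *)
Lemma approx_lim (f_ : nat -> 'rV[R]_d -> R) f g :
  (forall n, approx (f_ n)) -> (forall x, f_ ^~ x @ \oo --> f x) ->
  measurable_fun [set: T] g -> (sqn g < +oo)%E ->
  (forall n x, `|f_ n x| <= g x) -> approx f.
Proof.
move=> Vf cf mg ig fg.
have mf : measurable_fun [set: T] f.
  apply: (measurable_fun_cvg (h := f_)) => // n; exact: (Vf n).1.
apply: approx_closed => // e e0.
have fgl x : `|f x| <= g x.
  have C : (fun n => `|f_ n x|) @ \oo --> `|f x| by apply: cvg_norm; exact: cf.
  by rewrite -(cvg_lim _ C) //; apply: limr_le; [apply/cvg_ex; eexists; exact: C|exact: nearW].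
have g0 x : 0 <= g x by apply: le_trans (fgl x).
pose u n x := ((f x - f_ n x) ^+ 2)%:E.
have ig4 : mu.-integrable [set: T] (fun x => (4%:E * (g x ^+ 2)%:E)%E).
  apply: integrableZl => //; apply/integrableP; split; first exact: measurable_sq.
  apply: le_lt_trans ig; rewrite /sqn; apply: ge0_le_integral => //.
  - by apply: measurableT_comp => //; exact: measurable_sq.
  - exact: measurable_sq.
  - by move=> x _ /=; rewrite lee_fin ger0_norm // sqr_ge0.
have mfn n : measurable_fun [set: T] (f_ n) by exact: (Vf n).1.
have C : (\int[mu]_x u n x)%E @[n --> \oo] --> (\int[mu]_x (cst 0 x : \bar R))%E.
  have := @dominated_cvg _ _ R mu [set: T] measurableT u (cst 0%E)
    (fun x => (4%:E * (g x ^+ 2)%:E)%E); apply => //.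
  - by move=> n; apply: measurable_sq; exact: measurable_funB.
  - move=> x _; apply/cvg_EFin; first exact: nearW.
    rewrite (_ : _ \o _ = fun n => (f x - f_ n x) * (f x - f_ n x)); last first.
      by apply/funext => n; rewrite /= expr2.
    rewrite -(mulr0 (0 : R)); have C0 : (fun n => f x - f_ n x) @ \oo --> (0 : R).
      by rewrite -(subrr (f x)); apply: cvgB; [exact: cvg_cst|exact: cf].
    exact: cvgM.
  - move=> n x _; rewrite -EFinM /u lee_fin ger0_norm ?sqr_ge0 //.
    rewrite -[X in X <= _]real_normK ?num_real //.
    apply: le_trans (_ : (2 * g x) ^+ 2 <= _); last by rewrite exprMn -natrX.
    rewrite lerXn2r ?nnegrE ?mulr_ge0 // (le_trans (ler_normB _ _)) //.
    by rewrite mulr_natl mulr2n lerD.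
rewrite integral0 in C.
have /fine_cvgP[F /cvgrPdist_lt/(_ e e0) L] := C.
near \oo => n; exists (f_ n); split => //.
have Fn : (\int[mu]_x u n x)%E \is a fin_num by near: n; exact: F.
have Ln : `|0 - fine (\int[mu]_x u n x)%E| < e by near: n; exact: L.
rewrite /sqn -[ltLHS]/(\int[mu]_x u n x)%E -(fineK Fn) lte_fin.
by apply: le_lt_trans Ln; rewrite sub0r normrN ler_norm.
Unshelve. all: by end_near. Qed.

(* [x ^ al] times the Gaussian: these span the same space as the Hermite
   functions. *)
Definition wt (al : 'I_d -> nat) (x : 'rV[R]_d) : R :=
  (\prod_(i < d) x 0 i ^+ al i) * \prod_(i < d) gauss (x 0 i).

(** By the recurrence [hS], multiplication by a coordinate acts on the encodings of finite
    combinations. *)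
Lemma rc_coor l j : exists l', forall x, rc l' x = x 0 j * rc l x.
Proof.
elim: l => [|[a c] l [l' IH]].
  by exists [::] => x; rewrite /rc !big_nil mulr0.
exists [:: (upd a j (a j).+1, c * lad R (a j).+1),
           (upd a j (a j).-1, c * lad R (a j)) & l'] => x.
rewrite /rc !big_cons mulrDr -[X in _ = _ + X]IH addrA; congr (_ + _) => /=.
rewrite !hr_upd (hrE a j); have E := hS (a j) (x 0 j).
rewrite [in RHS]mulrCA [X in _ = c * X]mulrA.
rewrite (_ : x 0 j * h (a j) (x 0 j) =
  lad R (a j).+1 * h (a j).+1 (x 0 j) + lad R (a j) * h (a j).-1 (x 0 j)); first by ring.
by rewrite E; ring.
Qed.

(** The product of the h_0 is c0^d times the Gaussian; coordinates are then multiplied in one at a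
    time by [rc_coor]. *)
Lemma wt_span al : exists l, rc l = wt al.
Proof.
have c_neq0 : c0 R != 0 by rewrite gt_eqF // c0_gt0.
suff H (r : seq 'I_d) : exists l, rc l = fun x =>
    (\prod_(i <- r) x 0 i ^+ al i) * \prod_(i < d) gauss (x 0 i) by exact: H.
elim: r => [|j r [l IH]].
  exists [:: (fun=> 0%N, c0 R ^- d)]; apply/funext => x.
  rewrite /rc big_seq1 big_nil mul1r /= /hr /prodh.
  rewrite (eq_bigr (fun i => c0 R * gauss (x 0 i))); last first.
    by move=> i _; rewrite hE /= hornerC mulr1.
  by rewrite big_split prodr_const card_ord mulKf // expf_neq0.
have [l' El] : exists l', forall x, rc l' x = x 0 j ^+ al j * rc l x.
  elim: (al j) => [|k [l' IHk]]; first by exists l => x; rewrite mul1r.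
  have [l2 E2] := rc_coor l' j; exists l2 => x.
  by rewrite E2 IHk mulrA exprS.
by exists l'; apply/funext => x; rewrite El IH big_cons mulrA.
Qed.

Lemma wtE al x : wt al x = \prod_(i < d) (x 0 i ^+ al i * gauss (x 0 i)).
Proof. by rewrite /wt big_split. Qed.

Lemma wt_upd al j k x : wt (upd al j (al j + k)) x = x 0 j ^+ k * wt al x.
Proof.
rewrite /wt mulrA; congr (_ * _).
rewrite (bigD1 j) //= [in RHS](bigD1 j) //= updj exprD [in RHS]mulrCA -!mulrA.
congr (_ * (_ * _)); apply: eq_bigr => i /negPf ij; by rewrite /upd ij.
Qed.

(** Dominating function for [approx_lim]: t = 0 for bounded limits, t = 1 for partial sums of power
    series in one coordinate. *)
Definition majorant (C t : R) al (x : 'rV[R]_d) : R :=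
  C * \prod_(i < d) (`|x 0 i| ^+ al i * expR (t * `|x 0 i|) * gauss (x 0 i)).

Lemma measurable_majorant C t al : measurable_fun [set: T] (majorant C t al).
Proof.
apply: measurable_funM => //.
apply: (@measurable_prod_rV R d (fun i y => `|y| ^+ al i * expR (t * `|y|) * gauss y)) => i.
apply: measurable_funM; last exact: measurable_gauss.
apply: measurable_funM; first by apply: measurable_funX; exact: normr_measurable.
by apply: measurableT_comp => //; apply: measurable_funM => //; exact: normr_measurable.
Qed.

Lemma sqn_majorant C t al : (sqn (majorant C t al) < +oo)%E.
Proof.
pose u i y : R := (`|y| ^+ al i * expR (t * `|y|) * gauss y) ^+ 2.
have Iu i : (@lebesgue_measure R).-integrable setT (EFin \o u i).
  have [B B0 BH] := poly_gauss_bounded ('X^(2 * al i)) (2 * t).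
  apply: (@le_gauss_integrable R _ B).
    apply: measurable_funX.
    apply: measurable_funM; last exact: measurable_gauss.
    apply: measurable_funM; first by apply: measurable_funX; exact: normr_measurable.
    by apply: measurableT_comp => //; apply: measurable_funM => //; exact: normr_measurable.
  move=> y; have := BH y; rewrite hornerXn => H.
  rewrite ger0_norm ?sqr_ge0 //.
  have -> : u i y = `|y ^+ (2 * al i)| * expR (2 * t * `|y|) * gauss y * gauss y.
    by rewrite /u !exprMn normrX -exprM mulnC (_ : 2 * t * `|y| = t * `|y| + t * `|y|);
      [rewrite expRD; ring|ring].
  by rewrite ler_wpM2r // expR_ge0.
have M : measurable_fun [set: T] (fun x => \prod_(i < d) (`|x 0 i| ^+ al i * expR (t * `|x 0 i|) * gauss (x 0 i))).
  rewrite (_ : (fun x => _) = majorant 1 t al); first exact: measurable_majorant.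
  by apply/funext => x; rewrite /majorant mul1r.
rewrite /majorant sqnZ // lte_mul_pinfty ?lee_fin ?sqr_ge0 //.
have [/integrableP[_ H] _] := prod_integral Iu.
apply: le_lt_trans H; rewrite le_eqVlt; apply/orP; left; apply/eqP.
apply: eq_integral => x _ /=; congr EFin.
rewrite ger0_norm; last by apply: prodr_ge0 => i _; rewrite /u sqr_ge0.
by rewrite -prodrXl.
Qed.

End hermite_closure.

(** * Multipliers of the closed span *)

Section multipliers.
Variables (R : realType) (d : nat).
Local Notation mu := (lebesgue_rV R d).
Local Notation T := ('rV[R]_d).
Local Open Scope classical_set_scope.
Implicit Types (f g phi theta : 'rV[R]_d -> R) (al : 'I_d -> nat) (j : 'I_d).

Definition bdd f := exists C : R, forall x, `|f x| <= C.

(* [tame] is a module over the algebra [multiplier], which is closed under bounded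
   pointwise limits; asking for all the weights [x ^ al] lets the power series of
   [sin] and [cos] in a coordinate act on [tame] functions. *)
Definition tame phi := [/\ measurable_fun [set: T] phi, bdd phi &
  forall al, approx (fun x => phi x * wt al x)].

Definition multiplier theta := [/\ measurable_fun [set: T] theta, bdd theta &
  forall phi, tame phi -> forall al, approx (fun x => theta x * phi x * wt al x)].

Lemma tame1 : tame (fun=> 1).
Proof.
split; [exact: measurable_cst|by exists 1 => x; rewrite normr1|move=> al].
have [l lE] := wt_span R al; apply: (approx_ext _ (approx_rc l)) => x.
by rewrite lE mul1r.
Qed.

Lemma tame_mul theta phi : multiplier theta -> tame phi -> tame (fun x => theta x * phi x).
Proof.
move=> [mt [C tC] Mt] Bp; have [mp [D pD] _] := Bp; split.
- exact: measurable_funM.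
- by exists (C * D) => x; rewrite normrM ler_pM.
- exact: Mt.
Qed.

Lemma multiplier_cst (c : R) : multiplier (fun=> c).
Proof.
split; [exact: measurable_cst|by exists (`|c|) => x |move=> phi [_ _ Bp] al].
by apply: (approx_ext _ (approx_scale c (Bp al))) => x; rewrite mulrA.
Qed.

Lemma multiplier_add theta1 theta2 : multiplier theta1 -> multiplier theta2 -> multiplier (fun x => theta1 x + theta2 x).
Proof.
move=> [m1 [C1 b1] M1] [m2 [C2 b2] M2]; split.
- exact: measurable_funD.
- by exists (C1 + C2) => x; rewrite (le_trans (ler_normD _ _)) // lerD.
- move=> phi Bp al; apply: (approx_ext _ (approx_add (M1 _ Bp al) (M2 _ Bp al))) => x.
  by rewrite !mulrDl.
Qed.

Lemma multiplier_mul theta1 theta2 : multiplier theta1 -> multiplier theta2 -> multiplier (fun x => theta1 x * theta2 x).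
Proof.
move=> T1 T2; have [m1 [C1 b1] M1] := T1; have [m2 [C2 b2] M2] := T2; split.
- exact: measurable_funM.
- by exists (C1 * C2) => x; rewrite normrM ler_pM.
- move=> phi Bp al; apply: (approx_ext _ (M1 _ (tame_mul T2 Bp) al)) => x.
  by rewrite !mulrA.
Qed.

Lemma multiplier_ext theta1 theta2 : theta1 =1 theta2 -> multiplier theta1 -> multiplier theta2.
Proof. by move=> /funext ->. Qed.

Lemma multiplier_sum (I : Type) (r : seq I) (F : I -> 'rV[R]_d -> R) :
  (forall i, multiplier (F i)) -> multiplier (fun x => \sum_(i <- r) F i x).
Proof.
move=> MF; elim: r => [|i r IH].
  by apply: (multiplier_ext _ (multiplier_cst 0)) => x; rewrite big_nil.
by apply: (multiplier_ext _ (multiplier_add (MF i) IH)) => x; rewrite big_cons.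
Qed.

Lemma multiplier_exp theta n : multiplier theta -> multiplier (fun x => theta x ^+ n).
Proof.
move=> Mt; elim: n => [|n IH]; first exact: multiplier_cst 1.
by apply: (multiplier_ext _ (multiplier_mul Mt IH)) => x; rewrite exprS.
Qed.

Lemma wt_le al (x : T) : `|wt al x| <= majorant 1 0 al x.
Proof.
rewrite /majorant mul1r wtE normr_prod le_eqVlt; apply/orP; left; apply/eqP.
apply: eq_bigr => i _.
by rewrite normrM normrX mul0r expR0 mulr1 [`|gauss _|]ger0_norm ?expR_ge0.
Qed.

Lemma wt_exp_le al j (x : T) : expR `|x 0 j| * `|wt al x| <= majorant 1 1 al x.
Proof.
rewrite /majorant mul1r wtE normr_prod (bigD1 j) //= [leRHS](bigD1 j) //= mulrA.
apply: ler_pM; rewrite ?mulr_ge0 ?expR_ge0 //; first exact: prodr_ge0.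
  rewrite normrM normrX mul1r [`|gauss _|]ger0_norm ?expR_ge0 //.
  by rewrite mulrA [expR _ * _]mulrC.
apply: ler_prod => i _; rewrite normr_ge0 /= normrM normrX mul1r.
rewrite [`|gauss _|]ger0_norm ?expR_ge0 // ler_wpM2r ?expR_ge0 //.
by rewrite ler_peMr ?exprn_ge0 // -expR0 ler_expR.
Qed.

Lemma majorantM (C t : R) al (x : T) : majorant C t al x = C * majorant 1 t al x.
Proof. by rewrite /majorant mul1r. Qed.

Lemma multiplier_lim (theta_ : nat -> 'rV[R]_d -> R) theta (C : R) :
  (forall n, multiplier (theta_ n)) -> (forall x, theta_ ^~ x @ \oo --> theta x) ->
  (forall n x, `|theta_ n x| <= C) -> multiplier theta.
Proof.
move=> Mt ct tC.
have tCl x : `|theta x| <= C.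
  have Cx : (fun n => `|theta_ n x|) @ \oo --> `|theta x| by apply: cvg_norm; exact: ct.
  by rewrite -(cvg_lim _ Cx) //; apply: limr_le; [apply/cvg_ex; eexists; exact: Cx|exact: nearW].
split; [|by exists C|].
  apply: (measurable_fun_cvg (h := theta_)) => // n; by have [] := Mt n.
move=> phi Bp al; have [mp [D pD] _] := Bp.
apply: (@approx_lim R d (fun n x => theta_ n x * phi x * wt al x) _ (majorant (C * D) 0 al)).
- by move=> n; have [_ _] := Mt n; apply.
- move=> x; apply: cvgM; last exact: cvg_cst.
  by apply: cvgM; [exact: ct|exact: cvg_cst].
- exact: measurable_majorant.
- exact: sqn_majorant.
- move=> n x; rewrite majorantM normrM ler_pM ?wt_le //.
  by rewrite normrM ler_pM.
Qed.

Lemma partial_exp_le (y : R) (c : nat -> R) n :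
  (forall k, `|c k| <= (k`!%:R)^-1) ->
  `|\sum_(0 <= k < n) c k * y ^+ k| <= expR `|y|.
Proof.
move=> cb; apply: (@le_trans _ _ (series (exp_coeff `|y|) n)).
  rewrite /series /= (le_trans (ler_norm_sum _ _ _)) // ler_sum // => k _.
  by rewrite /exp_coeff /= normrM normrX mulrC ler_wpM2l // exprn_ge0.
rewrite /expR; apply: nondecreasing_cvgn_le; last exact: is_cvg_series_exp_coeff.
apply/nondecreasing_seqP => k; rewrite -subr_ge0 seriesSB.
by rewrite /exp_coeff /= divr_ge0 ?exprn_ge0.
Qed.

(** The partial sums are unbounded, hence not multipliers themselves in general, but powers of x_j
    can be moved into the weight. Coefficients at most 1 / k! keep the partial sums below e^|x_j|,
    which the Gaussian absorbs. *)
Lemma multiplier_pseries (c : nat -> R) (f : R -> R) (C : R) j :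
  (forall k, `|c k| <= (k`!%:R)^-1) ->
  (forall y, (fun n => \sum_(0 <= k < n) c k * y ^+ k) @ \oo --> f y) ->
  (forall y, `|f y| <= C) -> multiplier (fun x => f (x 0 j)).
Proof.
move=> cb cf fC.
have cn n : measurable_fun [set: T] (fun x : T => \sum_(0 <= k < n) c k * x 0 j ^+ k).
  apply: measurable_sum => k; apply: measurable_funM => //.
  by apply: measurable_funX; exact: (measurable_rV_coor j).
split; [|by exists C => x; exact: fC|].
  by apply: (measurable_fun_cvg (h := fun n (x : T) => \sum_(0 <= k < n) c k * x 0 j ^+ k)).
move=> phi [mp [D pD] Bp] al.
have D0 : 0 <= D by apply: le_trans (pD 0).
apply: (@approx_lim R d (fun n x => (\sum_(0 <= k < n) c k * x 0 j ^+ k) * phi x * wt al x) _ (majorant D 1 al)).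
- move=> n; apply: (approx_ext (f := fun x => \sum_(0 <= k < n) c k * (phi x * wt (upd al j (al j + k)) x))).
    by move=> x; rewrite !mulr_suml; apply: eq_bigr => k _; rewrite wt_upd; ring.
  by apply: approx_sum => k; apply: approx_scale; exact: Bp.
- move=> x; apply: cvgM; last exact: cvg_cst.
  by apply: cvgM; [exact: cf|exact: cvg_cst].
- exact: measurable_majorant.
- exact: sqn_majorant.
- move=> n x; rewrite majorantM 2!normrM.
  apply: le_trans (_ : expR `|x 0 j| * D * `|wt al x| <= _).
    by rewrite ler_wpM2r // ler_pM // partial_exp_le.
  by rewrite [expR _ * D]mulrC -mulrA ler_wpM2l // wt_exp_le.
Qed.

(** The condition on [t] keeps the coefficients below 1 / k!; the frequencies needed later are 1 /
    (n + 1). *)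
Lemma multiplier_sin j (t : R) : `|t| <= 1 -> multiplier (fun x => sin (t * x 0 j)).
Proof.
move=> t1; apply: (@multiplier_pseries (fun k => sin_coeff t k) (fun y => sin (t * y)) 1).
- move=> k; rewrite /sin_coeff /= !normrM normfV !normr_nat !normrX normrN normr1 expr1n mulr1.
  rewrite -[leRHS]mul1r ler_wpM2r ?invr_ge0 // mulr_ile1 ?exprn_ge0 ?ler_n1 ?exprn_ile1 //.
  by case: odd.
- move=> y; rewrite (_ : (fun n => _) = series (sin_coeff (t * y))).
    by have := @is_cvg_series_sin_coeff R (t * y); rewrite unlock.
  apply/funext => n; apply: eq_bigr => k _.
  by rewrite /sin_coeff /= exprMn; ring.
- by move=> y; rewrite ler_norml sin_geN1 sin_le1.
Qed.

Lemma multiplier_cos j (t : R) : `|t| <= 1 -> multiplier (fun x => cos (t * x 0 j)).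
Proof.
move=> t1; apply: (@multiplier_pseries (fun k => cos_coeff t k) (fun y => cos (t * y)) 1).
- move=> k; rewrite /cos_coeff /= !normrM normfV !normr_nat !normrX normrN normr1 expr1n mulr1.
  rewrite -[leRHS]mul1r ler_wpM2r ?invr_ge0 // mulr_ile1 ?exprn_ge0 ?ler_n1 ?exprn_ile1 //.
  by case: odd.
- move=> y; rewrite (_ : (fun n => _) = series (cos_coeff (t * y))).
    by have := @is_cvg_series_cos_coeff R (t * y); rewrite unlock.
  apply/funext => n; apply: eq_bigr => k _.
  by rewrite /cos_coeff /= exprMn; ring.
- by move=> y; rewrite ler_norml cos_geN1 cos_le1.
Qed.

(** As theta is bounded by some C, the partial sums are multipliers uniformly bounded by e^C. *)
Lemma multiplier_expR theta : multiplier theta -> multiplier (fun x => expR (theta x)).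
Proof.
move=> Mt; have [_ [C tC] _] := Mt.
apply: (@multiplier_lim (fun n x => \sum_(0 <= k < n) (k`!%:R)^-1 * theta x ^+ k) _ (expR C)).
- by move=> n; apply: multiplier_sum => k; apply: multiplier_mul; [exact: multiplier_cst|exact: multiplier_exp].
- move=> x; have := is_cvg_series_exp_coeff (theta x).
  rewrite [X in _ --> X]/expR (_ : (fun n => _) = series (exp_coeff (theta x))) //.
  by apply/funext => n; apply: eq_bigr => k _; rewrite /exp_coeff /= mulrC.
- move=> n x; apply: (le_trans (partial_exp_le _ _ _)).
    by move=> k; rewrite ger0_norm // invr_ge0.
  by rewrite ler_expR.
Qed.

(** A coordinate is unbounded, hence not a multiplier, but these bounded functions of it converge to
    it. The limit is the derivative of sin (t y) at t = 0 along t = 1 / (n + 1). *)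
Lemma cvg_sin_scaled (y : R) : (fun n => n.+1%:R * sin (n.+1%:R^-1 * y)) @ \oo --> y.
Proof.
have D : isd (fun t => sin (t * y)) 0 y.
  apply: isd_eq.
    apply: (@isd_comp _ (fun t => t * y) sin); last exact: is_derive_sin.
    by apply: isdM; [exact: isd_id|exact: isd_cst].
  by rewrite mul0r cos0; ring.
have [D1 D2] := D.
have L : (fun t => t^-1 *: (((fun t => sin (t * y)) \o shift 0) (t *: (1 : R)) - sin (0 * y)))
    @ 0^' --> y by rewrite -[X in _ --> X]D2; exact: D1.
have := (cvgr_dnbhsP _ _ _).1 L (fun n => n.+1%:R^-1).
rewrite (_ : (fun n => n.+1%:R * _) = fun n => n.+1%:R^-1^-1 *:
   (((fun t => sin (t * y)) \o shift 0) (n.+1%:R^-1 *: (1 : R)) - sin (0 * y))); last first.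
  by apply/funext => n; rewrite /= addr0 mul0r sin0 subr0 invrK /GRing.scale /= mulr1.
apply; split; last exact: cvg_harmonic.
by move=> n; rewrite invr_eq0 pnatr_eq0.
Qed.

Lemma cvg_scaled_harmonic (c : R) : (fun m : nat => c * m.+1%:R^-1) @ \oo --> (0 : R).
Proof.
have A := @cvg_harmonic R.
have H := @cvgM R _ _ _ (cst c) _ c 0 (cvg_cst c) A.
by rewrite mulr0 in H; exact: H.
Qed.

(* [exp (- m exp (- m y))] tends to the indicator of [y > 0], and
   [n sin ((x - a) / n)] tends to [y = x - a]. *)
Lemma multiplier_step j (a : R) : multiplier (\1_[set x : 'rV[R]_d | a < x 0 j]).
Proof.
pose E m (y : R) := expR (- (m%:R * expR (- (m%:R * y)))) : R.
have ME m : multiplier (fun x => E m (x 0 j - a)).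
  pose s n (x : 'rV[R]_d) := n.+1%:R * sin (n.+1%:R^-1 * (x 0 j - a)).
  have Ms n : multiplier (s n).
    apply: multiplier_mul; first exact: multiplier_cst.
    have n1 : `|n.+1%:R^-1| <= 1 :> R.
      by rewrite ger0_norm ?invr_ge0 // invf_le1 ?ltr0n // ler1n.
    apply: (multiplier_ext _ (multiplier_add (multiplier_mul (multiplier_sin j n1) (multiplier_cst (cos (n.+1%:R^-1 * a))))
      (multiplier_mul (multiplier_cst (-1)) (multiplier_mul (multiplier_cos j n1) (multiplier_cst (sin (n.+1%:R^-1 * a))))))) => x.
    by rewrite mulrBr sinB; ring.
  apply: (@multiplier_lim (fun n x => E m (s n x)) _ 1).
  - move=> n; apply: multiplier_expR; apply: (multiplier_ext _ (multiplier_mul (multiplier_cst (- m%:R)) (multiplier_expR (multiplier_mul (multiplier_cst (- m%:R)) (Ms n))))) => x.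
    by rewrite !mulNr.
  - move=> x; have C : continuous (E m).
      move=> y; apply: differentiable_continuous; apply/derivable1_diffP.
      have [//] : isd (E m) y (E m y * - (m%:R * (expR (- (m%:R * y)) * - m%:R))).
      apply: isd_eq.
        apply: isd_expR; apply: isdN; apply: isdM; first exact: isd_cst.
        apply: isd_expR; apply: isdN; apply: isdM; [exact: isd_cst|exact: isd_id].
      by rewrite /E; ring.
    have Cx : E m @ (x 0 j - a) --> E m (x 0 j - a) by exact: C.
    have H := cvg_comp _ _ (@cvg_sin_scaled (x 0 j - a)) Cx.
    exact: H.
  - move=> n x; rewrite ger0_norm ?expR_ge0 // /E -expR0 ler_expR oppr_le0.
    by rewrite mulr_ge0 ?expR_ge0.
have := @multiplier_lim (fun m x => E m.+1 (x 0 j - a)) (\1_[set x : 'rV[R]_d | a < x 0 j]) 1.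
apply; first by move=> n; exact: ME.
  2: {
  move=> n x; rewrite ger0_norm ?expR_ge0 // /E -expR0 ler_expR oppr_le0.
  by rewrite mulr_ge0 ?expR_ge0. }
have harm0 := cvg_scaled_harmonic.
move=> x; rewrite indicE; set y := x 0 j - a.
have [ax|ax] := ltP a (x 0 j); last first.
  rewrite memNset /=; last by apply/negP; rewrite -leNgt.
  apply: (squeeze_cvgr _ (cvg_cst 0) (harm0 1)); apply: nearW => m.
  rewrite expR_ge0 /= mul1r /E expRN lef_pV2 ?posrE ?expR_gt0 ?ltr0n //.
  apply: le_trans (expR_ge1Dx _); apply: (@le_trans _ _ (m.+1%:R * expR (- (m.+1%:R * y)))); last by rewrite lerDr.
  rewrite ler_peMr // -expR0 ler_expR oppr_ge0 mulr_ge0_le0 //.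
  by rewrite /y subr_le0.
rewrite mem_set //=.
have y0 : 0 < y by rewrite subr_gt0.
have c : expR @ (- (0 : R)) --> (1 : R).
  by rewrite -[X in _ --> X](expR0 R) -{2}[0 : R]oppr0; exact: continuous_expR.
have L : (fun m => - (m.+1%:R * expR (- (m.+1%:R * y)))) @ \oo --> - (0 : R).
  apply: cvgN; apply: (squeeze_cvgr _ (cvg_cst 0) (harm0 (2 / y ^+ 2))); apply: nearW => m.
  rewrite mulr_ge0 ?expR_ge0 //= expRN ler_pdivrMr ?expR_gt0 //.
  have := @exp_ge_pow R (m.+1%:R * y) 2; rewrite mulr_ge0 ?(ltW y0) // => /(_ isT) H.
  have m0 : 0 < m.+1%:R :> R by rewrite ltr0n.
  move: (m.+1%:R) m0 H => t t0; rewrite exprMn => H.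
  rewrite mulrAC ler_pdivlMr // mulrAC ler_pdivlMr ?exprn_gt0 //.
exact: (cvg_comp _ _ L c).
Qed.

End multipliers.

Section completeness.
Variables (R : realType) (d : nat).
Local Notation mu := (lebesgue_rV R d).
Local Notation T := ('rV[R]_d).
Local Open Scope classical_set_scope.
Implicit Types (f g phi theta : 'rV[R]_d -> R) (A : set 'rV[R]_d).

Lemma multiplier_setC A : multiplier (\1_A : T -> R) -> multiplier (\1_(setT `\` A) : T -> R).
Proof.
move=> MA; apply: (multiplier_ext _ (multiplier_add (multiplier_cst d 1) (multiplier_mul (multiplier_cst d (-1)) MA))) => x.
rewrite !indicE; have [Ax|Ax] := pselect (A x).
  by rewrite mem_set // memNset /=; [ring|case].
by rewrite memNset // mem_set //=; ring.
Qed.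

Lemma multiplier_setU (A1 A2 : set T) : multiplier (\1_A1 : T -> R) -> multiplier (\1_A2 : T -> R) -> multiplier (\1_(A1 `|` A2) : T -> R).
Proof.
move=> M1 M2; have M12 := multiplier_mul M1 M2.
apply: (multiplier_ext _ (multiplier_add (multiplier_add M1 M2) (multiplier_mul (multiplier_cst d (-1)) M12))) => x.
by rewrite !indicE in_setU; case: (_ \in A1); case: (_ \in A2) => /=; ring.
Qed.

Lemma multiplier_set0 : multiplier (\1_set0 : T -> R).
Proof. by apply: (multiplier_ext _ (multiplier_cst d 0)) => x; rewrite indic0. Qed.

Lemma multiplier_bigcup (F : (set T)^nat) : (forall n, multiplier (\1_(F n) : T -> R)) -> multiplier (\1_(\bigcup_n F n) : T -> R).
Proof.
move=> MF; apply: (@multiplier_lim R d (fun n => \1_(\big[setU/set0]_(k < n) F k)) _ 1).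
- elim=> [|n IH]; first by rewrite big_ord0; exact: multiplier_set0.
  by rewrite big_ord_recr /=; exact: multiplier_setU.
- move=> x; have [[k _ Fkx]|nF] := pselect ((\bigcup_n F n) x).
    apply: cvg_near_cst; exists k.+1 => // n /= kn; rewrite !indicE.
    rewrite mem_set; last by rewrite -bigcup_mkord; exists k.
    by rewrite mem_set //; exists k.
  apply: cvg_near_cst; apply: nearW => n; rewrite !indicE.
  rewrite memNset; last by rewrite -bigcup_mkord => -[k _ Fk]; apply: nF; exists k.
  by rewrite memNset.
- by move=> n x; rewrite indicE; case: (_ \in _); rewrite ?normr1 ?normr0.
Qed.

(** The sets whose indicator is a multiplier form a sigma-algebra. Generators are used twice: first
    preimages of Borel sets under coordinates, then open rays, for which [multiplier_step]
    applies. *)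
Lemma multiplier_indic A : measurable A -> multiplier (\1_A : T -> R).
Proof.
move=> mA; suff H : (@measurable _ T) `<=` [set A | multiplier (\1_A : T -> R)] by exact: H.
apply: smallest_sub.
  by split; [exact: multiplier_set0|move=> ?; exact: multiplier_setC|move=> ?; exact: multiplier_bigcup].
rewrite -bigcup_seq => _ [i _ [B0 mB <-]] /=; rewrite setTI.
suff H : (@measurable _ (measurableTypeR R)) `<=`
    [set B0 | multiplier (\1_(@rV_coor R d i @^-1` B0) : T -> R)] by exact: H.
rewrite [X in X `<=` _]RGenOInfty.measurableE; apply: smallest_sub.
  split => /=; first by rewrite preimage_set0; exact: multiplier_set0.
    by move=> A'; rewrite setTD preimage_setC -setTD; exact: multiplier_setC.
  by move=> F; rewrite preimage_bigcup; exact: multiplier_bigcup.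
move=> _ [a ->] /=.
rewrite (_ : _ @^-1` _ = [set x : T | a < x 0 i]); first exact: multiplier_step.
by apply/seteqP; split => x /=; rewrite /rV_coor in_itv /= andbT.
Qed.

(* The sum is the integer part of [n.+1 * y]. *)
Lemma floor_approx (n : nat) (y : R) : 0 <= y <= 1 ->
  `|y - n.+1%:R^-1 * \sum_(0 <= k < n.+1) ((k.+1%:R <= n.+1%:R * y)%R : nat)%:R| <= n.+1%:R^-1.
Proof.
move=> /andP[y0 y1].
have n0 : 0 < n.+1%:R :> R by rewrite ltr0n.
have ny0 : 0 <= n.+1%:R * y by rewrite mulr_ge0 // ltW.
pose t := Num.truncn (n.+1%:R * y).
have /andP[t1 t2] := truncn_itv ny0.
have tn : (t <= n.+1)%N.
  rewrite -(ler_nat R); apply: le_trans t1 _.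
  by rewrite ler_piMr // ltW.
have -> : \sum_(0 <= k < n.+1) ((k.+1%:R <= n.+1%:R * y)%R : nat)%:R = t%:R :> R.
  rewrite (big_cat_nat (leq0n t) tn) //= [X in _ + X]big_nat_cond [X in _ + X]big1 ?addr0.
    rewrite big_nat_cond (eq_bigr (fun=> 1)).
      by rewrite -big_nat_cond sumr_const_nat subn0.
    move=> k; rewrite andbT => /andP[_ kt].
    by rewrite (le_trans _ t1) ?ler_nat.
  move=> k; rewrite andbT => /andP[tk _].
  by rewrite leNgt (lt_le_trans t2) // ler_nat ltnS.
have i0 : 0 <= n.+1%:R^-1 :> R by rewrite invr_ge0.
rewrite -[X in X - _](mulKf (lt0r_neq0 n0)) -mulrBr normrM (ger0_norm i0).
rewrite -[X in _ <= X]mulr1 ler_wpM2l //.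
by rewrite ger0_norm ?subr_ge0 // lerBlDr addrC natr1 ltW.
Qed.

Lemma indic_pred (P : pred T) x : \1_[set x | P x] x = ((P x : nat)%:R : R).
Proof.
by rewrite indicE; have [Px|/negP Px] := boolP (P x); [rewrite mem_set|rewrite memNset].
Qed.

(** Layer cake: theta is within 1 / (n + 1) of the normalised sum of the indicators of its
    superlevel sets, by [floor_approx]. *)
Lemma multiplier_measurable01 theta : measurable_fun [set: T] theta ->
  (forall x, 0 <= theta x <= 1) -> multiplier theta.
Proof.
move=> mt t01.
pose A n k := [set x | k.+1%:R <= n.+1%:R * theta x].
apply: (@multiplier_lim R d (fun n x => n.+1%:R^-1 * \sum_(0 <= k < n.+1) \1_(A n k) x) _ 2).
- move=> n; apply: multiplier_mul; first exact: multiplier_cst.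
  apply: multiplier_sum => k; apply: multiplier_indic.
  rewrite (_ : A n k = theta @^-1` `[k.+1%:R / n.+1%:R, +oo[).
    by rewrite -[X in measurable X]setTI; exact: mt.
  apply/seteqP; split => x /=; rewrite /A /= in_itv /= andbT.
    by rewrite ler_pdivrMr ?ltr0n // mulrC.
  by rewrite ler_pdivrMr ?ltr0n // mulrC.
- move=> x; apply/cvgrPdist_le => e e0.
  have := @cvg_harmonic R; move=> /cvgrPdist_le/(_ e e0).
  apply: filterS => n /=; rewrite sub0r normrN ger0_norm ?invr_ge0 // => ne.
  apply: le_trans ne; rewrite (eq_bigr (fun k => ((k.+1%:R <= n.+1%:R * theta x)%R : nat)%:R)).
    exact: floor_approx.
  by move=> k _; exact: indic_pred.
- move=> n x; have := floor_approx n (t01 x).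
  rewrite (eq_bigr (fun k => \1_(A n k) x)); last first.
    by move=> k _; rewrite [RHS]indic_pred.
  move: (_ * _) => u; rewrite ler_norml ler_norml => /andP[u1 u2].
  have n1 : n.+1%:R^-1 <= 1 :> R by rewrite invf_le1 ?ltr0n // ler1n.
  have /andP[t0 t1] := t01 x.
  by move: (n.+1%:R^-1) u1 u2 n1 => v u1 u2 n1; apply/andP; split; lra.
Qed.

Lemma multiplier_measurable theta : measurable_fun [set: T] theta -> bdd theta -> multiplier theta.
Proof.
move=> mt [C tC].
have C0 : 0 <= C by apply: le_trans (tC 0).
have C1 : 0 < 2 * C + 1 by lra.
have H : multiplier (fun x => (theta x + C) * (2 * C + 1)^-1).
  apply: multiplier_measurable01.
    by apply: measurable_funM => //; exact: measurable_funD.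
  move=> x; have := tC x; rewrite ler_norml => /andP[t1 t2].
  rewrite divr_ge0 ?(ltW C1) //=; last by lra.
  by rewrite ler_pdivrMr //; lra.
apply: (multiplier_ext _ (multiplier_add (multiplier_mul (multiplier_cst d (2 * C + 1)) H) (multiplier_cst d (- C)))) => x.
by field; lra.
Qed.

Lemma wt0_gt0 (x : T) : 0 < wt (fun=> 0%N) x.
Proof. by rewrite wtE prodr_gt0 // => i _; rewrite mul1r expR_gt0. Qed.

Lemma measurable_wt al : measurable_fun [set: T] (wt al).
Proof. by have [l <-] := wt_span R al; exact: measurable_rc. Qed.

Lemma approx_L2 f : measurable_fun [set: T] f -> (sqn f < +oo)%E -> approx f.
Proof.
(* Truncate [f] to [|f| <= n G], with [G] the Gaussian. *)
move=> mf f2; pose G := @wt R d (fun=> 0%N).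
have mG : measurable_fun [set: T] G by exact: measurable_wt.
pose A n := [set x | `|f x| <= n%:R * G x].
have mA n : measurable (A n).
  rewrite (_ : A n = (fun x => n%:R * G x - `|f x|) @^-1` `[0, +oo[).
    rewrite -[X in measurable X]setTI.
    have : measurable_fun [set: T] (fun x => n%:R * G x - `|f x|).
      apply: measurable_funB; first exact: measurable_funM.
      by apply: measurableT_comp => //; exact: normr_measurable.
    exact.
  by apply/seteqP; split => x /=; rewrite /A /= in_itv /= andbT subr_ge0.
pose phi n x := f x * \1_(A n) x * (G x)^-1.
have pb n x : `|phi n x| <= n%:R.
  rewrite /phi !normrM indicE normfV (ger0_norm (ltW (wt0_gt0 x))).
  rewrite ler_pdivrMr ?wt0_gt0 //.
  have [Ax|Ax] := pselect (A n x); first by rewrite mem_set // normr1 mulr1.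
  by rewrite memNset // normr0 mulr0 mulr_ge0 // ltW // wt0_gt0.
apply: (@approx_lim R d (fun n x => phi n x * 1 * G x) _ (fun x => `|f x|)).
- move=> n; have [_ _ H] : multiplier (phi n).
    apply: multiplier_measurable; last by exists n%:R.
    apply: measurable_funM; first by apply: measurable_funM => //; exact: measurable_indic.
    rewrite (_ : (fun x => _) = (fun x => expR (- ln (G x)))).
      by apply: measurableT_comp => //; apply: measurable_funN; apply: measurableT_comp.
    by apply/funext => x; rewrite expRN lnK // posrE wt0_gt0.
  exact: H (@tame1 R d) (fun=> 0%N).
- move=> x; apply: cvg_near_cst; exists (Num.truncn (`|f x| / G x)).+1 => // n /= tn.
  rewrite /phi indicE mem_set; first by rewrite !mulr1 mulfVK // lt0r_neq0 // wt0_gt0.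
  rewrite /A /= -ler_pdivrMr ?wt0_gt0 //.
  have /andP[_ /ltW H] : (Num.truncn (`|f x| / G x))%:R <= `|f x| / G x < (Num.truncn (`|f x| / G x)).+1%:R.
    by apply: truncn_itv; rewrite divr_ge0 // ltW // wt0_gt0.
  by apply: le_trans H _; rewrite ler_nat.
- by apply: measurableT_comp => //; exact: normr_measurable.
- rewrite /sqn; under eq_integral do rewrite real_normK ?num_real //.
  exact: f2.
- move=> n x; rewrite mulr1 /phi mulfVK ?lt0r_neq0 ?wt0_gt0 //.
  rewrite normrM indicE ler_piMr //; by case: (_ \in _); rewrite ?normr1 ?normr0.
Qed.

End completeness.

Section density.
Variables (R : realType) (d : nat).
Local Notation mu := (lebesgue_rV R d).
Local Notation T := ('rV[R]_d).
Local Notation Re := (@complex.Re R).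
Local Notation Im := (@complex.Im R).
Local Open Scope classical_set_scope.
Local Open Scope complex_scope.
Implicit Types (f : 'rV[R]_d -> R[i]) (l : seq (('I_d -> nat) * R)).

Lemma lc_cat (l1 l2 : seq (('I_d -> nat) * R[i])) (x : T) : lc (l1 ++ l2) x = lc l1 x + lc l2 x :> R[i].
Proof. by rewrite /lc big_cat. Qed.

Lemma lc_parts l1 l2 (x : T) :
  lc ([seq (s.1, s.2%:C) | s <- l1] ++ [seq (s.1, 'i * s.2%:C) | s <- l2]) x =
  rc l1 x +i* rc l2 x.
Proof.
rewrite lc_cat /lc !big_map /= /rc [RHS]complexE /= !rmorph_sum mulr_sumr.
congr (_ + _); apply: eq_bigr => s _; first by rewrite rmorphM.
by rewrite rmorphM mulrA.
Qed.

Lemma hermite_dense f : L2 f -> forall e : R, 0 < e ->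
  exists l : seq (('I_d -> nat) * R[i]), (L2norm (fun x => (f x - lc l x)%R) < e%:E)%E.
Proof.
move=> [mR mI]; rewrite L2norm_lty => fin e e0.
have VR : approx (fun x => Re (f x)).
  apply: approx_L2 => //; apply: le_lt_trans fin; apply: ge0_le_integral => //.
  - by move=> x _; rewrite lee_fin sqr_ge0.
  - exact: measurable_sq.
  - by apply/measurable_EFinP; apply: measurable_funD; exact: measurable_funX.
  - by move=> x _; rewrite lee_fin lerDl sqr_ge0.
have VI : approx (fun x => Im (f x)).
  apply: approx_L2 => //; apply: le_lt_trans fin; apply: ge0_le_integral => //.
  - by move=> x _; rewrite lee_fin sqr_ge0.
  - exact: measurable_sq.
  - by apply/measurable_EFinP; apply: measurable_funD; exact: measurable_funX.
  - by move=> x _; rewrite lee_fin lerDr sqr_ge0.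
have e2 : 0 < e ^+ 2 / 2 by rewrite divr_gt0 // exprn_gt0.
have [l1 H1] := VR.2 _ e2; have [l2 H2] := VI.2 _ e2.
exists ([seq (s.1, s.2%:C) | s <- l1] ++ [seq (s.1, 'i * s.2%:C) | s <- l2]).
apply: L2norm_lt => //; rewrite /L2sq.
rewrite (eq_integral (fun x => ((Re (f x) - rc l1 x) ^+ 2)%:E + ((Im (f x) - rc l2 x) ^+ 2)%:E)%E); last first.
  by move=> x _; rewrite lc_parts; case: (f x) => u v /=; rewrite EFinD.
have m1 := measurable_rc l1; have m2 := measurable_rc l2.
rewrite ge0_integralD //; last first.
- by apply: measurable_sq; exact: measurable_funB.
- by move=> x _; rewrite lee_fin sqr_ge0.
- by apply: measurable_sq; exact: measurable_funB.
- by move=> x _; rewrite lee_fin sqr_ge0.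
rewrite (_ : (e ^+ 2)%:E = (e ^+ 2 / 2)%:E + (e ^+ 2 / 2)%:E)%E; first exact: lteD.
by rewrite -EFinD -splitr.
Qed.

End density.

(** * Enumeration of the levels *)

Section enumeration.
Variable N : nat -> nat.
Hypothesis N0 : forall k, (0 < N k)%N.

(** Lexicographic walk through the pairs (k, j) with j < [N k]; positivity of [N] ensures that it
    always lands on such a pair. [offset] below is the inverse of the resulting enumeration. *)
Definition next (p : nat * nat) :=
  if (p.2.+1 < N p.1)%N then (p.1, p.2.+1) else (p.1.+1, 0%N).

Definition enu n := iter n next (0%N, 0%N).

Definition offset (p : nat * nat) := (\sum_(0 <= i < p.1) N i + p.2)%N.

Lemma enu_lt n : ((enu n).2 < N (enu n).1)%N.
Proof. by elim: n => [|n IH] //=; rewrite /next; case: ifP. Qed.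

Lemma offset_enu n : offset (enu n) = n.
Proof.
elim: n => [|n IH]; first by rewrite /offset big_geq.
have := enu_lt n; rewrite /= -[in RHS]IH /next.
case: (enu n) => k j /= jN; case: ifP => H; first by rewrite /offset addnS.
rewrite /offset big_nat_recr //= addn0 -addnS; congr addn.
by apply/eqP; rewrite eqn_leq jN leqNgt H.
Qed.

Lemma offset_inj p q : (p.2 < N p.1)%N -> (q.2 < N q.1)%N ->
  offset p = offset q -> p = q.
Proof.
have H k j k' j' : (j < N k)%N -> (k < k')%N -> (offset (k, j) < offset (k', j'))%N.
  move=> jN kk'; rewrite /offset /= (big_cat_nat (leq0n k.+1) kk') /= big_nat_recr //=.
  by rewrite -!addnA ltn_add2l ltn_addr.
case: p q => [k j] [k' j'] /= jN jN' E.
have [kk'|kk'|kk'] := ltngtP k k'.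
- by have := H _ _ _ j' jN kk'; rewrite E ltnn.
- by have := H _ _ _ j jN' kk'; rewrite E ltnn.
by move: E; rewrite kk' /offset /= => /addnI ->.
Qed.

Lemma enu_offset p : (p.2 < N p.1)%N -> enu (offset p) = p.
Proof. by move=> pN; apply: offset_inj => //; [exact: enu_lt|rewrite offset_enu]. Qed.

Lemma enu_inj : injective enu.
Proof. by move=> m n E; rewrite -(offset_enu m) E offset_enu. Qed.

Lemma enu_homo : {homo (fun n => (enu n).1) : m n / (m <= n)%N}.
Proof.
apply: homo_leq => [//|m n p|n]; first exact: leq_trans.
by rewrite /= /next; case: ifP.
Qed.

End enumeration.

(** * The basis *)

Section assembly.
Variables (R : realType) (d : nat).
Local Notation T := ('rV[R]_d).
Local Open Scope complex_scope.

Definition mindex k (a : 'I_#|mi d k|) : 'I_d -> nat := fun i => enum_val a i.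

Lemma sum_mindex k (a : 'I_#|mi d k|) : (\sum_(i < d) mindex a i)%N = k.
Proof. by have := enum_valP a; rewrite inE => /eqP. Qed.

Lemma mindex_inj k : injective (@mindex k).
Proof.
move=> a b ab; apply: enum_val_inj; apply/ffunP => i; apply: val_inj.
exact: (congr1 (fun u => u i) ab).
Qed.

Lemma mindex_onto (a : 'I_d -> nat) : exists b : 'I_#|mi d (\sum_(i < d) a i)|, mindex b = a.
Proof.
set k := (\sum_(i < d) a i)%N.
have ak i : (a i < k.+1)%N by rewrite ltnS /k (bigD1 i) //= leq_addr.
pose b := [ffun i => Ordinal (ak i)].
have bm : b \in mi d k.
  by rewrite inE; apply/eqP; apply: eq_bigr => i _; rewrite ffunE.
exists (enum_rank_in bm b); apply/funext => i.
by rewrite /mindex enum_rankK_in // ffunE.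
Qed.

Lemma forall_eq_mindex k k' (a : 'I_#|mi d k|) (b : 'I_#|mi d k'|) :
  [forall i, mindex a i == mindex b i] -> k = k'.
Proof.
by move=> /forallP H; rewrite -(sum_mindex a) -(sum_mindex b); apply: eq_bigr => i _; exact/eqP.
Qed.

Variable U : forall k, 'M[R[i]]_#|mi d k|.
Hypothesis UU : forall k, U k *m (map_mx conjc (U k))^T = 1%:M.

Definition block k (j : 'I_#|mi d k|) : seq (('I_d -> nat) * R[i]) :=
  [seq (mindex a, U k j a) | a <- index_enum 'I_#|mi d k|].

(* Empty outside the range [p.2 < #|mi d p.1|]. *)
Definition phis (p : nat * nat) : seq (('I_d -> nat) * R[i]) :=
  oapp (@block p.1) [::] (insub p.2).

Lemma phisE k (j : 'I_#|mi d k|) : phis (k, val j) = block j.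
Proof. by rewrite /phis /= valK. Qed.

(** Distinct levels share no multi-index; within one level the Gram matrix is the product of [U k]
    with its adjoint. *)
Lemma inner_block k k' (j : 'I_#|mi d k|) (j' : 'I_#|mi d k'|) :
  inner (lc (block j)) (lc (block j')) = ((k, val j) == (k', val j'))%:R.
Proof.
rewrite inner_lc /block big_map.
have [kk'|kk'] := eqVneq k k'; last first.
  rewrite xpair_eqE (negPf kk') /= big1 // => a _; rewrite big_map big1 // => b _ /=.
  case: forallP => [/forallP/forall_eq_mindex/eqP|]; first by rewrite (negPf kk').
  by rewrite mulr0.
case: _ / kk' in j' *.
rewrite xpair_eqE eqxx /= (_ : (_ == _) = (j == j')) //.
have := congr1 (fun A => fun_of_matrix A j j') (UU k).
rewrite !mxE => <-; apply: eq_bigr => a _; rewrite big_map (bigD1 a) //= !mxE.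
rewrite big1 ?addr0 => [|b ba].
  by case: forallP => [_|[]] //; rewrite mulr1.
case: forallP => [H|_]; last by rewrite mulr0.
have ab : mindex a = mindex b by apply/funext => i; exact/eqP.
by rewrite (mindex_inj ab) eqxx in ba.
Qed.

(** A right inverse of a square matrix is also a left inverse, so the adjoint of [U k] undoes the
    change of basis. *)
Lemma block_span k (b : 'I_#|mi d k|) (x : T) :
  (hr (mindex b) x)%:C = \sum_j conjc (U k j b) * lc (block j) x.
Proof.
have V := mulmx1C (UU k).
under eq_bigr do rewrite /lc big_map mulr_sumr.
rewrite exchange_big /=.
rewrite (eq_bigr (fun a => (a == b)%:R * (hr (mindex a) x)%:C)); last first.
  move=> a _; have := congr1 (fun A => fun_of_matrix A b a) V.
  rewrite !mxE [b == a]eq_sym => <-; rewrite mulr_suml; apply: eq_bigr => j _.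
  by rewrite !mxE mulrA.
rewrite (bigD1 b) //= eqxx mul1r big1 ?addr0 // => a /negPf ->.
by rewrite mul0r.
Qed.

Hypothesis N0 : forall k, (0 < #|mi d k|)%N.
Let N k := #|mi d k|.

Definition basis n : T -> R[i] := lc (phis (enu N n)).

Definition level n := (2 * (enu N n).1 + d)%N.

Lemma enuP n : exists k (j : 'I_#|mi d k|), enu N n = (k, val j).
Proof.
have := enu_lt N0 n; case: (enu N n) => k j /= jN.
by exists k, (Ordinal jN).
Qed.

Lemma basis_orthonormal m n : inner (basis m) (basis n) = (m == n)%:R.
Proof.
have [k [j E]] := enuP m; have [k' [j' E']] := enuP n.
rewrite /basis E E' !phisE inner_block -E -E'.
by rewrite (inj_eq (enu_inj N0)).
Qed.

Definition in_span (f : T -> R[i]) := exists n (c : nat -> R[i]),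
  forall x, f x = \sum_(k < n) c k * basis k x.

Lemma span_scale (c0 : R[i]) f : in_span f -> in_span (fun x => c0 * f x).
Proof.
move=> [n [c H]]; exists n, (fun k => c0 * c k) => x.
by rewrite H mulr_sumr; apply: eq_bigr => k _; rewrite mulrA.
Qed.

Lemma span_widen n m (c : nat -> R[i]) : (n <= m)%N ->
  exists c' : nat -> R[i], forall x : T,
  \sum_(k < n) c k * basis k x = \sum_(k < m) c' k * basis k x.
Proof.
move=> nm; exists (fun k => if (k < n)%N then c k else 0) => x.
rewrite (big_ord_widen _ (fun k => c k * basis k x) nm) big_mkcond /=.
by apply: eq_bigr => k _; case: ifP => _; rewrite ?mul0r.
Qed.

Lemma span_add f g : in_span f -> in_span g -> in_span (fun x => f x + g x).
Proof.
move=> [n [c Hf]] [m [c' Hg]].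
have [u Eu] := span_widen c (leq_maxl n m).
have [v Ev] := span_widen c' (leq_maxr n m).
exists (maxn n m), (fun k => u k + v k) => x.
by rewrite Hf Hg Eu Ev -big_split; apply: eq_bigr => k _; rewrite mulrDl.
Qed.

Lemma span_sum (I : Type) (r : seq I) (F : I -> T -> R[i]) :
  (forall i, in_span (F i)) -> in_span (fun x => \sum_(i <- r) F i x).
Proof.
move=> HF; elim: r => [|i r IH].
  by exists 0%N, (fun=> 0) => x; rewrite big_nil big_ord0.
have [n [c H]] := span_add (HF i) IH; exists n, c => x; by rewrite big_cons H.
Qed.

Lemma span_basis n : in_span (basis n).
Proof.
exists n.+1, (fun k => (k == n)%:R) => x.
rewrite big_ord_recr /= eqxx mul1r big1 ?add0r // => k _.
by rewrite ltn_eqF ?mul0r.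
Qed.

(** The block of the weight of [a] expresses it, and each function of that block occurs in the
    enumeration at its [offset]. *)
Lemma span_hr a : in_span (fun x => (hr a x)%:C).
Proof.
have [b ba] := mindex_onto a; rewrite -ba.
rewrite (_ : (fun x => _) = fun x => \sum_j conjc (U _ j b) * lc (block j) x); last first.
  by apply/funext => x; rewrite block_span.
apply: span_sum => j; apply: span_scale.
have -> : lc (block j) = basis (offset N (\sum_(i < d) a i, val j)%N).
  by rewrite /basis (enu_offset N0) ?phisE //=; exact: ltn_ord.
exact: span_basis.
Qed.

Lemma span_lc l : in_span (lc l).
Proof. by apply: span_sum => s; apply: span_scale; exact: span_hr. Qed.

Lemma basis_hilbert : hilbert_basis basis.
Proof.
split; [by move=> n; exact: L2_lc|exact: basis_orthonormal|move=> f f2 e e0].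
have [l Hl] := hermite_dense f2 e0; have [n [c E]] := span_lc l.
exists n, c; rewrite (_ : (fun x => _) = fun x => f x - lc l x) //.
by apply/funext => x; rewrite E.
Qed.

(** A function vanishing everywhere would contradict orthonormality. The eigenvalue is the sum of
    the 2 a_i + 1, which depends on the weight of the multi-index alone. *)
Lemma basis_eigenfunction n : eigenfunction (level n)%:R (basis n).
Proof.
split; [exact: L2_lc|exact: Ck_lc| |].
  apply: contrapT => H.
  have := basis_orthonormal n n; rewrite eqxx.
  rewrite /inner (_ : (fun x => _) = fun=> 0); last first.
    apply/funext => x; apply/eqP; rewrite mulf_eq0; apply/orP; left.
    by apply/negPn/negP => nz; apply: H; exists x.
  rewrite /cintegral /= /Rintegral !integral0 /= => /eqP.
  by rewrite eq_complex /= eq_sym oner_eq0.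
move=> x; apply: harmonic_oscillator_lc => s.
have [k [j E]] := enuP n; rewrite /level E phisE /block -map_comp => /mapP[a _ ->] /=.
rewrite big_split /= -big_distrr /= sum_mindex sum_nat_const card_ord muln1 //.
Qed.

Lemma basis_norm n : L2norm (basis n) = 1%:E.
Proof.
by rewrite L2normE /basis L2sq_lc -/(basis n) basis_orthonormal eqxx /= powR1.
Qed.

Lemma basis_Linf n C : (forall k j X, Normc.normc (\sum_a U k j a * (prodh (mindex a) X)%:C) <= C k) ->
  (Linfnorm (basis n) <= (C (enu N n).1)%:E)%E.
Proof.
move=> H; have [k [j E]] := enuP n; rewrite /basis E phisE /=.
have B (x : T) : Normc.normc (lc (block j) x) <= C k.
  by rewrite /lc /block big_map; exact: H.
rewrite /Linfnorm unlock; case: ifP => _.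
  apply/ess_supP; apply: nearW => x; rewrite /modulus /= lee_fin.
  by rewrite ger0_norm ?B //; case: (lc _ x) => u v; exact: sqrtr_ge0.
(* In this branch the norm takes its default value 0. *)
rewrite lee_fin; apply: le_trans (B 0).
by case: (lc _ 0) => u v; exact: sqrtr_ge0.
Qed.

End assembly.

Theorem theorem1p3 (R : realType) (d : nat) (hd : (2 <= d)%N) :
  exists (phi : nat -> 'rV[R]_d -> R[i]) (lambda : nat -> R),
    [/\ hilbert_basis phi,
        forall n, eigenfunction (lambda n) (phi n),
        {homo lambda : m n / (m <= n)%N >-> m <= n},
        forall n, L2norm (phi n) = 1%:E &
        exists2 M : R, 0 < M &
          forall n, (Linfnorm (phi n) <=
            ((M * lambda n `^ (- (d%:R / 4%:R)) *
             (1 + ln (lambda n)) `^ (2%:R^-1))%R)%:E)%E].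
Proof.
case: d hd => [|[|m]] // _; set d := m.+2.
have [M M0 H] := flat_basis R m.
pose U k := projT1 (cid (H k)).
have UU k : U k *m (map_mx conjc (U k))^T = 1%:M by exact: (projT2 (cid (H k))).1.
have UB k : forall j X, Normc.normc (\sum_a U k j a * (prodh (mindex a) X)%:C)%C <=
    M * (2 * k + d)%:R `^ (- (d%:R / 4)) * (1 + ln (2 * k + d)%:R) `^ 2^-1.
  exact: (projT2 (cid (H k))).2.
have N0 k : (0 < #|mi d k|)%N by apply: leq_trans (card_mi_ge m k); rewrite expn_gt0.
exists (basis U), (fun n => (level d n)%:R); split.
- exact: basis_hilbert.
- exact: basis_eigenfunction.
- move=> p q pq; rewrite ler_nat leq_add2r leq_mul2l /=.
  exact: (enu_homo (fun k => #|mi d k|) pq).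
- exact: basis_norm.
- exists M => // n; exact: (@basis_Linf _ _ U N0 n (fun k => M * (2 * k + d)%:R `^ (- (d%:R / 4)) *
    (1 + ln (2 * k + d)%:R) `^ 2^-1) UB).
Qed.
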